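(* For $\theta>0$, let $\mathbb{P}_\theta$ be the probability measure on the set $[0,1]^{\mathbb{N}}$ of infinite sequences in $[0,1]$ (with its Borel $\sigma$-algebra) such that, for $(U_i)_{i\ge 1}$ following the law $\mathbb{P}_\theta$: (a) $U_1$ is Beta distributed with parameters $\theta$ and $1$; (b) for every $n\ge 1$, conditionally on $(U_1,\dots,U_n)$, with $\min(U_1,\dots,U_n)=r$, the distribution of $U_{n+1}$ is the mixture with weights $r$ and $1-r$ of the distribution of $r$ times a Beta$(\theta,1)$ variable and the uniform distribution on $[r,1]$, i.e. it has density $$\frac{\mathbb{P}_\theta(U_{n+1}\in du \mid \min(U_1,\dots,U_n)=r)}{du}=\theta\left(\frac{u}{r}\right)^{\theta-1}\mathbf{1}(u<r)+\mathbf{1}(u\ge r),\qquad 0<u<1.$$ (In particular, for every $\theta>0$, the conditional probability of a new lower record at time $n+1$, given $(U_1,\dots,U_n)$, is $\min(U_1,\dots,U_n)$.) Then the following statements hold for every $\theta>0$: 1. For every $n\ge 1$, the law of $(U_1,\dots,U_n)$ under $\mathbb{P}_\theta$ is absolutely continuous with respect to the Lebesgue measure on $[0,1]^n$, with density $$\frac{d\mathbb{P}_\theta}{d\mathbb{P}_1}(u_1,\dots,u_n)=\theta^{K_n}\,\min(u_1,\dots,u_n)^{\theta-1},$$ where $K_n$ is the number of lower records in the sequence $(u_1,\dots,u_n)$. In particular, under $\mathbb{P}_1$, the variables $(U_i)_{i\ge1}$ are i.i.d. uniform on $[0,1]$. 2. If $(U_i)_{i\ge1}$ follows the law $\mathbb{P}_\theta$,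 then almost surely this sequence has no smallest element and the $U_i$ are pairwise distinct, and the inter-record stretches $(V_k)_{k\ge1}$ of $(U_i)_{i\ge 1}$ form a Poisson point process on $\bigcup_{\ell=1}^\infty[0,1]^\ell$ with mean measure $\theta\mu(\bullet)$, where $$\mu(\bullet)=\sum_{\ell=1}^\infty\frac{P_\ell(\bullet)}{\ell}.$$
   Context: Lower records: for a finite or infinite sequence $(u_i)$ in $[0,1]$, an index $I$ is a lower record index if $u_I<u_i$ for all $i<I$ (so the index $1$ is always a lower record index). The number of lower records of $(u_1,\dots,u_n)$ is the number of lower record indices in $\{1,\dots,n\}$. Inter-record stretches: let $(U_i)_{i\ge1}$ be a sequence of pairwise distinct elements of $[0,1]$ with no smallest element. Then there are infinitely many lower record indices $1=I_1<I_2<I_3<\cdots$. For $k\ge1$, the $k$-th inter-record stretch is the finite sequence $$V_k:=(U_{I_k},U_{I_k+1},\dots,U_{I_{k+1}-1}),$$ an element of the space $\bigcup_{\ell=1}^\infty[0,1]^\ell$ (disjoint union) of finite sequences in $[0,1]$ of undetermined length. Saying that $(V_k)_{k\ge1}$ forms a Poisson point process means that the random collection of points $\{V_k: k\ge 1\}$ (equivalently, the random counting measure $\sum_{k}\delta_{V_k}$) is a Poisson point process. The measures $P_\ell$: for $\ell\ge1$, $P_\ell$ is the probability measure on $[0,1]^\ell$ which is the conditional distribution of $(W_1,\dots,W_\ell)$ given that $W_1<W_i$ for every $1<i\le\ell$, where $W_1,\dots,W_\ell$ are i.i.d. uniform on $[0,1]$. It is regarded as a measure on $\bigcup_{\ell\ge1}[0,1]^\ell$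 carried by the component $[0,1]^\ell$. The Beta$(\theta,1)$ distribution has density $\theta u^{\theta-1}$ on $(0,1)$. *)

(* Defs.v *)
From HB Require Import structures.
From mathcomp Require Import all_boot all_order all_algebra.
From mathcomp Require Import all_classical all_reals all_analysis measurable_realfun.

Set Implicit Arguments.
Unset Strict Implicit.
Unset Printing Implicit Defensive.

Import Order.TTheory GRing.Theory Num.Theory.
Import numFieldNormedType.Exports.

Local Open Scope classical_set_scope.
Local Open Scope ring_scope.

(* Sequences are indexed from 0: the term [u_i] of the mathematical text is
   [u i.-1], and the same shift applies to records and stretches. *)

Section records.
Context {R : realType}.
Implicit Types (u : nat -> R) (i n k : nat).

Definition lower_record u i : bool := [forall j : 'I_i, u i < u j].

Definition nb_records u n : nat := (\sum_(i < n) lower_record u i)%N.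

(* The lower record index preceded by exactly [k] others, which is [I_(k+1)],
   or 0 if [u] has at most [k] lower records. *)
Definition record_index u k : nat :=
  xget 0%N [set i | lower_record u i /\ nb_records u i = k].

(* [V_(k+1)], or the junk value [::] if [u] has at most [k.+1] lower records. *)
Definition stretch u k : seq R :=
  [seq u i | i <- iota (record_index u k)
                       (record_index u k.+1 - record_index u k)].

Definition prefix_tuple n u : n.-tuple R := [tuple u i | i < n].

Definition tuple_min n (t : n.-tuple R) : R :=
  \big[Num.min/(t`_0)]_(x <- t) x.

End records.

(* Infinite sequences, with the product sigma-algebra, which is also the Borel
   sigma-algebra of the product topology. *)
Definition coordinate_sets (R : realType) : set (set (nat -> R)) :=
  [set A | exists i B, measurable B /\ A = (fun u => u i) @^-1` B].

Definition seqspace (R : realType) := g_sigma_algebraType (@coordinate_sets R).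

HB.instance Definition _ (R : realType) := Measurable.on (seqspace R).

(* Finite sequences, with the sigma-algebra of the disjoint union of the spaces
   [n.-tuple R]. *)
Definition finseq (R : realType) : Type := seq R.

Section finseq.
Context {R : realType}.

HB.instance Definition _ := Choice.on (finseq R).
HB.instance Definition _ := isPointed.Build (finseq R) [::].

Definition finseq_measurable : set (set (finseq R)) :=
  [set A | forall n, measurable [set t : n.-tuple R | A (tval t)]].

Let finseq_measurable0 : finseq_measurable set0.
Proof. by move=> n; exact: measurable0. Qed.

Let finseq_measurableC A : finseq_measurable A -> finseq_measurable (~` A).
Proof. by move=> mA n; exact: measurableC (mA n). Qed.

Let finseq_measurable_bigcup (F : (set (finseq R))^nat) :
  (forall i, finseq_measurable (F i)) -> finseq_measurable (\bigcup_i F i).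
Proof.
move=> mF n.
rewrite (_ : mkset _ = \bigcup_i [set t : n.-tuple R | F i (tval t)]) //.
by apply: bigcupT_measurable => i; exact: mF.
Qed.

HB.instance Definition _ := @isMeasurable.Build default_measure_display
  (finseq R) finseq_measurable finseq_measurable0 finseq_measurableC
  finseq_measurable_bigcup.

End finseq.

Section cons_measure.
Local Open Scope ereal_scope.
Context d (T : measurableType d) (R : realType) (n : nat).
Variables (m1 : {sigma_finite_measure set T -> \bar R})
  (m2 : {sigma_finite_measure set (n.-tuple T) -> \bar R}).

Let cons (p : T * n.-tuple T) : n.+1.-tuple T := [tuple of p.1 :: p.2].

Let mcons : measurable_fun setT cons.
Proof. exact: measurable_cons. Qed.

Definition cons_measure : set (n.+1.-tuple T) -> \bar R :=
  pushforward (m1 \x m2) cons.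

Let cons_measure0 : cons_measure set0 = 0.
Proof. by rewrite /cons_measure /pushforward preimage_set0 measure0. Qed.

Let cons_measure_ge0 A : 0 <= cons_measure A.
Proof. exact: measure_ge0. Qed.

Let cons_measure_sigma_additive : semi_sigma_additive cons_measure.
Proof.
move=> F mF tF mUF; rewrite /cons_measure /pushforward preimage_bigcup.
apply: measure_semi_sigma_additive.
- by move=> i; rewrite -[X in measurable X]setTI; exact: mcons.
- apply/trivIsetP => /= i j _ _ ij; rewrite -preimage_setI.
  by move/trivIsetP : tF => /(_ _ _ _ _ ij) ->//; rewrite preimage_set0.
- by rewrite -preimage_bigcup -[X in measurable X]setTI; exact: mcons.
Qed.

HB.instance Definition _ := isMeasure.Build _ _ _ cons_measure
  cons_measure0 cons_measure_ge0 cons_measure_sigma_additive.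

Let uncons (t : n.+1.-tuple T) : T * n.-tuple T := (thead t, [tuple of behead t]).

Let muncons : measurable_fun setT uncons.
Proof.
apply/measurable_fun_pairP; split; first exact: measurable_tnth.
exact: measurable_behead.
Qed.

Let consK : cancel cons uncons.
Proof.
by case=> x t; rewrite /uncons /cons theadE; congr pair; exact: val_inj.
Qed.

Let cons_measure_sigma_finite : sigma_finite setT cons_measure.
Proof.
have /sigma_finiteP[F [TF ndF Foo]] := sigma_finiteT m1.
have /sigma_finiteP[G [TG ndG Goo]] := sigma_finiteT m2.
exists (fun i => uncons @^-1` (F i `*` G i)).
  apply/esym; rewrite -subTset => t _.
  have [i _ Fi] : (\bigcup_i F i) (uncons t).1 by rewrite -TF.
  have [j _ Gj] : (\bigcup_j G j) (uncons t).2 by rewrite -TG.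
  exists (maxn i j) => //; split.
  - by move: Fi; apply/subsetPset/ndF/leq_maxl.
  - by move: Gj; apply/subsetPset/ndG/leq_maxr.
move=> i; have [mFi Fioo] := Foo i; have [mGi Gioo] := Goo i; split.
  by rewrite -[X in measurable X]setTI; apply: muncons => //; exact: measurableX.
rewrite /cons_measure /pushforward -comp_preimage.
rewrite (_ : uncons \o cons = id); last by apply/funext => p; exact: consK.
by rewrite preimage_id product_measure1E// lte_mul_pinfty// ge0_fin_numE.
Qed.

HB.instance Definition _ := Measure_isSigmaFinite.Build _ _ _ cons_measure
  cons_measure_sigma_finite.

End cons_measure.

Fixpoint tuple_measure d (T : measurableType d) (R : realType)
    (m : {sigma_finite_measure set T -> \bar R}) (n : nat) :
    {sigma_finite_measure set (n.-tuple T) -> \bar R} :=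
  match n with
  | 0 => \d_[tuple]
  | n'.+1 => cons_measure m (tuple_measure m n')
  end.

(* [lebesgue_measure] lives on [measurableTypeR R], which is [R] with the same
   measurable sets as the default structure but another display. *)
Section cube.
Context {R : realType}.

Definition lebesgue_tuple (n : nat) :
    {sigma_finite_measure set (n.-tuple (measurableTypeR R)) -> \bar R} :=
  tuple_measure (@lebesgue_measure R) n.

Definition cube (n : nat) : set (n.-tuple (measurableTypeR R)) :=
  [set t | forall i, (tnth t i : R) \in `[0, 1]].

Arguments cube : clear implicits.

Lemma measurable_cube n : measurable (cube n).
Proof.
rewrite (_ : cube n = \bigcap_(i in [set: 'I_n])
    (fun t : n.-tuple (measurableTypeR R) => tnth t i) @^-1` `[(0 : R), 1]).
  apply: fin_bigcap_measurable; first exact: finite_finset.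
  move=> i _; rewrite -[X in measurable X]setTI.
  by apply: measurable_tnth => //; exact: measurable_itv.
by apply/seteqP; split=> [t tc i _|t tc i]; [exact: tc|exact: (tc i Logic.I)].
Qed.

Definition lebesgue_cube (n : nat) :
    {measure set (n.-tuple (measurableTypeR R)) -> \bar R} :=
  mrestr (lebesgue_tuple n) (@measurable_cube n).

(* The law of [n] i.i.d. uniform variables on [0, 1]. *)
Definition iid_uniform (n : nat) :
    {sigma_finite_measure set (n.-tuple (measurableTypeR R)) -> \bar R} :=
  tuple_measure (uniform_prob (@ltr01 R)) n.

End cube.

Section probability_notions.
Local Open Scope ereal_scope.
Context d d' (T : measurableType d) (E : measurableType d') (R : realType).

Definition has_density (mu : set T -> \bar R) (f : T -> R)
    (nu : set T -> \bar R) : Prop :=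
  measurable_fun setT f /\
  forall A, measurable A -> nu A = \int[mu]_(x in A) (f x)%:E.

(* [f x] is the density of the conditional distribution of [Y] given [X = x]. *)
Definition has_conditional_density (P : probability T R)
    (X : T -> E) (Y : T -> R) (f : E -> R -> R) : Prop :=
  forall A B, measurable A -> measurable B ->
    P (X @^-1` A `&` Y @^-1` B) =
    \int[P]_(w in X @^-1` A) \int[lebesgue_measure]_(y in B) (f (X w) y)%:E.

Definition conditional_probability (P : set T -> \bar R) (D A : set T) : \bar R :=
  (fine (P (A `&` D)) / fine (P D))%:E.

Definition mutually_independent (I : eqType) (P : probability T R)
    (X : I -> T -> E) : Prop :=
  forall (J : seq I) (A : I -> set E), uniq J ->
    (forall i, measurable (A i)) ->
    P [set w | forall i, i \in J -> A i (X i w)] =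
    \prod_(i <- J) P (X i @^-1` A i).

(* The counting measure [\sum_k \d_(V k)] evaluated at [B]. *)
Definition point_count (V : nat -> T -> E) (B : set E) (w : T) : \bar R :=
  \sum_(0 <= k <oo) \d_(V k w) B.

End probability_notions.

Definition poisson_mass {R : realType} (l : R) (n : nat) : R :=
  expR (- l) * l ^+ n / n`!%:R.

Section poisson_point_process.
Local Open Scope ereal_scope.
Context d d' (T : measurableType d) (E : measurableType d') (R : realType).
Variables (P : probability T R) (V : nat -> T -> E) (nu : set E -> \bar R).

Definition is_poisson_process : Prop :=
  [/\ forall B, measurable B -> measurable_fun setT (point_count R V B),
      forall B, measurable B -> nu B < +oo -> forall n : nat,
        P [set w | point_count R V B w = n%:R%:E] =
        (poisson_mass (fine (nu B)) n)%:E,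
      forall B, measurable B -> nu B = +oo ->
        P [set w | point_count R V B w = +oo] = 1
    & forall m (B : 'I_m -> set E), (forall i, measurable (B i)) ->
        trivIset setT B ->
        mutually_independent P (fun i => point_count R V (B i))].

End poisson_point_process.

Section law.
Context {R : realType}.
Implicit Types (theta r u : R).

Definition beta1_density theta u : R :=
  if 0 < u < 1 then theta * u `^ (theta - 1) else 0.

Definition step_density theta r u : R :=
  if 0 < u < 1 then
    if u < r then theta * (u / r) `^ (theta - 1) else 1
  else 0.

Record is_Ptheta theta (P : probability (seqspace R) R) : Prop := {
  Ptheta_unit : P [set u : seqspace R | forall i, u i \in `[0, 1]] = 1%E ;
  Ptheta_init : has_density lebesgue_measure (beta1_density theta)
                  (pushforward P (fun u : seqspace R => u 0%N)) ;
  Ptheta_step : forall n, (0 < n)%N ->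
    has_conditional_density P (prefix_tuple n) (fun u : seqspace R => u n)
      (fun t => step_density theta (tuple_min t)) }.

Definition lowest_first (l : nat) : set (l.-tuple R) :=
  [set w | forall i, (0 < i < l)%N -> w`_0 < w`_i].
Arguments lowest_first : clear implicits.

(* [P_l] *)
Definition stretch_law (l : nat) : set (l.-tuple R) -> \bar R :=
  conditional_probability (iid_uniform l) (lowest_first l).

(* [mu]; the factor is the probability measure [P_l] extended to [finseq R]. *)
Definition stretch_mean (B : set (finseq R)) : \bar R :=
  (\sum_(1 <= l <oo) stretch_law [set w : l.-tuple R | B (tval w)] * (l%:R^-1)%:E)%E.

End law.

(* Main.v *)
Require Import Defs.
From HB Require Import structures.
From mathcomp Require Import all_boot all_order all_algebra.
From mathcomp Require Import all_classical all_reals all_analysis measurable_realfun.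
From mathcomp Require Import ring lra.

(** The density. Given a past with minimum [m], the next term has density
    [theta * (y / m) ^ (theta - 1)] at [y < m] and 1 at [y >= m]. Multiplied by
    this, the expression [theta ^ K * m ^ (theta - 1)], where [K] is the number
    of records of the past, becomes the same expression for the longer past
    ([dens_rcons]). So by induction it is the density of a prefix with respect
    to Lebesgue measure on the cube ([prefix_law]), and it is constant equal to
    1 when [theta = 1]. All statements about finitely many terms are integrals
    of this density: the probability of a new record, the absolute continuity,
    the i.i.d. uniform case, and the absence of ties.

    The Poisson process. Fix a level [r] in ]0, 1[ and stop the sequence at its
    first passage at or below [r]. The stretches that begin above [r] are then
    the blocks obtained by cutting the stopped prefix at its records
    ([point_count_level]). Colour finite sequences with finitely many colours
    and ask for [n i] blocks of each colour [i], hence [k] blocks in all. On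
    this event the density of the prefix together with the passage term [y] is
    [theta ^ (k + 1) * y ^ (theta - 1)]; as it depends on the prefix only
    through [k], the event has probability [theta ^ k * r ^ theta] times the
    Lebesgue volume, over all lengths, of the prefixes above [r] with these
    block counts ([level_event_prob]).

    This volume is found by splitting off the first block. As a function of an
    upper bound [x] on the first term it satisfies a recursion ([volume_rec]):
    its derivative in [x] is the sum over [i] of the same volume with one block
    of colour [i] fewer, times the volume of the completions of the head [x] to
    a block of colour [i]. The solution is the product of
    [m_i x ^ n_i / n_i!], where [m_i x] is the integral of the latter volume
    over heads between [r] and [x] ([volumeE]). At [x = 1] the number [m_i 1] is the
    [mu]-mass of the stretches of colour [i] that begin above [r], because the
    weight [1 / l] in [mu] is the probability of the event by which [P_l] is
    conditioned ([stretch_meanE], [colour_mass1E]). Completions of [y] of all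
    colours have volume [sum_a (1 - y) ^ a = 1 / y], so the masses add up to
    [- ln r] and [r ^ theta] is the product of the exponentials
    [exp (- theta * m_i 1)]. The event therefore has a product of Poisson
    probabilities ([level_set_prob]).

    Summing over all counts shows that every level is passed almost surely;
    since all terms are positive, the sequence has no smallest element, and
    each stretch is above the level once the level is small enough. Letting the
    level vanish gives the joint law of the counts of finitely many disjoint
    sets, a set of infinite mean having no finite count ([counts_prob]).
    Independence as extended real variables follows by decomposing the events
    along the values of the counts, one set after the other
    ([counts_independence]). *)

Set Implicit Arguments.
Unset Strict Implicit.
Unset Printing Implicit Defensive.

Import Order.TTheory GRing.Theory Num.Theory.
Import numFieldNormedType.Exports.

Local Open Scope classical_set_scope.
Local Open Scope ring_scope.

(** * Measurable operations on finite sequences *)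

Section finseq_measurability.
Context {R : realType}.

Lemma finseq_measurableP (A : set (finseq R)) :
  measurable A <-> forall n, measurable [set t : n.-tuple R | A (tval t)].
Proof. by []. Qed.

Lemma measurable_size n : measurable [set s : finseq R | size s = n].
Proof.
apply/finseq_measurableP => k; have [->|kn] := eqVneq k n.
  rewrite (_ : [set _ | _] = setT) //.
  by apply/seteqP; split=> // t _ /=; rewrite size_tuple.
rewrite (_ : [set _ | _] = set0) //; apply/seteqP; split=> // t /=.
by rewrite size_tuple => kn'; rewrite kn' eqxx in kn.
Qed.

Lemma measurable_nth i : measurable_fun [set: finseq R] (fun s => nth 0 s i : R).
Proof.
move=> _ B mB; rewrite setTI; apply/finseq_measurableP => k.
have [ik|ki] := ltnP i k.
  rewrite (_ : mkset _ = (fun t : k.-tuple R => tnth t (Ordinal ik)) @^-1` B).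
    by rewrite -[X in measurable X]setTI; exact: measurable_tnth.
  by apply/seteqP; split => t /=; rewrite (tnth_nth 0).
have [B0|B0] := pselect (B 0).
  rewrite (_ : mkset _ = setT) //.
  by apply/seteqP; split => t //= _; rewrite nth_default // size_tuple.
rewrite (_ : mkset _ = set0) //.
by apply/seteqP; split => t //=; rewrite nth_default // size_tuple.
Qed.

(** A finite sequence is determined by its length and its entries, the entries
    being read with default value 0 beyond the end; so these are the only
    measurability obligations for a map into [finseq R]. *)
Lemma measurable_fun_finseq d (Y : measurableType d) (F : Y -> finseq R) :
  (forall n, measurable [set y | size (F y) = n]) ->
  (forall i, measurable_fun [set: Y] (fun y => nth 0 (F y) i : R)) ->
  measurable_fun [set: Y] F.
Proof.
move=> mS mN _ A mA; rewrite setTI.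
pose G n (y : Y) : n.-tuple R := [tuple nth 0 (F y) i | i < n].
have mG n : measurable_fun [set: Y] (G n).
  apply/measurable_fun_tnthP => i.
  rewrite (_ : _ \o _ = fun y => nth 0 (F y) i) //.
  by apply/funext => y /=; rewrite tnth_mktuple.
rewrite (_ : F @^-1` A = \bigcup_n ([set y | size (F y) = n] `&`
    G n @^-1` [set t : n.-tuple R | A (tval t)])).
  apply: bigcupT_measurable => n; apply: measurableI => //.
  by rewrite -[X in measurable X]setTI; apply: mG => //; exact: mA.
have GE y : tval (G (size (F y)) y) = F y.
  apply: (@eq_from_nth _ 0); first by rewrite size_tuple.
  by rewrite size_tuple => i iF; rewrite (nth_mktuple _ _ (Ordinal iF)).
apply/seteqP; split => [y Ay|y [n _ [/= <-]]]; last by rewrite GE.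
by exists (size (F y)) => //; split => //=; rewrite GE.
Qed.

Lemma measurable_tval n :
  measurable_fun [set: n.-tuple R] (fun t => tval t : finseq R).
Proof. by move=> _ B mB; rewrite setTI; exact: mB. Qed.

Lemma measurable_finseq_tuple n (f : finseq R -> \bar R) :
  measurable_fun [set: finseq R] f ->
  measurable_fun [set: n.-tuple R] (fun t => f (tval t)).
Proof. by move=> mf; exact: measurableT_comp mf (@measurable_tval n). Qed.

Lemma measurable_prop d (Y : measurableType d) (P : Prop) :
  measurable [set _ : Y | P].
Proof.
have [p|np] := pselect P.
  by rewrite (_ : mkset _ = setT)//; apply/seteqP; split.
by rewrite (_ : mkset _ = set0)//; apply/seteqP; split.
Qed.

Lemma measurable_pred_nat d (Y : measurableType d) (f : Y -> nat) (P : nat -> Prop) :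
  (forall n, measurable [set y | f y = n]) -> measurable [set y | P (f y)].
Proof.
move=> mf; rewrite (_ : mkset _ =
    \bigcup_(n in [set n | P n]) [set y | f y = n]).
  exact: bigcup_measurable.
by apply/seteqP; split => [y Py|y [n /= Pn /= ->]//]; exists (f y).
Qed.

(** Countably many measurable pieces, one for each value of [f], can be glued;
    this handles every quantity that depends on a random length, count or
    index. *)
Lemma measurable_fun_nat_dep d (Y : measurableType d) (f : Y -> nat)
    d' (Z : measurableType d') (g : nat -> Y -> Z) :
  (forall n, measurable [set y | f y = n]) ->
  (forall n, measurable_fun [set: Y] (g n)) ->
  measurable_fun [set: Y] (fun y => g (f y) y).
Proof.
move=> mf mg _ B mB; rewrite setTI.
rewrite (_ : _ @^-1` _ = \bigcup_n ([set y | f y = n] `&` g n @^-1` B)).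
  apply: bigcupT_measurable => n; apply: measurableI => //.
  by rewrite -[X in measurable X]setTI; exact: mg.
by apply/seteqP; split => [y /= By|y [n _ [/= <-]]//]; exists (f y).
Qed.

Lemma measurable_catf d (Y : measurableType d) (F G : Y -> finseq R) :
  measurable_fun [set: Y] F -> measurable_fun [set: Y] G ->
  measurable_fun [set: Y] (fun y => F y ++ G y : finseq R).
Proof.
move=> mF mG.
have mSF n : measurable [set y | size (F y) = n].
  rewrite -[X in measurable X]setTI; apply: (mF measurableT [set s | size s = n]).
  exact: measurable_size.
have mSG n : measurable [set y | size (G y) = n].
  rewrite -[X in measurable X]setTI; apply: (mG measurableT [set s | size s = n]).
  exact: measurable_size.
apply: measurable_fun_finseq => n.
  rewrite (_ : mkset _ = \bigcup_k ([set y | size (F y) = k] `&`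
      [set y | (k + size (G y) = n)%N])).
    apply: bigcupT_measurable => k; apply: measurableI => //.
    exact: (@measurable_pred_nat _ _ (size \o G) (fun m => k + m = n)%N).
  apply/seteqP; split => [y /=|y [k _ [/= <-]]].
    by rewrite size_cat => <-; exists (size (F y)).
  by rewrite size_cat.
under eq_fun do rewrite nth_cat.
apply: (measurable_fun_nat_dep (f := size \o F)
  (g := fun k y => if (n < k)%N then nth 0 (F y) n else nth 0 (G y) (n - k)%N)) => //.
move=> k; rewrite /=; case: (n < k)%N.
  exact: measurableT_comp (measurable_nth _) mF.
exact: measurableT_comp (measurable_nth _) mG.
Qed.

Lemma measurable_seq1 d (Y : measurableType d) (f : Y -> R) :
  measurable_fun [set: Y] f -> measurable_fun [set: Y] (fun y => [:: f y] : finseq R).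
Proof.
move=> mf; apply: measurable_fun_finseq => [n|[|[|i]]] //=.
  exact: (@measurable_prop _ Y (1%N = n)).
Qed.

Lemma measurable_consf d (Y : measurableType d) (f : Y -> R) (F : Y -> finseq R) :
  measurable_fun [set: Y] f -> measurable_fun [set: Y] F ->
  measurable_fun [set: Y] (fun y => f y :: F y : finseq R).
Proof. by move=> mf mF; apply: measurable_catf (measurable_seq1 mf) mF. Qed.

Lemma measurable_rconsf d (Y : measurableType d) (f : Y -> R) (F : Y -> finseq R) :
  measurable_fun [set: Y] f -> measurable_fun [set: Y] F ->
  measurable_fun [set: Y] (fun y => rcons (F y) (f y) : finseq R).
Proof.
move=> mf mF; under eq_fun do rewrite -cats1.
exact: measurable_catf mF (measurable_seq1 mf).
Qed.

Lemma measurable_takef n : measurable_fun [set: finseq R] (fun s => take n s : finseq R).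
Proof.
apply: measurable_fun_finseq => i.
  rewrite (_ : mkset _ = [set y : finseq R | minn n (size y) = i]); last first.
    by apply/seteqP; split => y /=; rewrite size_take_min.
  exact: (@measurable_pred_nat _ _ (size : finseq R -> nat)
    (fun m => minn n m = i) measurable_size).
have [ltin|leni] := ltnP i n.
  by under eq_fun do rewrite nth_take//; exact: measurable_nth.
under eq_fun.
  move=> s; rewrite nth_default; last first.
    by rewrite size_take_min; apply: leq_trans leni; exact: geq_minl.
  over.
exact: measurable_cst.
Qed.

Lemma measurable_dropf n : measurable_fun [set: finseq R] (fun s => drop n s : finseq R).
Proof.
apply: measurable_fun_finseq => i.
  rewrite (_ : mkset _ = [set y : finseq R | size y - n = i]%N); last first.
    by apply/seteqP; split => y /=; rewrite size_drop.
  exact: (@measurable_pred_nat _ _ (size : finseq R -> nat)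
    (fun m => m - n = i)%N measurable_size).
by under eq_fun do rewrite nth_drop//; exact: measurable_nth.
Qed.

Lemma measurable_fun_preimage d (Y : measurableType d) d' (Z : measurableType d')
    (f : Y -> Z) (B : set Z) :
  measurable_fun [set: Y] f -> measurable B -> measurable [set y | B (f y)].
Proof. by move=> mf mB; rewrite -[X in measurable X]setTI; exact: mf. Qed.

Lemma measurable_andb d (Y : measurableType d) (a b : Y -> bool) :
  measurable [set y | a y] -> measurable [set y | b y] ->
  measurable [set y | a y && b y].
Proof.
move=> ma mb; rewrite (_ : mkset _ = [set y | a y] `&` [set y | b y]).
  exact: measurableI.
by apply/seteqP; split => y /= /andP.
Qed.

Lemma measurable_orb d (Y : measurableType d) (a b : Y -> bool) :
  measurable [set y | a y] -> measurable [set y | b y] ->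
  measurable [set y | a y || b y].
Proof.
move=> ma mb; rewrite (_ : mkset _ = [set y | a y] `|` [set y | b y]).
  exact: measurableU.
by apply/seteqP; split => y /= /orP.
Qed.

Lemma measurable_nil : measurable [set s : finseq R | size s == 0%N].
Proof.
rewrite (_ : mkset _ = [set s | size s = 0%N]); first exact: measurable_size.
by apply/seteqP; split => s /= /eqP.
Qed.

Lemma measurable_nnil : measurable [set s : finseq R | ~~ (size s == 0%N)].
Proof.
rewrite (_ : mkset _ = ~` [set s : finseq R | size s == 0%N]).
  by apply: measurableC; exact: measurable_nil.
by apply/seteqP; split => s /= /negP.
Qed.

Lemma measurable_ltb d (Y : measurableType d) (f g : Y -> R) :
  measurable_fun [set: Y] f -> measurable_fun [set: Y] g ->
  measurable [set y | (f y < g y)%R].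
Proof.
move=> mf mg; rewrite -[X in measurable X]setTI.
rewrite (_ : mkset _ = (fun y => (f y < g y)%R) @^-1` [set true]).
  exact: measurable_fun_ltr.
by apply/seteqP; split.
Qed.

Lemma measurable_leb d (Y : measurableType d) (f g : Y -> R) :
  measurable_fun [set: Y] f -> measurable_fun [set: Y] g ->
  measurable [set y | (f y <= g y)%R].
Proof.
move=> mf mg; rewrite (_ : mkset _ = ~` [set y | (g y < f y)%R]).
  by apply: measurableC; exact: measurable_ltb.
by apply/seteqP; split => y /=; rewrite leNgt => /negP.
Qed.

End finseq_measurability.

(** * Iterated integrals over the unit cube *)

Section unit_interval.
Context {R : realType}.
Local Open Scope ereal_scope.
Implicit Types (n : nat).

(** The open interval is used so that integrands need to be known only at
    points where quotients and real powers behave well; the boundary has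
    measure 0. *)
Definition int01 (f : R -> \bar R) : \bar R := \int[@lebesgue_measure R]_(x in `]0%R, 1%R[) f x.

Lemma int01_ge0 (f : R -> \bar R) : (forall x, 0 <= f x) -> 0 <= int01 f.
Proof. by move=> f0; exact: integral_ge0. Qed.

Lemma eq_int01 (f g : R -> \bar R) : (forall x, (0 < x < 1)%R -> f x = g x) -> int01 f = int01 g.
Proof. by move=> fg; apply: eq_integral => x; rewrite inE/= in_itv/= => /fg. Qed.

Lemma int01D (f g : R -> \bar R) : (forall x, 0 <= f x) -> (forall x, 0 <= g x) ->
  measurable_fun [set: R] f -> measurable_fun [set: R] g ->
  int01 (fun x => f x + g x) = int01 f + int01 g.
Proof.
move=> f0 g0 mf mg; apply: ge0_integralD => //; exact: measurable_funTS.
Qed.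

Lemma int01_sum (I : Type) (s : seq I) (f : I -> R -> \bar R) :
  (forall i x, 0 <= f i x) -> (forall i, measurable_fun [set: R] (f i)) ->
  int01 (fun x => \sum_(i <- s) f i x) = \sum_(i <- s) int01 (f i).
Proof.
move=> f0 mf; apply: ge0_integral_sum => // i; apply: measurable_funTS; exact: mf.
Qed.

Lemma int01_series (f : nat -> R -> \bar R) :
  (forall i x, 0 <= f i x) -> (forall i, measurable_fun [set: R] (f i)) ->
  int01 (fun x => \sum_(i <oo) f i x) = \sum_(i <oo) int01 (f i).
Proof.
move=> f0 mf; apply: integral_nneseries => // i; apply: measurable_funTS; exact: mf.
Qed.

Lemma int01Zl (k : \bar R) (f : R -> \bar R) : 0 <= k -> (forall x, 0 <= f x) ->
  measurable_fun [set: R] f -> int01 (fun x => k * f x) = k * int01 f.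
Proof.
move=> k0 f0 mf; apply: ge0_integralZl => //; exact: measurable_funTS.
Qed.

Lemma int01_uniform (f : R -> \bar R) : (forall x, 0 <= f x) -> measurable_fun [set: R] f ->
  \int[uniform_prob (@ltr01 R)]_x f x = int01 f.
Proof.
move=> f0 mf; rewrite integral_uniform// subr0 invr1 mul1e.
by apply: integral_itv_bndoo; exact: measurable_funTS.
Qed.

(** Points are null for Lebesgue measure; this is how ties between coordinates,
    and the difference between strict and large inequalities, are discarded. *)
Lemma eq_int01_but1 (z0 : R) (f g : R -> \bar R) :
  measurable_fun [set: R] f -> measurable_fun [set: R] g ->
  (forall z, z != z0 -> f z = g z) -> int01 f = int01 g.
Proof.
move=> mf mg fg; rewrite /int01.
have mD : measurable (`]0%R, 1%R[ `\ z0) by exact: measurableD.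
rewrite -[LHS](integral_setD1 mD (measurable_funTS mf)).
rewrite -[RHS](integral_setD1 mD (measurable_funTS mg)).
by apply: eq_integral => z; rewrite inE => -[_ /eqP]; exact: fg.
Qed.

Lemma int01_cst1 : int01 (fun=> 1) = 1.
Proof.
rewrite /int01 integral_cst//= mul1e lebesgue_measure_itv/= lte_fin ltr01.
by rewrite -EFinB subr0.
Qed.

Lemma measurable_int01 d (T : measurableType d) (f : T * R -> \bar R) :
  (forall p, 0 <= f p) -> measurable_fun [set: T * R] f ->
  measurable_fun [set: T] (fun x => int01 (fun y => f (x, y))).
Proof.
move=> f0 mf.
under eq_fun.
  move=> x; rewrite -int01_uniform//; last exact: measurableT_comp mf _.
  over.
exact: (@measurable_fun_fubini_tonelli_F _ _ _ _ _ (uniform_prob (@ltr01 R)) f).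
Qed.

Lemma int01_swap (f : R * R -> \bar R) :
  (forall p, 0 <= f p) -> measurable_fun [set: R * R] f ->
  int01 (fun x => int01 (fun y => f (x, y))) =
  int01 (fun y => int01 (fun x => f (x, y))).
Proof.
move=> f0 mf.
have mf1 x : measurable_fun [set: R] (fun y => f (x, y)) by exact: measurableT_comp mf _.
have mf2 y : measurable_fun [set: R] (fun x => f (x, y)) by exact: measurableT_comp mf _.
have m1 : measurable_fun [set: R] (fun x => int01 (fun y => f (x, y))).
  exact: measurable_int01.
have m2 : measurable_fun [set: R] (fun y => int01 (fun x => f (x, y))).
  apply: (@measurable_int01 _ _ (f \o (fun p => (p.2, p.1)))) => [p|/=].
    exact: f0.
  by apply: measurableT_comp mf _; exact: measurable_swap.
rewrite -int01_uniform//; last by move=> x; exact: int01_ge0.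
transitivity (\int[uniform_prob (@ltr01 R)]_x
    \int[uniform_prob (@ltr01 R)]_y f (x, y)).
  by apply: eq_integral => x _; rewrite -int01_uniform.
rewrite -int01_uniform//; last by move=> x; exact: int01_ge0.
transitivity (\int[uniform_prob (@ltr01 R)]_y
    \int[uniform_prob (@ltr01 R)]_x f (x, y)); last first.
  by apply: eq_integral => x _; rewrite -int01_uniform.
exact: (fubini_tonelli (m1 := uniform_prob (@ltr01 R))
  (m2 := uniform_prob (@ltr01 R)) f).
Qed.

(** The integral over the open unit cube of dimension [n] of a function of
    finite sequences. Keeping the integrand on sequences, whatever their
    length, makes splitting a cube into a product of two cubes an identity
    without casts. *)
Fixpoint int01n n (f : seq R -> \bar R) : \bar R :=
  if n is n'.+1 then int01 (fun x => int01n n' (fun s => f (x :: s))) else f [::].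

Lemma int01n_ge0 n f : (forall s, 0 <= f s) -> 0 <= int01n n f.
Proof. by elim: n f => //= n IH f f0; apply: int01_ge0 => x; exact: IH. Qed.

Lemma eq_int01n n (f g : seq R -> \bar R) :
  (forall s, size s = n -> (forall x, x \in s -> (0 < x < 1)%R) -> f s = g s) ->
  int01n n f = int01n n g.
Proof.
elim: n f g => [|n IH] f g fg /=; first exact: fg.
apply: eq_int01 => x x01; apply: IH => s sn s01; apply: fg => /=.
  by rewrite sn.
by move=> y; rewrite inE => /predU1P[->//|]; exact: s01.
Qed.

Lemma int01n_cat a b (f : seq R -> \bar R) :
  int01n (a + b) f = int01n a (fun s => int01n b (fun t => f (s ++ t))).
Proof. by elim: a f => //= a IH f; apply: eq_int01 => x _; rewrite IH. Qed.

Lemma int01n_rcons n (f : seq R -> \bar R) :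
  int01n n.+1 f = int01n n (fun s => int01 (fun x => f (rcons s x))).
Proof.
rewrite -addn1 int01n_cat; apply: eq_int01n => s _ _ /=.
by apply: eq_int01 => x _; rewrite cats1.
Qed.

(** The induction moves one coordinate of the cube into the parameter, which is
    why the parameter space is arbitrary. *)
Lemma measurable_int01n_param n d (Y : measurableType d) (f : Y * finseq R -> \bar R) :
  (forall p, 0 <= f p) -> measurable_fun [set: Y * finseq R] f ->
  measurable_fun [set: Y] (fun y => int01n n (fun t => f (y, t))).
Proof.
elim: n d Y f => [|n IH] d Y f f0 mf /=.
  exact: (measurableT_comp mf (pair2_measurable ([::] : finseq R))).
pose g (q : (Y * R) * finseq R) := f (q.1.1, q.1.2 :: q.2).
apply: (@measurable_int01 _ _ (fun p : Y * R => int01n n (fun t => g (p, t)))).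
  by move=> p; apply: int01n_ge0 => s; exact: f0.
apply: IH => [q|]; first exact: f0.
apply: (measurableT_comp mf); apply: measurable_fun_pair.
  exact: (measurableT_comp measurable_fst measurable_fst).
by apply: measurable_consf; [exact: (measurableT_comp measurable_snd measurable_fst)|
  exact: measurable_snd].
Qed.

Lemma measurable_int01n_cons n (f : finseq R -> \bar R) : (forall s, 0 <= f s) ->
  measurable_fun [set: finseq R] f ->
  measurable_fun [set: R] (fun x => int01n n (fun t => f (x :: t))).
Proof.
move=> f0 mf; apply: (@measurable_int01n_param n _ R (fun p => f (p.1 :: p.2))) => //.
by apply: (measurableT_comp mf); exact: measurable_consf.
Qed.

Lemma measurable_consr (x : R) : measurable_fun [set: finseq R] (cons x : finseq R -> finseq R).
Proof. by apply: measurable_consf => //; exact: measurable_id. Qed.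

Let measurable_comp_cons (x : R) (f : finseq R -> \bar R) :
  measurable_fun [set: finseq R] f -> measurable_fun [set: finseq R] (fun s => f (x :: s)).
Proof. by move=> mf; exact: measurableT_comp mf (measurable_consr x). Qed.

Lemma int01n_sum n (I : Type) (r : seq I) (f : I -> finseq R -> \bar R) :
  (forall i s, 0 <= f i s) -> (forall i, measurable_fun [set: finseq R] (f i)) ->
  int01n n (fun s => \sum_(i <- r) f i s) = \sum_(i <- r) int01n n (f i).
Proof.
elim: n f => //= n IH f f0 mf.
rewrite -int01_sum; last 2 first.
- by move=> i x; exact: int01n_ge0.
- by move=> i; exact: measurable_int01n_cons.
by apply: eq_int01 => x _; rewrite IH// => i; exact: measurable_comp_cons.
Qed.

Lemma int01n_sum_cond n (I : Type) (r : seq I) (P : pred I) (f : I -> finseq R -> \bar R) :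
  (forall i s, 0 <= f i s) -> (forall i, measurable_fun [set: finseq R] (f i)) ->
  int01n n (fun s => \sum_(i <- r | P i) f i s) = \sum_(i <- r | P i) int01n n (f i).
Proof.
move=> f0 mf; rewrite -big_filter -int01n_sum//.
by apply: eq_int01n => s _ _; rewrite big_filter.
Qed.

Lemma int01n_series n (f : nat -> finseq R -> \bar R) :
  (forall i s, 0 <= f i s) -> (forall i, measurable_fun [set: finseq R] (f i)) ->
  int01n n (fun s => \sum_(i <oo) f i s) = \sum_(i <oo) int01n n (f i).
Proof.
elim: n f => //= n IH f f0 mf.
rewrite -int01_series; last 2 first.
- by move=> i x; exact: int01n_ge0.
- by move=> i; exact: measurable_int01n_cons.
by apply: eq_int01 => x _; rewrite IH// => i; exact: measurable_comp_cons.
Qed.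

Lemma int01nZl n (k : \bar R) (f : finseq R -> \bar R) : 0 <= k ->
  (forall s, 0 <= f s) -> measurable_fun [set: finseq R] f ->
  int01n n (fun s => k * f s) = k * int01n n f.
Proof.
move=> k0; elim: n f => //= n IH f f0 mf.
rewrite -int01Zl//; last 2 first.
- by move=> x; exact: int01n_ge0.
- exact: measurable_int01n_cons.
by apply: eq_int01 => x _; rewrite IH//; exact: measurable_comp_cons.
Qed.

Lemma integral_iid_uniform n (f : finseq R -> \bar R) : (forall s, 0 <= f s) ->
  measurable_fun [set: finseq R] f ->
  \int[iid_uniform n]_t f (tval t) = int01n n f.
Proof.
elim: n f => [|n IH] f f0 mf.
  rewrite [LHS]integral_dirac//; last exact: measurable_finseq_tuple.
  by rewrite diracT mul1e.
rewrite /iid_uniform/=.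
pose c (p : measurableTypeR R * n.-tuple (measurableTypeR R)) :=
  [tuple of p.1 :: p.2].
have mc : measurable_fun setT c by exact: measurable_cons.
have mf' : measurable_fun setT (fun t : n.+1.-tuple (measurableTypeR R) => f (tval t)).
  exact: measurable_finseq_tuple.
transitivity (\int[uniform_prob (@ltr01 R) \x iid_uniform n]_p f (tval (c p))).
  exact: (ge0_integral_pushforward mc (uniform_prob (@ltr01 R) \x iid_uniform n)
    measurableT mf').
rewrite (fubini_tonelli1 (fun p => f (tval (c p))))//; last first.
  exact: measurableT_comp mf' mc.
rewrite -int01_uniform; last 2 first.
- by move=> x; exact: int01n_ge0.
- exact: measurable_int01n_cons.
apply: eq_integral => x _; rewrite /fubini_F/= -IH//.
exact: measurable_comp_cons.
Qed.

End unit_interval.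

Section cube_law.
Context {R : realType}.
Local Open Scope ereal_scope.

(** Lebesgue measure restricted to the interval [0, 1] is the uniform law,
    hence so are their powers; sectioning along the first coordinate gives the
    induction step. *)
Lemma lebesgue_cube_iid n (A : set (n.-tuple (measurableTypeR R))) :
  measurable A -> lebesgue_cube n A = iid_uniform n A.
Proof.
elim: n A => [|n IH] A mA.
  rewrite /lebesgue_cube/= /mrestr/= /iid_uniform/=.
  congr (\d__ _); apply/seteqP; split => [t []//|t At]; split => //.
  by case.
pose c (p : measurableTypeR R * n.-tuple (measurableTypeR R)) :=
  [tuple of p.1 :: p.2].
have mc : measurable_fun setT c by exact: measurable_cons.
have mcA : measurable (c @^-1` A) by rewrite -[X in measurable X]setTI; exact: mc.
transitivity (\int[uniform_prob (@ltr01 R)]_x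
    iid_uniform n (xsection (c @^-1` A) x)); last by [].
rewrite integral_uniform//; last first.
  exact: (@measurable_fun_xsection _ _ _ _ _ (iid_uniform n)).
rewrite subr0 invr1 mul1e [RHS]integral_mkcond.
transitivity (\int[@lebesgue_measure R]_x
    lebesgue_tuple n (xsection (c @^-1` (A `&` @cube R n.+1)) x)); first by [].
apply: eq_integral => x _; rewrite patchE; case: ifPn => [|].
  rewrite inE/= => x01; rewrite -IH; last exact: measurable_xsection.
  congr (lebesgue_tuple n _); apply/seteqP; split => t.
    rewrite /xsection/= !inE => -[At ct]; split => //= i.
    by have := ct (lift ord0 i); rewrite tnthS.
  rewrite /xsection/= !inE => -[At ct]; split => //= i.
  by case: (unliftP ord0 i) => [j ->|->]; rewrite ?tnthS ?tnth0.
rewrite notin_setE/= => x01; rewrite -[RHS](measure0 (lebesgue_tuple n)).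
congr (lebesgue_tuple n _); apply/seteqP; split => t //.
rewrite /xsection/= !inE => -[At ct]; apply: x01.
by have := ct ord0; rewrite tnth0.
Qed.

Lemma integral_lebesgue_cube n (A : set (n.-tuple R)) (f : finseq R -> \bar R) :
  measurable A -> (forall s, 0 <= f s) -> measurable_fun [set: finseq R] f ->
  \int[lebesgue_cube n]_(t in A) f (tval t) =
  \int[iid_uniform n]_(t in A) f (tval t).
Proof.
move=> mA f0 mf; apply: eq_measure_integral => B mB _; exact: lebesgue_cube_iid.
Qed.

Lemma iid_uniformE (n : nat) (A : set (finseq R)) : measurable A ->
  iid_uniform n [set t : n.-tuple R | A (tval t)] = int01n n (fun s => (\1_A s)%:E).
Proof.
move=> mA; rewrite -integral_iid_uniform; last 2 first.
- by move=> s; rewrite lee_fin.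
- exact/measurable_EFinP/measurable_indic.
rewrite -(setIT [set t : _.-tuple R | A (tval t)]) -integral_indic//.
exact: mA.
Qed.

End cube_law.

(** * Records, stretches and prefixes *)

Section record_combinatorics.
Context {R : realType}.
Implicit Types (u v : nat -> R) (s : seq R).

Lemma lower_recordP u i :
  reflect (forall j, (j < i)%N -> u i < u j) (lower_record u i).
Proof.
apply: (iffP forallP) => [H j ji|H j]; last exact: H.
exact: (H (Ordinal ji)).
Qed.

Lemma lower_record0 u : lower_record u 0.
Proof. by apply/lower_recordP. Qed.

Lemma nb_records0 u : nb_records u 0 = 0%N.
Proof. by rewrite /nb_records big_ord0. Qed.

Lemma nb_recordsS u n : nb_records u n.+1 = (nb_records u n + lower_record u n)%N.
Proof. by rewrite /nb_records big_ord_recr. Qed.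

Lemma nb_records_homo u m n : (m <= n)%N -> (nb_records u m <= nb_records u n)%N.
Proof.
move=> /subnKC <-; elim: (n - m)%N => [|k IH]; first by rewrite addn0.
by rewrite addnS nb_recordsS; apply: leq_trans IH _; exact: leq_addr.
Qed.

Lemma nb_records_lt u m n : lower_record u m -> (m < n)%N ->
  (nb_records u m < nb_records u n)%N.
Proof.
by move=> um mn; apply: leq_trans (nb_records_homo u mn); rewrite nb_recordsS um addn1.
Qed.

Lemma record_uniq u i j : lower_record u i -> lower_record u j ->
  nb_records u i = nb_records u j -> i = j.
Proof.
move=> ui uj e; case: (ltngtP i j) => // ij.
  by have := nb_records_lt ui ij; rewrite e ltnn.
by have := nb_records_lt uj ij; rewrite e ltnn.
Qed.

(** The number of records grows by steps of 0 or 1, so it cannot skip the value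
    [k]: the record at which it leaves [k] is the one preceded by [k]
    others. *)
Lemma record_exists u n k : (k < nb_records u n)%N ->
  exists i, [/\ (i < n)%N, lower_record u i & nb_records u i = k].
Proof.
elim: n => [|n IH]; first by rewrite nb_records0.
have [kn _|nk] := ltnP k (nb_records u n).
  by have [i [? ? ?]] := IH kn; exists i; split => //; exact: ltnW.
rewrite nb_recordsS; have [un kn|_] := boolP (lower_record u n); last first.
  by rewrite addn0 ltnNge nk.
exists n; split => //; apply/eqP; rewrite eqn_leq nk.
by move: kn; rewrite addn1 ltnS.
Qed.

Lemma record_indexP u i k : lower_record u i -> nb_records u i = k ->
  record_index u k = i.
Proof.
move=> ui ik; rewrite /record_index; case: xgetP => [j _ [uj jk]|H].
  by apply: record_uniq uj ui _; rewrite jk.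
by have := H i; case.
Qed.

Lemma record_index_default u k :
  (forall i, lower_record u i -> nb_records u i <> k) -> record_index u k = 0%N.
Proof.
move=> H; rewrite /record_index; case: xgetP => [j _ [uj jk]|//].
by have := H j uj; rewrite jk.
Qed.

Lemma eq_lower_record u v i : (forall j, (j <= i)%N -> u j = v j) ->
  lower_record u i = lower_record v i.
Proof.
move=> uv; apply/lower_recordP/lower_recordP => H j ji.
  by rewrite -!uv//; [exact: H|exact: ltnW].
by rewrite !uv//; [exact: H|exact: ltnW].
Qed.

Lemma eq_nb_records u v n : (forall j, (j < n)%N -> u j = v j) ->
  nb_records u n = nb_records v n.
Proof.
move=> uv; apply: eq_bigr => i _; congr nat_of_bool.
by apply: eq_lower_record => j ji; apply: uv; apply: leq_ltn_trans ji _.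
Qed.

End record_combinatorics.

Section stretch_measurability.
Context {R : realType} d (Y : measurableType d) (u : Y -> nat -> R).
Hypothesis mu : forall i, measurable_fun [set: Y] (fun y => u y i).

Lemma measurable_lower_record i : measurable [set y | lower_record (u y) i].
Proof.
rewrite (_ : mkset _ = \bigcap_(j in [set j | (j < i)%N])
    [set y | u y i < u y j]); last first.
  apply/seteqP; split => [y /lower_recordP H j /=|y H]; first exact: H.
  by apply/lower_recordP => j ji; exact: H.
by apply: bigcap_measurableType => // j _; exact: measurable_ltb.
Qed.

Lemma measurable_nb_records n k : measurable [set y | nb_records (u y) n = k].
Proof.
elim: n k => [|n IH] k.
  rewrite (_ : mkset _ = [set _ | 0%N = k]); first exact: measurable_prop.
  by apply/seteqP; split => y /=; rewrite nb_records0.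
rewrite (_ : mkset _ =
    ([set y | lower_record (u y) n] `&` [set y | (nb_records (u y) n).+1 = k]) `|`
    (~` [set y | lower_record (u y) n] `&` [set y | nb_records (u y) n = k])).
  have mr := measurable_lower_record n.
  apply: measurableU; apply: measurableI => //.
    exact: (@measurable_pred_nat _ _ (fun y => nb_records (u y) n) (fun m => m.+1 = k)).
  exact: measurableC.
apply/seteqP; split => y /=; rewrite nb_recordsS; case: (lower_record (u y) n).
- by rewrite addn1 => ->; left.
- by rewrite addn0 => ->; right.
- by rewrite addn1 => -[[]|[]].
- by rewrite addn0 => -[[]|[]].
Qed.

(** The second part of the union is where no record index of that rank exists,
    in which case the index is by convention 0. *)
Lemma measurable_record_index k i : measurable [set y | record_index (u y) k = i].
Proof.
pose E j := [set y | lower_record (u y) j] `&` [set y | nb_records (u y) j = k].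
have mE j : measurable (E j).
  apply: measurableI; [exact: measurable_lower_record|exact: measurable_nb_records].
rewrite (_ : mkset _ = E i `|` ([set _ | 0%N = i] `&` \bigcap_j ~` E j)).
  apply: measurableU => //; apply: measurableI; first exact: measurable_prop.
  by apply: bigcapT_measurable => j; exact: measurableC.
apply/seteqP; split => y /=.
  have [[j [yj kj]] <-|H] := pselect (exists j, E j y).
    by left; rewrite (record_indexP yj kj).
  rewrite record_index_default => [<-|j yj jk]; last by apply: H; exists j.
  by right; split => // j _ Ej; apply: H; exists j.
move=> [[yi ki]|[<- H]]; first exact: record_indexP.
by apply: record_index_default => j yj jk; exact: (H j Logic.I).
Qed.

Lemma nth_stretch (v : nat -> R) k i :
  nth 0 (stretch v k) i =
  if (i < record_index v k.+1 - record_index v k)%N then v (record_index v k + i)%N else 0.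
Proof.
rewrite /stretch; case: ifP => H; first by rewrite (nth_map 0%N) ?size_iota// nth_iota.
by rewrite nth_default// size_map size_iota leqNgt H.
Qed.

Lemma measurable_stretch k :
  measurable_fun [set: Y] (fun y => stretch (u y) k : finseq R).
Proof.
apply: measurable_fun_finseq => i.
  rewrite (_ : mkset _ = \bigcup_a ([set y | record_index (u y) k = a] `&`
      [set y | (record_index (u y) k.+1 - a)%N = i])).
    apply: bigcupT_measurable => a; apply: measurableI; first exact: measurable_record_index.
    exact: (@measurable_pred_nat _ _ (fun y => record_index (u y) k.+1)
      (fun m => (m - a)%N = i) (measurable_record_index k.+1)).
  apply/seteqP; split => [y /=|y [a _ [/= <-]]].
    by rewrite size_map size_iota => <-; exists (record_index (u y) k).
  by rewrite size_map size_iota.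
under eq_fun do rewrite nth_stretch.
apply: (measurable_fun_nat_dep (f := fun y => record_index (u y) k)
  (g := fun a y => if (i < record_index (u y) k.+1 - a)%N then u y (a + i)%N else 0)).
  exact: measurable_record_index.
move=> a; apply: (measurable_fun_nat_dep (f := fun y => record_index (u y) k.+1)
  (g := fun b y => if (i < b - a)%N then u y (a + i)%N else 0)).
  exact: measurable_record_index.
by move=> b; case: (_ < _)%N => //; exact: measurable_cst.
Qed.

End stretch_measurability.

Section prefix.
Context {R : realType}.
Implicit Types (u : nat -> R) (s : seq R).

Definition nb_recs s := nb_records (nth 0 s) (size s).

Definition seq_min s := \big[Num.min/(s`_0)]_(x <- s) x.

Lemma measurable_coord i : measurable_fun [set: seqspace R] (fun u => u i : R).
Proof.
move=> _ B mB; rewrite setTI; apply: sub_sigma_algebra.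
by exists i, B.
Qed.

Lemma measurable_mkseq n :
  measurable_fun [set: seqspace R] (fun u => mkseq u n : finseq R).
Proof.
apply: measurable_fun_finseq => i.
  rewrite (_ : mkset _ = [set _ | n = i]); first exact: measurable_prop.
  by apply/seteqP; split => u /=; rewrite size_mkseq.
have [ni|ni] := ltnP i n.
  rewrite (_ : (fun u => _) = fun u => u i); first exact: measurable_coord.
  by apply/funext => u; rewrite nth_mkseq.
rewrite (_ : (fun u => _) = cst 0); first exact: measurable_cst.
by apply/funext => u; rewrite nth_default ?size_mkseq.
Qed.

Lemma prefix_tupleE n u : tval (prefix_tuple n u) = mkseq u n.
Proof.
apply: (@eq_from_nth _ 0); first by rewrite size_tuple size_mkseq.
rewrite size_tuple => i ni; rewrite nth_mkseq//.
by rewrite (nth_mktuple _ _ (Ordinal ni)).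
Qed.

Lemma measurable_prefix_tuple n :
  measurable_fun [set: seqspace R] (prefix_tuple n : seqspace R -> n.-tuple R).
Proof.
apply/measurable_fun_tnthP => i.
apply: (eq_measurable_fun (fun u : seqspace R => u i)); last exact: measurable_coord.
by move=> u _ /=; rewrite tnth_mktuple.
Qed.

Lemma mkseqS n u : mkseq u n.+1 = rcons (mkseq u n) (u n).
Proof. by rewrite /mkseq -[in LHS]addn1 iotaD map_cat cats1. Qed.

Lemma nb_recs_mkseq n u : nb_recs (mkseq u n) = nb_records u n.
Proof.
rewrite /nb_recs size_mkseq; apply: eq_nb_records => j jn.
by rewrite nth_mkseq.
Qed.

Lemma measurable_nb_recs k : measurable [set s : finseq R | nb_recs s = k].
Proof.
rewrite (_ : mkset _ = \bigcup_n ([set s | size s = n] `&`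
    [set s : finseq R | nb_records (nth 0 s) n = k])).
  apply: bigcupT_measurable => n; apply: measurableI; first exact: measurable_size.
  by apply: measurable_nb_records => i; exact: measurable_nth.
apply/seteqP; split => [s /=|s [n _ [/= <-]]//].
by move=> <-; exists (size s).
Qed.

Lemma big_min_rcons (I : Type) (x : R) (r : seq I) i (F : I -> R) :
  \big[Num.min/x]_(j <- rcons r i) F j =
  Num.min (\big[Num.min/x]_(j <- r) F j) (F i).
Proof.
elim: r => [|a r IH]; rewrite /= !big_cons ?big_nil; first by rewrite minC.
by rewrite IH minA.
Qed.

Lemma measurable_seq_min : measurable_fun [set: finseq R] (seq_min : finseq R -> R).
Proof.
pose g n (s : finseq R) := \big[Num.min/(nth 0 s 0%N)]_(0 <= i < n) nth 0 s i.
rewrite (_ : seq_min = fun s => g (size s) s); last first.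
  by apply/funext => s; rewrite /seq_min (big_nth 0).
apply: measurable_fun_nat_dep; first exact: measurable_size.
elim=> [|n IH]; first by rewrite /g; under eq_fun do rewrite big_nil; exact: measurable_nth.
rewrite (_ : g n.+1 = g n \min (fun s => nth 0 s n)).
  by apply: measurable_minr => //; exact: measurable_nth.
apply/funext => s; rewrite /g.
by rewrite /index_iota !subn0 -addn1 iotaD cats1 big_min_rcons.
Qed.

Lemma seq_min_rcons s y : s != [::] -> seq_min (rcons s y) = Num.min (seq_min s) y.
Proof. by case: s => // x s _; rewrite /seq_min big_min_rcons. Qed.

Lemma seq_min1 x : seq_min [:: x] = x.
Proof. by rewrite /seq_min big_cons big_nil /= minxx. Qed.

Lemma lt_seq_min s y : s != [::] ->
  (y < seq_min s) = all (fun x => y < x) s.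
Proof.
case: s => // x s _; rewrite /seq_min /=.
have H t : (y < \big[Num.min/x]_(z <- t) z) = (y < x) && all (fun x => y < x) t.
  elim: t => [|z t IH] /=; first by rewrite big_nil andbT.
  by rewrite big_cons lt_min IH andbCA.
by rewrite H /= andbA andbb.
Qed.

Lemma le_seq_min s y : s != [::] ->
  (y <= seq_min s) = all (fun x => (y <= x)) s.
Proof.
case: s => // x s _; rewrite /seq_min /=.
have H t : (y <= \big[Num.min/x]_(z <- t) z) = (y <= x) && all (fun x => (y <= x)) t.
  elim: t => [|z t IH] /=; first by rewrite big_nil andbT.
  by rewrite big_cons le_min IH andbCA.
by rewrite H /= andbA andbb.
Qed.

Lemma measurable_all_gt (r : R) : measurable [set s : finseq R | all (fun y => r < y) s].
Proof.
rewrite (_ : mkset _ = [set s | (size s == 0%N) || (r < seq_min s)]).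
  apply: measurable_orb; first exact: measurable_nil.
  by apply: measurable_ltb; [exact: measurable_cst|exact: measurable_seq_min].
apply/seteqP; split => s /=; case: (eqVneq s [::]) => [->//|s0].
  by rewrite lt_seq_min// => ->; rewrite orbT.
by rewrite size_eq0 (negPf s0)/= lt_seq_min.
Qed.

Lemma measurable_all_ge (y : R) :
  measurable [set s : finseq R | all (fun z => y <= z) s].
Proof.
rewrite (_ : mkset _ = [set s | (size s == 0%N) || (y <= seq_min s)]).
  apply: measurable_orb; first exact: measurable_nil.
  by apply: measurable_leb; [exact: measurable_cst|exact: measurable_seq_min].
apply/seteqP; split => s /=; case: (eqVneq s [::]) => [->//|s0].
  by rewrite le_seq_min// => ->; rewrite orbT.
by rewrite size_eq0 (negPf s0)/= le_seq_min.
Qed.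

Lemma lower_record_rcons s y : s != [::] ->
  lower_record (nth 0 (rcons s y)) (size s) = (y < seq_min s).
Proof.
move=> s0; rewrite lt_seq_min//; apply/lower_recordP/(all_nthP 0) => H i si.
  by have := H i si; rewrite !nth_rcons ltnn eqxx si.
by rewrite !nth_rcons ltnn eqxx si; exact: H.
Qed.

Lemma nb_recs_rcons s y : s != [::] ->
  nb_recs (rcons s y) = (nb_recs s + (y < seq_min s)%R)%N.
Proof.
move=> s0; rewrite /nb_recs size_rcons nb_recordsS lower_record_rcons//.
by congr addn; apply: eq_nb_records => j js; rewrite nth_rcons js.
Qed.

Lemma nb_recs1 x : nb_recs [:: x] = 1%N.
Proof. by rewrite /nb_recs /= nb_recordsS nb_records0 lower_record0. Qed.

Lemma lower_record_mkseq n u : (0 < n)%N ->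
  lower_record u n = (u n < seq_min (mkseq u n)).
Proof.
move=> n0; rewrite -lower_record_rcons; last by case: n n0.
rewrite -mkseqS size_mkseq; apply: eq_lower_record => j jn.
by rewrite nth_mkseq.
Qed.

End prefix.

(** * Integration against a density *)

Section density_measure.
Local Open Scope ereal_scope.
Context d (T : measurableType d) (R : realType) (mu : {measure set T -> \bar R}).
Variable g : T -> \bar R.
Hypotheses (g0 : forall x, 0 <= g x) (mg : measurable_fun [set: T] g).

(** The hypotheses on the density are parameters so that the measure structure
    can be attached to the term. *)
Definition density_measure (g0 : forall x, 0 <= g x)
    (mg : measurable_fun [set: T] g) (A : set T) : \bar R :=
  \int[mu]_(x in A) g x.

Local Notation dm := (density_measure g0 mg).

Let dm0 : dm set0 = 0.
Proof. by rewrite /density_measure integral_set0. Qed.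

Let dm_ge0 A : 0 <= dm A.
Proof. by apply: integral_ge0. Qed.

Let dm_sigma_additive : semi_sigma_additive dm.
Proof.
move=> F mF tF mUF; rewrite /density_measure; apply: cvg_toP.
  apply: ereal_nondecreasing_is_cvgn => m n mn.
  by apply: lee_sum_nneg_natr => // k _ _; apply: integral_ge0.
by rewrite ge0_integral_bigcup//; exact: measurable_funTS.
Qed.

HB.instance Definition _ := isMeasure.Build _ _ _ dm dm0 dm_ge0 dm_sigma_additive.

End density_measure.

Section integral_density.
Local Open Scope ereal_scope.
Context d (T : measurableType d) (R : realType) (mu nu : {measure set T -> \bar R}).
Variable g : T -> R.
Hypotheses (g0 : forall x, (0 <= g x)%R) (mg : measurable_fun [set: T] g).
Hypothesis nuE : forall A, measurable A -> nu A = \int[mu]_(x in A) (g x)%:E.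

Import HBNNSimple.

Let integral_density_nnsfun (f : {nnsfun T >-> R}) :
  \int[nu]_x (f x)%:E = \int[mu]_x ((f x)%:E * (g x)%:E).
Proof.
transitivity (\sum_(r \in range f) r%:E * nu (f @^-1` [set r])).
  under eq_integral do rewrite fimfunE -fsumEFin//.
  rewrite ge0_integral_fsum//; last 2 first.
    by move=> r; exact/measurable_EFinP/measurableT_comp.
    by move=> n x _; rewrite EFinM nnfun_muleindic_ge0.
  apply: eq_fsbigr => r _; rewrite integralZl_indic_nnsfun//.
  by rewrite integral_indic// setIT.
transitivity (\sum_(r \in range f) \int[mu]_x (r%:E * ((\1_(f @^-1` [set r]) x)%:E * (g x)%:E))).
  apply: eq_fsbigr => r; rewrite inE => -[x _ fxr].
  rewrite ge0_integralZl//; last 3 first.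
  - apply: emeasurable_funM; last exact/measurable_EFinP.
    exact/measurable_EFinP/measurable_indic.
  - by move=> y _; rewrite mule_ge0// lee_fin.
  - by rewrite -fxr lee_fin.
  congr *%E; rewrite nuE// integral_mkcond.
  apply: eq_integral => y _; rewrite patchE indicE; case: ifPn => _.
    by rewrite mul1e.
  by rewrite mul0e.
rewrite -ge0_integral_fsum//; last 2 first.
- move=> r; apply: emeasurable_funM => //.
  apply: emeasurable_funM; last exact/measurable_EFinP.
  exact/measurable_EFinP/measurable_indic.
- move=> r x _; rewrite muleA; apply: mule_ge0; last by rewrite lee_fin.
  exact: nnfun_muleindic_ge0.
apply: eq_integral => x _.
rewrite fimfunE -fsumEFin// ge0_mule_fsuml//; last first.
  by move=> r; rewrite EFinM nnfun_muleindic_ge0.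
by apply: eq_fsbigr => r _; rewrite muleA EFinM.
Qed.

(** The change of density formula: true for simple functions by linearity, then
    for nonnegative functions by monotone convergence. *)
Lemma ge0_integral_density f : (forall x, 0 <= f x) -> measurable_fun [set: T] f ->
  \int[nu]_x f x = \int[mu]_x (f x * (g x)%:E).
Proof.
move=> f0 mf.
pose f_ := nnsfun_approx measurableT mf.
have fE x : f x = limn (fun n => (f_ n x)%:E).
  by apply/esym/cvg_lim => //; exact: cvg_nnsfun_approx.
transitivity (limn (fun n => \int[nu]_x (f_ n x)%:E)).
  rewrite -monotone_convergence//=.
  - by apply: eq_integral => x _; exact: fE.
  - by move=> n; exact/measurable_EFinP/measurable_funTS.
  - by move=> n x _; rewrite lee_fin.
  - by move=> x _ m n mn; rewrite lee_fin; exact/lefP/nd_nnsfun_approx.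
under eq_fun do rewrite integral_density_nnsfun.
rewrite -monotone_convergence//=.
- apply: eq_integral => x _; apply/esym/esym/cvg_lim => //.
  by apply: cvgeZr => //; exact: cvg_nnsfun_approx.
- move=> n; apply: emeasurable_funM; last exact/measurable_EFinP.
  exact/measurable_EFinP/measurable_funTS.
- by move=> n x _; rewrite mule_ge0// lee_fin.
- move=> x _ m n mn; apply: lee_wpmul2r; first by rewrite lee_fin.
  by rewrite lee_fin; exact/lefP/nd_nnsfun_approx.
Qed.

End integral_density.

Section joint_density.
Local Open Scope ereal_scope.
Context d d1 d2 (T : measurableType d) (T1 : measurableType d1)
  (T2 : measurableType d2) (R : realType).
Variables (P : probability T R) (X : T -> T1) (Y : T -> T2).
Variables (m1 : {sigma_finite_measure set T1 -> \bar R})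
          (m2 : {sigma_finite_measure set T2 -> \bar R}).
Hypotheses (mX : measurable_fun [set: T] X) (mY : measurable_fun [set: T] Y).
Variable D : T1 * T2 -> R.
Hypotheses (D0 : forall p, (0 <= D p)%R) (mD : measurable_fun [set: T1 * T2] D).
Hypothesis PXY : forall A B, measurable A -> measurable B ->
  P (X @^-1` A `&` Y @^-1` B) = \int[m1]_(x in A) \int[m2]_(y in B) (D (x, y))%:E.

Let XY w := (X w, Y w).

Let mXY : measurable_fun [set: T] XY.
Proof. exact: measurable_fun_pair. Qed.

Let D0e p : 0 <= (D p)%:E. Proof. by rewrite lee_fin. Qed.
Let mDe : measurable_fun [set: T1 * T2] (fun p => (D p)%:E).
Proof. exact/measurable_EFinP. Qed.

(** Both sides are finite measures that agree on rectangles, and rectangles are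
    stable under intersection and generate the product sigma-algebra. *)
Let joint_law C : measurable C ->
  pushforward P XY C = density_measure (m1 \x m2) D0e mDe C.
Proof.
pose G : set (set (T1 * T2)) :=
  [set C | exists A, measurable A /\ exists B, measurable B /\ C = A `*` B].
have GE A B : measurable A -> measurable B ->
    pushforward P XY (A `*` B) = density_measure (m1 \x m2) D0e mDe (A `*` B).
  move=> mA mB; rewrite /density_measure.
  transitivity (P (X @^-1` A `&` Y @^-1` B)); first by [].
  rewrite PXY// [RHS]integral_mkcond fubini_tonelli1//; last 2 first.
  - apply/(measurable_restrict _ _ measurableT); first exact: measurableX.
    exact: measurable_funTS.
  - by move=> p; rewrite patchE; case: ifPn.
  rewrite [LHS]integral_mkcond; apply: eq_integral => x _.
  rewrite /fubini_F patchE; case: ifPn => xA.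
    rewrite [LHS]integral_mkcond; apply: eq_integral => y _.
    by rewrite !patchE in_setX/= xA.
  by rewrite integral0_eq// => y _; rewrite patchE in_setX/= (negbTE xA).
apply: (measure_unique G (fun=> setT)).
- rewrite measurable_prod_measurableType //; congr (<<s _ >>).
  rewrite predeqE; split => [[A mA [B mB <-]]|[A [mA [B [mB ->]]]]].
    by exists A; split => //; exists B.
  by exists A => //; exists B.
- move=> /= _ _ [X1 [mX1 [X2 [mX2 ->]]]] [Y1 [mY1 [Y2 [mY2 ->]]]].
  rewrite -setXI; exists (X1 `&` Y1); split; first exact: measurableI.
  by exists (X2 `&` Y2); split => //; exact: measurableI.
- by move=> _; exists setT; split => //; exists setT; rewrite setXTT.
- by rewrite bigcup_const.
- by move=> _ [A [mA [B [mB ->]]]]; exact: GE.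
- by move=> _; rewrite /= /pushforward preimage_setT probability_setT ltry.
Qed.

Lemma integral_joint_density (f : T1 * T2 -> \bar R) :
  (forall p, 0 <= f p) -> measurable_fun [set: T1 * T2] f ->
  \int[P]_w f (X w, Y w) =
  \int[m1]_x \int[m2]_y (f (x, y) * (D (x, y))%:E).
Proof.
move=> f0 mf; transitivity (\int[pushforward P XY]_p f p).
  by rewrite ge0_integral_pushforward.
rewrite (ge0_integral_density (mu := m1 \x m2) D0 mD)//.
rewrite fubini_tonelli1//; first exact: emeasurable_funM.
by move=> p; rewrite mule_ge0.
Qed.

End joint_density.

Section law_density.
Local Open Scope ereal_scope.
Context d d1 (T : measurableType d) (T1 : measurableType d1) (R : realType).
Variables (P : {measure set T -> \bar R}) (mu : {measure set T1 -> \bar R}).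
Variables (X : T -> T1) (g : T1 -> R).
Hypotheses (mX : measurable_fun [set: T] X).
Hypotheses (g0 : forall x, (0 <= g x)%R) (mg : measurable_fun [set: T1] g).
Hypothesis PX : forall A, measurable A -> P (X @^-1` A) = \int[mu]_(x in A) (g x)%:E.

Lemma integral_law_density (f : T1 -> \bar R) :
  (forall x, 0 <= f x) -> measurable_fun [set: T1] f ->
  \int[P]_w f (X w) = \int[mu]_x (f x * (g x)%:E).
Proof.
move=> f0 mf; transitivity (\int[pushforward P X]_x f x).
  by rewrite ge0_integral_pushforward.
by apply: (ge0_integral_density g0 mg).
Qed.

End law_density.

(** * The law of a prefix *)

Section seq_tuple.
Context {R : realType}.

Definition seq_tuple n (s : finseq R) : n.-tuple R := [tuple nth 0 s i | i < n].

Lemma measurable_seq_tuple n : measurable_fun [set: finseq R] (@seq_tuple n).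
Proof.
apply/measurable_fun_tnthP => i.
rewrite (_ : _ \o _ = fun s => nth 0 s i); first exact: measurable_nth.
by apply/funext => s /=; rewrite tnth_mktuple.
Qed.

Lemma measurable_seq_tuple_preimage n (A : set (n.-tuple R)) :
  measurable A -> measurable (@seq_tuple n @^-1` A).
Proof. by move=> mA; rewrite -[X in measurable X]setTI; exact: measurable_seq_tuple. Qed.

Lemma seq_tupleK n : cancel (@tval n R) (@seq_tuple n).
Proof.
move=> t; apply: eq_from_tnth => i; rewrite tnth_mktuple.
by rewrite (tnth_nth 0).
Qed.

End seq_tuple.

Section prefix_law.
Context {R : realType} (theta : R).
Hypothesis theta_gt0 : 0 < theta.

(** The density of the theorem, as a function of finite sequences of any
    length. *)
Definition dens (s : seq R) : R :=
  theta ^+ nb_recs s * seq_min s `^ (theta - 1).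

Lemma dens_ge0 s : 0 <= dens s.
Proof. by rewrite mulr_ge0 ?exprn_ge0 ?powR_ge0// ltW. Qed.

Lemma measurable_dens : measurable_fun [set: finseq R] (dens : finseq R -> R).
Proof.
apply: (measurable_fun_nat_dep (f := nb_recs : finseq R -> nat)
  (g := fun k s => theta ^+ k * seq_min s `^ (theta - 1))).
  exact: measurable_nb_recs.
move=> k; apply: measurable_funM; first exact: measurable_cst.
exact: (measurableT_comp (@measurable_powR R (theta - 1)) measurable_seq_min).
Qed.

Lemma step_density_ge0 r y : 0 <= step_density theta r y.
Proof.
rewrite /step_density; case: ifP => // _; case: ifP => // _.
by rewrite mulr_ge0 ?powR_ge0// ltW.
Qed.

(** Away from 0 the inverse is a real power, up to sign, and real powers are
    measurable on the whole line; the value of the inverse at 0 is 0. *)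
Lemma measurable_invr : measurable_fun [set: R] (fun x : R => x^-1).
Proof.
rewrite (_ : (fun x => x^-1) = fun x => if 0 < x then x `^ (-1) else
    if x < 0 then - (- x) `^ (-1) else 0); last first.
  apply/funext => x; case: ltP => x0; first by rewrite powR_inv1// ltW.
  case: ltP => x0'; first by rewrite powR_inv1 ?oppr_ge0// invrN opprK.
  by rewrite (le_anti (introT andP (conj x0 x0'))) invr0.
apply: measurable_fun_ifT; first exact: measurable_fun_ltr.
  exact: measurable_powR.
apply: measurable_fun_ifT; [exact: measurable_fun_ltr| |exact: measurable_cst].
apply: measurableT_comp => //.
exact: (measurableT_comp (@measurable_powR R (-1))).
Qed.

Lemma measurable_step_density :
  measurable_fun [set: R * R] (fun p => step_density theta p.1 p.2).
Proof.
apply: measurable_fun_ifT => //.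
  by apply: measurable_and; apply: measurable_fun_ltr.
apply: measurable_fun_ifT => //; first by apply: measurable_fun_ltr.
apply: measurable_funM => //.
apply: (measurableT_comp (@measurable_powR R (theta - 1))).
by apply: measurable_funM => //; exact: (measurableT_comp measurable_invr).
Qed.

(** The computation behind the density: if [y] is a new record below the
    minimum [m], then [theta * (y / m) ^ (theta - 1)] turns the factor [m ^
    (theta - 1)] into [y ^ (theta - 1)] and adds one factor [theta]; otherwise
    record count and minimum are unchanged. *)
Lemma dens_rcons s y : s != [::] -> (forall x, x \in s -> 0 < x < 1) ->
  0 < y < 1 -> dens (rcons s y) = dens s * step_density theta (seq_min s) y.
Proof.
move=> s0 s01 y01; rewrite /dens nb_recs_rcons// seq_min_rcons// /step_density y01.
have m0 : 0 < seq_min s.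
  by rewrite lt_seq_min//; apply/allP => x /s01 /andP[].
have [y0 _] := andP y01.
have [ym|my] := ltP y (seq_min s); last first.
  by rewrite addn0 mulr1.
rewrite addn1 exprSr -!mulrA; congr *%R.
rewrite mulrCA; congr *%R.
rewrite -powRM ?divr_ge0 ?ltW//.
by rewrite mulrCA divff ?mulr1 ?gt_eqF.
Qed.

Variable P : probability (seqspace R) R.
Hypothesis HP : is_Ptheta theta P.

Local Open Scope ereal_scope.

Lemma int01_indic (B : set R) (g : R -> \bar R) :
  measurable B -> (forall x, 0 <= g x) -> measurable_fun [set: R] g ->
  \int[uniform_prob (@ltr01 R)]_(y in B) g y = int01 (fun y => (\1_B y)%:E * g y).
Proof.
move=> mB g0 mg; rewrite -int01_uniform; last 2 first.
- by move=> x; rewrite mule_ge0// lee_fin.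
- by apply: emeasurable_funM => //; exact/measurable_EFinP/measurable_indic.
rewrite integral_mkcond; apply: eq_integral => y _.
by rewrite patchE indicE; case: (y \in B); rewrite ?mul1e ?mul0e.
Qed.

Lemma lebesgue_int01 (B : set R) (g : R -> R) :
  (forall y, ~~ (0 < y < 1)%R -> g y = 0%R) ->
  \int[lebesgue_measure]_(y in B) (g y)%:E = int01 (fun y => (\1_B y)%:E * (g y)%:E).
Proof.
move=> g0; rewrite /int01 [LHS]integral_mkcond [RHS]integral_mkcond.
apply: eq_integral => y _; rewrite !patchE indicE.
case: ifPn => yB; case: ifPn => y01; rewrite ?mul1e ?mul0e//.
by rewrite g0//; move: y01; rewrite notin_setE/= in_itv/= => /negP.
Qed.

Lemma prefix_law1 (f : finseq R -> \bar R) :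
  (forall s, 0 <= f s) -> measurable_fun [set: finseq R] f ->
  \int[P]_u f (mkseq u 1) = int01n 1 (fun s => f s * (dens s)%:E).
Proof.
move=> f0 mf; have [mb Hb] := Ptheta_init HP.
have mg : measurable_fun [set: R] (fun x : R => f [:: x]).
  exact: measurableT_comp mf (measurable_seq1 (@measurable_id _ R setT)).
have b0 x : (0 <= beta1_density theta x)%R.
  by rewrite /beta1_density; case: ifP => // _; rewrite mulr_ge0 ?powR_ge0// ltW.
transitivity (\int[lebesgue_measure]_x (f [:: x] * (beta1_density theta x)%:E)).
  exact: (integral_law_density (X := fun u : seqspace R => u 0%N : measurableTypeR R)
    (@measurable_coord R 0) b0 mb Hb).
have bE x : (0 < x < 1)%R -> beta1_density theta x = dens [:: x].
  by move=> x01; rewrite /beta1_density x01 /dens nb_recs1 seq_min1 expr1.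
rewrite /= /int01 [RHS]integral_mkcond; apply: eq_integral => x _.
rewrite patchE; case: ifPn; rewrite ?inE ?notin_setE/= in_itv/=; first by move=> /bE ->.
by move=> /negP/negbTE x01; rewrite /beta1_density x01 mule0.
Qed.

(** The conditional density of the next term, integrated against the law of the
    prefix given by the induction hypothesis, yields a joint density on the
    product of the cube and the interval; by [dens_rcons] it is the density of
    the longer prefix. *)
Lemma prefix_lawS n (f : finseq R -> \bar R) : (0 < n)%N ->
  (forall f : finseq R -> \bar R,
     (forall s, 0 <= f s) -> measurable_fun [set: finseq R] f ->
     \int[P]_u f (mkseq u n) = int01n n (fun s => f s * (dens s)%:E)) ->
  (forall s, 0 <= f s) -> measurable_fun [set: finseq R] f ->
  \int[P]_u f (mkseq u n.+1) = int01n n.+1 (fun s => f s * (dens s)%:E).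
Proof.
move=> n0 IH f0 mf.
(* the joint density of the prefix and the next term with respect to i.i.d.
   uniform variables *)
pose D (p : n.-tuple (measurableTypeR R) * measurableTypeR R) : R :=
  (dens (tval p.1) * step_density theta (seq_min (tval p.1)) p.2)%R.
have D0 p : (0 <= D p)%R by rewrite mulr_ge0 ?dens_ge0 ?step_density_ge0.
have mT : measurable_fun [set: n.-tuple (measurableTypeR R)]
    (fun t => tval t : finseq R) by exact: measurable_tval.
have mD : measurable_fun setT D.
  apply: measurable_funM.
    exact: (measurableT_comp (measurableT_comp measurable_dens mT) measurable_fst).
  apply: (measurableT_comp (g := fun p : n.-tuple (measurableTypeR R) * measurableTypeR R =>
    (seq_min (tval p.1), p.2 : R)) measurable_step_density).
  apply: measurable_fun_pair; last exact: measurable_snd.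
  exact: (measurableT_comp (measurableT_comp measurable_seq_min mT) measurable_fst).
have mX : measurable_fun [set: seqspace R]
    (prefix_tuple n : seqspace R -> n.-tuple (measurableTypeR R)).
  exact: measurable_prefix_tuple.
have mY : measurable_fun [set: seqspace R] (fun u => u n : measurableTypeR R).
  exact: measurable_coord.
have mstep r : measurable_fun [set: R] (fun y => (step_density theta r y)%:E).
  apply/measurable_EFinP.
  exact: (measurableT_comp measurable_step_density (pair1_measurable r)).
have PXY A B : measurable A -> measurable B ->
    P ((prefix_tuple n : seqspace R -> n.-tuple (measurableTypeR R)) @^-1` A `&`
       (fun u : seqspace R => u n : measurableTypeR R) @^-1` B) =
    \int[iid_uniform n]_(x in A) \int[uniform_prob (@ltr01 R)]_(y in B) (D (x, y))%:E.
  move=> mA mB.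
  pose G (s : finseq R) := int01 (fun y =>
    (\1_B y)%:E * (step_density theta (seq_min s) y)%:E).
  have G0 s : 0 <= G s.
    by apply: int01_ge0 => y; rewrite mule_ge0// lee_fin step_density_ge0.
  have mG : measurable_fun [set: finseq R] G.
    apply: (@measurable_int01 _ _ _ (fun p : finseq R * R =>
      (\1_B p.2)%:E * (step_density theta (seq_min p.1) p.2)%:E)).
      by move=> p; rewrite mule_ge0// lee_fin step_density_ge0.
    apply: emeasurable_funM; apply/measurable_EFinP.
      exact: (measurableT_comp (measurable_indic mB) measurable_snd).
    apply: (measurableT_comp (g := fun p : finseq R * R =>
      (seq_min p.1, p.2)) measurable_step_density).
    apply: measurable_fun_pair; last exact: measurable_snd.
    exact: (measurableT_comp measurable_seq_min measurable_fst).
  pose A' := @seq_tuple R n @^-1` A.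
  have mA' : measurable A' by exact: measurable_seq_tuple_preimage.
  pose h s := (\1_A' s)%:E * G s.
  have h0 s : 0 <= h s by rewrite mule_ge0// lee_fin.
  have mh : measurable_fun [set: finseq R] h.
    by apply: emeasurable_funM => //; exact/measurable_EFinP/measurable_indic.
  transitivity (\int[P]_u h (mkseq u n)).
    rewrite (Ptheta_step HP n0 mA mB) integral_mkcond.
    apply: eq_integral => u _; rewrite patchE /h.
    have -> : (u \in prefix_tuple n @^-1` A) = ((mkseq u n : finseq R) \in A').
      by apply/idP/idP; rewrite !inE /A' /preimage /= -prefix_tupleE seq_tupleK.
    rewrite indicE; case: (_ \in A'); last by rewrite mul0e.
    rewrite mul1e lebesgue_int01; last by move=> y /negPf H; rewrite /step_density H.
    by rewrite /G -prefix_tupleE.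
  rewrite IH//.
  rewrite [RHS]integral_mkcond.
  rewrite -integral_iid_uniform; last 2 first.
  - by move=> s; rewrite mule_ge0// lee_fin dens_ge0.
  - by apply: emeasurable_funM => //; apply/measurable_EFinP; exact: measurable_dens.
  apply: eq_integral => t _; rewrite patchE /h indicE.
  have -> : ((tval t : finseq R) \in A') = (t \in A).
    by apply/idP/idP; rewrite !inE /A' /preimage /= seq_tupleK.
  case: (t \in A); last by rewrite !mul0e.
  rewrite mul1e int01_indic//; last 2 first.
  - by move=> y; rewrite lee_fin.
  - apply/measurable_EFinP; exact: (measurableT_comp mD (pair1_measurable t)).
  rewrite muleC -int01Zl ?lee_fin ?dens_ge0//; last 2 first.
  - by move=> y; rewrite mule_ge0// lee_fin step_density_ge0.
  - by apply: emeasurable_funM => //; exact/measurable_EFinP/measurable_indic.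
  by apply: eq_int01 => y _; rewrite EFinM muleCA.
transitivity (\int[P]_u f (rcons (tval (prefix_tuple n u)) (u n))).
  by apply: eq_integral => u _; rewrite prefix_tupleE mkseqS.
have mfr : measurable_fun setT
  (fun p : n.-tuple (measurableTypeR R) * measurableTypeR R => f (rcons (tval p.1) p.2)).
  apply: (measurableT_comp mf); apply: measurable_rconsf; first exact: measurable_snd.
  exact: (measurableT_comp mT measurable_fst).
rewrite (integral_joint_density mX mY D0 mD PXY
  (f := fun p => f (rcons (tval p.1) p.2)))//.
pose Df (p : finseq R * R) :=
  f (rcons p.1 p.2) * (dens p.1 * step_density theta (seq_min p.1) p.2)%:E.
have Df0 p : 0 <= Df p.
  by rewrite mule_ge0// lee_fin mulr_ge0 ?dens_ge0 ?step_density_ge0.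
have mDf : measurable_fun [set: finseq R * R] Df.
  apply: emeasurable_funM.
    by apply: (measurableT_comp mf); exact: measurable_rconsf.
  apply/measurable_EFinP; apply: measurable_funM.
    exact: (measurableT_comp measurable_dens measurable_fst).
  apply: (measurableT_comp (g := fun p : finseq R * R =>
    (seq_min p.1, p.2)) measurable_step_density).
  apply: measurable_fun_pair; last exact: measurable_snd.
  exact: (measurableT_comp measurable_seq_min measurable_fst).
transitivity (\int[iid_uniform n]_t int01 (fun y => Df (tval t, y))).
  apply: eq_integral => t _; rewrite -int01_uniform//.
  exact: (measurableT_comp (g := pair (tval t : finseq R)) mDf (pair1_measurable _)).
rewrite (@integral_iid_uniform _ n (fun s => int01 (fun y => Df (s, y)))); last 2 first.
- by move=> s; exact: int01_ge0.
- exact: measurable_int01.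
rewrite int01n_rcons; apply: eq_int01n => s sn s01; apply: eq_int01 => y y01.
rewrite /Df/= dens_rcons//.
by rewrite -size_eq0 sn -lt0n.
Qed.

Lemma prefix_law n (f : finseq R -> \bar R) : (0 < n)%N ->
  (forall s, 0 <= f s) -> measurable_fun [set: finseq R] f ->
  \int[P]_u f (mkseq u n) = int01n n (fun s => f s * (dens s)%:E).
Proof.
case: n => // n _; elim: n f => [|n IH] f; first exact: prefix_law1.
exact: prefix_lawS.
Qed.

Lemma prefix_prob n (A : set (finseq R)) : (0 < n)%N -> measurable A ->
  P [set u | A (mkseq u n)] = int01n n (fun s => (\1_A s)%:E * (dens s)%:E).
Proof.
move=> n0 mA; rewrite -(@prefix_law _ (fun s => (\1_A s)%:E))//; last first.
  exact/measurable_EFinP/measurable_indic.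
transitivity (\int[P]_u (\1_((fun u : seqspace R => mkseq u n) @^-1` A) u)%:E).
  rewrite integral_indic// ?setIT//.
  rewrite -[X in measurable X]setTI; exact: measurable_mkseq.
by apply: eq_integral => u _; rewrite !indicE.
Qed.

End prefix_law.

(** * Stretches as the blocks of a finite sequence *)

Section blocks.
Context {R : realType}.
Implicit Types (u v : nat -> R) (s cur : seq R) (x y : R).

(** [cur] is the block under construction and [x] its first term, which is the
    running minimum: a new block opens exactly at a new lower record. *)
Fixpoint blocks_from cur x s : seq (seq R) :=
  if s is y :: s' then
    if y < x then cur :: blocks_from [:: y] y s' else blocks_from (rcons cur y) x s'
  else [:: cur].

Definition blocks s := if s is x :: s' then blocks_from [:: x] x s' else [::].

(** The empty sequence counts as starting below [x], since a block may also end
    because the sequence ends. *)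
Definition starts_below x s := if s is y :: _ then y < x else true.

Lemma blocks_from_cat cur x s1 s2 :
  all (fun y => x <= y) s1 -> starts_below x s2 ->
  blocks_from cur x (s1 ++ s2) = (cur ++ s1) :: blocks s2.
Proof.
elim: s1 cur => [|y s1 IH] cur /=.
  by move=> _; case: s2 => [|y s2] /=; rewrite cats0// => ->.
by move=> /andP[xy xs1] yx; rewrite ltNge xy/= IH// cat_rcons.
Qed.

Lemma blocks_cat x s1 s2 : all (fun y => x <= y) s1 -> starts_below x s2 ->
  blocks (x :: s1 ++ s2) = (x :: s1) :: blocks s2.
Proof. exact: blocks_from_cat. Qed.

Lemma first_block x s : exists a, [/\ (a <= size s)%N,
  all (fun y => x <= y) (take a s) & starts_below x (drop a s)].
Proof.
elim: s => [|y s [a [an H1 H2]]]; first by exists 0%N.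
have [xy|yx] := leP x y; last by exists 0%N.
by exists a.+1; rewrite /= xy.
Qed.

Lemma first_block_uniq x s a b : (a <= size s)%N -> (b <= size s)%N ->
  all (fun y => x <= y) (take a s) -> starts_below x (drop a s) ->
  all (fun y => x <= y) (take b s) -> starts_below x (drop b s) -> a = b.
Proof.
elim: s a b => [|y s IH] [|a] [|b] //=.
- by move=> _ _ _ yx /andP[xy]; rewrite ltNge xy in yx.
- by move=> _ _ /andP[xy _] _ _; rewrite ltNge xy.
- by move=> an bn /andP[_ H1] H2 /andP[_ H3] H4; congr S; exact: IH.
Qed.

(** If [a] is the second record index, the sequence that starts at [a] has the
    same records and the same stretches as [u], apart from the first
    stretch. *)
Section shift.
Variables (u : nat -> R) (a : nat).
Hypotheses (a0 : (0 < a)%N) (ua : lower_record u a)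
  (u0 : forall i, (i < a)%N -> u 0%N <= u i).

Let v i := u (a + i)%N.

(** The terms before [a] are all above [u a], which is the first term of the
    shifted sequence, so they put no further constraint on later records. *)
Lemma lower_record_shift i : lower_record v i = lower_record u (a + i).
Proof.
apply/lower_recordP/lower_recordP => H j ji; last first.
  by apply: H; rewrite ltn_add2l.
have [ja|aj] := ltnP j a; last first.
  by rewrite -(subnKC aj); apply: H; rewrite ltn_subLR.
case: i H ji => [|i] H ji; first by rewrite /v addn0; exact: (lower_recordP _ _ ua).
by have := H 0%N isT; rewrite /v addn0 => /lt_trans; apply; exact: (lower_recordP _ _ ua).
Qed.

Lemma nb_records_first i : (0 < i <= a)%N -> nb_records u i = 1%N.
Proof.
elim: i => // -[|i] IH ia; first by rewrite nb_recordsS nb_records0 lower_record0.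
rewrite nb_recordsS IH; last by rewrite /= ltnW.
suff /negPf -> : ~~ lower_record u i.+1 by [].
apply/negP => /lower_recordP/(_ 0%N isT); rewrite ltNge u0//.
Qed.

Lemma nb_records_shift i : nb_records u (a + i) = (nb_records v i).+1.
Proof.
elim: i => [|i IH]; first by rewrite addn0 nb_records0 nb_records_first ?a0 ?leqnn.
by rewrite addnS !nb_recordsS IH lower_record_shift addSn.
Qed.

Lemma record_index_shift k i : lower_record v i -> nb_records v i = k ->
  record_index u k.+1 = (a + record_index v k)%N.
Proof.
move=> vi ik; rewrite (record_indexP vi ik); apply: record_indexP.
  by rewrite -lower_record_shift.
by rewrite nb_records_shift ik.
Qed.

Lemma stretch_shift k L : lower_record v L -> (k < nb_records v L)%N ->
  stretch u k.+1 = stretch v k.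
Proof.
move=> vL kL.
have [i [iL vi ik]] := record_exists kL.
have [j vj jk] : exists2 j, lower_record v j & nb_records v j = k.+1.
  have [kL'|kL'] := ltnP k.+1 (nb_records v L).
    by have [j [? ? ?]] := record_exists kL'; exists j.
  by exists L => //; apply/eqP; rewrite eqn_leq kL' kL.
rewrite /stretch (record_index_shift vi ik) (record_index_shift vj jk).
by rewrite subnDl iotaDl -map_comp.
Qed.

Lemma stretch0 : stretch u 0 = mkseq u a.
Proof.
rewrite /stretch (@record_indexP _ u 0 0)//; [|exact: lower_record0|exact: nb_records0].
by rewrite (@record_indexP _ u a 1) ?subn0// nb_records_first ?a0 ?leqnn.
Qed.

End shift.

Lemma mkseq_cat u a b : mkseq u (a + b) = mkseq u a ++ mkseq (fun i => u (a + i)%N) b.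
Proof. by rewrite /mkseq iotaD map_cat add0n -[X in iota X b]addn0 iotaDl -map_comp. Qed.

Lemma first_record u L : lower_record u L -> (0 < L)%N ->
  exists a, [/\ (0 < a <= L)%N, lower_record u a & forall i, (i < a)%N -> u 0%N <= u i].
Proof.
move=> uL L0.
have [|a /andP[a0 ua] amin] := @ex_minnP (fun a => (0 < a)%N && lower_record u a).
  by exists L; rewrite L0.
exists a; split => //; first by rewrite a0 amin// L0.
move=> i; elim/ltn_ind: i => i IH ia.
have [->//|i0] := posnP i.
have : ~~ lower_record u i.
  by apply/negP => ui; have := amin i; rewrite i0 ui => /(_ isT); rewrite leqNgt ia.
move=> nui; have [//|u0i] := leP (u 0%N) (u i); exfalso; apply/negP: nui.
rewrite negbK; apply/lower_recordP => j ji.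
by apply: lt_le_trans u0i _; apply: IH => //; exact: ltn_trans ia.
Qed.

(** The cut at [L] must fall on a record for the last block to be a complete
    stretch. *)
Lemma blocks_mkseq u L : lower_record u L ->
  blocks (mkseq u L) = [seq stretch u k | k <- iota 0 (nb_records u L)].
Proof.
elim/ltn_ind: L u => L IH u uL.
have [->|L0] := posnP L; first by rewrite nb_records0.
have [a [/andP[a0 aL] ua u0]] := first_record uL L0.
rewrite -(subnKC aL); set b := (L - a)%N.
have vb : lower_record (fun i => u (a + i)%N) b.
  by rewrite lower_record_shift// subnKC.
rewrite mkseq_cat nb_records_shift//= (stretch0 a0 ua u0).
have -> : mkseq u a = u 0%N :: mkseq (fun i => u (1 + i)%N) a.-1.
  by rewrite -(prednK a0) -add1n mkseq_cat.
rewrite cat_cons blocks_cat; last 2 first.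
- apply/allP => x /mapP[i]; rewrite mem_iota/= add0n => ia ->; apply: u0.
  by rewrite add1n -(prednK a0) ltnS.
- rewrite /mkseq; case: b vb => // b' _ /=; rewrite addn0.
  exact: (lower_recordP _ _ ua).
congr cons; rewrite IH//; last by rewrite ltn_subrL a0.
rewrite -[1%N]addn0 iotaDl -map_comp; apply/eq_in_map => k.
rewrite mem_iota/= add0n => kb.
by rewrite add1n (stretch_shift a0 ua u0 vb kb).
Qed.

(** The finite sequence continued by a constant below all its terms, so that
    its length becomes a record index of the continuation and [blocks_mkseq]
    applies. *)
Definition pad s i := if (i < size s)%N then nth 0 s i else seq_min s - 1.

Lemma mkseq_pad s : mkseq (pad s) (size s) = s.
Proof.
apply: (@eq_from_nth _ 0); first by rewrite size_mkseq.
by rewrite size_mkseq => i si; rewrite nth_mkseq// /pad si.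
Qed.

Lemma lower_record_pad s : lower_record (pad s) (size s).
Proof.
have [->|s0] := eqVneq s [::]; first exact: lower_record0.
rewrite lower_record_mkseq; last by rewrite lt0n size_eq0.
by rewrite mkseq_pad /pad ltnn ltrBlDr ltrDl.
Qed.

Lemma nb_records_pad s : nb_records (pad s) (size s) = nb_recs s.
Proof. by rewrite -[in RHS](mkseq_pad s) nb_recs_mkseq. Qed.

Lemma blocksE s : blocks s = [seq stretch (pad s) k | k <- iota 0 (nb_recs s)].
Proof.
by rewrite -nb_records_pad -blocks_mkseq ?mkseq_pad//; exact: lower_record_pad.
Qed.

Lemma size_blocks s : size (blocks s) = nb_recs s.
Proof. by rewrite blocksE size_map size_iota. Qed.

Lemma measurable_pad i : measurable_fun [set: finseq R] (fun s => pad s i).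
Proof.
apply: (measurable_fun_nat_dep (f := size : finseq R -> nat)
  (g := fun n s => if (i < n)%N then nth 0 s i else seq_min s - 1)).
  exact: measurable_size.
move=> n; case: (i < n)%N; first exact: measurable_nth.
by apply: measurable_funB; [exact: measurable_seq_min|exact: measurable_cst].
Qed.

End blocks.

Section count_stretches.
Context {R : realType} d (Y : measurableType d) (u : Y -> nat -> R).
Hypothesis mu : forall i, measurable_fun [set: Y] (fun y => u y i).
Variable B : set (finseq R).
Hypothesis mB : measurable B.

Lemma measurable_count_stretch K n :
  measurable [set y | count (fun b : finseq R => b \in B)
    [seq stretch (u y) k | k <- iota 0 K] = n].
Proof.
elim: K n => [|K IH] n; first exact: (@measurable_prop _ Y (0%N = n)).
have mV : measurable [set y | B (stretch (u y) K)].
  by rewrite -[X in measurable X]setTI; exact: measurable_stretch.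
rewrite (_ : mkset _ =
    ([set y | B (stretch (u y) K)] `&` [set y | (count (fun b : finseq R => b \in B)
       [seq stretch (u y) k | k <- iota 0 K]).+1 = n]) `|`
    (~` [set y | B (stretch (u y) K)] `&` [set y | count (fun b : finseq R => b \in B)
       [seq stretch (u y) k | k <- iota 0 K] = n])).
  apply: measurableU; apply: measurableI => //.
    exact: (@measurable_pred_nat _ _ (fun y => count (fun b : finseq R => b \in B)
      [seq stretch (u y) k | k <- iota 0 K]) (fun m => m.+1 = n)).
  exact: measurableC.
have cS v : count (fun b : finseq R => b \in B) [seq stretch v k | k <- iota 0 K.+1] =
    (count (fun b : finseq R => b \in B) [seq stretch v k | k <- iota 0 K] +
     ((stretch v K : finseq R) \in B))%N.
  by rewrite -[K.+1]addn1 iotaD map_cat count_cat/= add0n addn0.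
apply/seteqP; split => y; rewrite /mkset cS.
  have [BK|BK] := pselect (B (stretch (u y) K)).
    by rewrite mem_set// addn1 => cn; left.
  by rewrite memNset// addn0 => cn; right.
by move=> [[/= BK <-]|[/= BK <-]]; rewrite ?(mem_set BK) ?(memNset BK) ?addn1 ?addn0.
Qed.

End count_stretches.

(** Measurability of the blocks is inherited from that of the stretches of an
    infinite sequence, through [pad]. *)
Lemma measurable_count_blocks {R : realType} (B : set (finseq R)) n : measurable B ->
  measurable [set s : finseq R | count (fun b : finseq R => b \in B) (blocks s) = n].
Proof.
move=> mB; rewrite (_ : mkset _ = \bigcup_K ([set s | nb_recs s = K] `&`
    [set s : finseq R | count (fun b : finseq R => b \in B)
      [seq stretch (pad s) k | k <- iota 0 K] = n])).
  apply: bigcupT_measurable => K; apply: measurableI; first exact: measurable_nb_recs.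
  exact: (@measurable_count_stretch R _ _ (fun s : finseq R => pad s) (@measurable_pad R)).
apply/seteqP; split => [s /=|s [K _ [/= <-]]]; rewrite blocksE//.
by move=> <-; exists (nb_recs s).
Qed.

(** * The recursion on the first block *)

(** Summation along antidiagonals, legitimate because all terms are
    nonnegative. *)
Lemma cauchy_nneseries {R : realType} (A : nat -> nat -> \bar R) :
  (forall a b, 0 <= A a b)%E ->
  (\sum_(L <oo) \sum_(a < L.+1) A a (L - a)%N = \sum_(a <oo) \sum_(b <oo) A a b)%E.
Proof.
move=> A0.
(* the entry of row [a] on the antidiagonal [L]; the rows are completed by
   zeros below the diagonal so that the sums may be exchanged *)
pose D a L := (if (a <= L)%N then A a (L - a)%N else 0)%E.
have D0 a L : (0 <= D a L)%E by rewrite /D; case: ifP.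
transitivity (\sum_(L <oo) \sum_(a <oo) D a L)%E.
  apply: eq_eseriesr => L _.
  rewrite (nneseries_split 0 L.+1)//.
  rewrite [X in (_ + X)%E]eseries0 ?adde0//; last first.
    by move=> i Li _; rewrite /D leqNgt Li.
  rewrite add0n big_mkord; apply: eq_bigr => a _.
  by rewrite /D -ltnS ltn_ord.
rewrite nneseries_interchange//; apply: eq_eseriesr => a _.
rewrite (nneseries_split 0 a)//.
rewrite big1_seq ?add0e; last first.
  by move=> i /andP[_]; rewrite mem_index_iota add0n => /andP[_ ia]; rewrite /D leqNgt ia.
rewrite add0n -nneseries_addn//; apply: eq_eseriesr => b _.
by rewrite /D leq_addl addnK.
Qed.

(** A colouring [c] of finite sequences sorts the blocks into finitely many
    classes, and [n] prescribes how many blocks of each colour there are. *)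
Section block_recursion.
Context {R : realType} (C : finType) (c : finseq R -> C) (r : R).
Hypothesis mc : forall i, measurable [set s | c s = i].
Implicit Types (n : {ffun C -> nat}) (x y : R) (s : seq R).

Definition has_counts n s : bool :=
  [forall i, count (fun b => c b == i) (blocks s) == n i].

Definition decr n i : {ffun C -> nat} := [ffun j => (n j - (j == i))%N].

Lemma measurable_has_counts n : measurable [set s : finseq R | has_counts n s].
Proof.
rewrite (_ : mkset _ = \bigcap_(i in [set: C]) [set s : finseq R |
    count (fun b : finseq R => b \in [set s | c s = i]) (blocks s) = n i]).
  apply: fin_bigcap_measurable; first exact: finite_finset.
  by move=> i _; exact: measurable_count_blocks.
have E i s : count (fun b : finseq R => b \in [set s | c s = i]) (blocks s) =
    count (fun b => c b == i) (blocks s).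
  by apply: eq_count => b /=; apply/idP/eqP; rewrite inE.
apply/seteqP; split => [s /forallP H i _ /=|s H].
  by rewrite E; apply/eqP; exact: H.
by apply/forallP => i; rewrite -E; apply/eqP; exact: H.
Qed.

Lemma has_counts_cons n x s1 s2 : all (fun y => x <= y) s1 -> starts_below x s2 ->
  has_counts n (x :: s1 ++ s2) =
  (0 < n (c (x :: s1)))%N && has_counts (decr n (c (x :: s1))) s2.
Proof.
move=> xs1 xs2; rewrite /has_counts blocks_cat//=; set i0 := c _.
apply/forallP/andP => [H|[n0 /forallP H] i].
  have n0 : (0 < n i0)%N by rewrite -(eqP (H i0)) eqxx.
  split => //; apply/forallP => i; rewrite ffunE -(eqP (H i)).
  by rewrite [i == i0]eq_sym addKn.
have := H i; rewrite ffunE => /eqP ->; rewrite [i == i0]eq_sym.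
by case: (eqVneq i0 i) => [<-|_]; rewrite ?subn0 ?subnKC.
Qed.

(** The sequences that may follow a block with first term [x], all of whose
    terms lie above the level [r]. *)
Definition admissible n x s : bool :=
  [&& starts_below x s, all (fun y => r < y) s & has_counts n s].

Definition head_block x i s : bool :=
  if s is y :: t then [&& y < x, r < y, all (fun z => y <= z) t & c s == i] else false.

(** The first block of [s] has exactly one length and one colour, so at most
    one term of the double sum is nonzero. *)
Lemma admissible_rec n x s L : size s = L.+1 ->
  (admissible n x s : nat) = (\sum_(a < L.+1) \sum_(i | 0 < n i)
     (head_block x i (take a.+1 s) && admissible (decr n i) (head 0%R s) (drop a.+1 s)))%N.
Proof.
case: s => // y t [tL].
(* the first block is [y] followed by the [a0] first terms of [t] *)
have [a0 [a0t ya0 ba0]] := first_block y t.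
have a0L : (a0 < L.+1)%N by rewrite ltnS -tL.
rewrite (bigD1 (Ordinal a0L))//= [X in (_ + X)%N]big1 ?addn0; last first.
  move=> a /eqP aa0; rewrite big1// => i _; apply/eqP; rewrite eqb0.
  apply/negP => /andP[/and4P[_ _ ya _]] /and3P[ba _ _]; apply: aa0.
  apply/val_inj => /=; apply: (first_block_uniq _ _ ya ba ya0 ba0) => //.
  by rewrite tL -ltnS.
have -> : admissible n x (y :: t) = [&& y < x, r < y, all (fun z => r < z) (drop a0 t),
    (0 < n (c (y :: take a0 t)))%N & has_counts (decr n (c (y :: take a0 t))) (drop a0 t)].
  rewrite /admissible /= -[in has_counts _ _](cat_take_drop a0 t) has_counts_cons//.
  congr andb; rewrite -!andbA; have [ry/=|//] := ltP r y.
  rewrite -[in all _ t](cat_take_drop a0 t) all_cat.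
  rewrite (_ : all (fun z => r < z) (take a0 t))//.
  by apply: sub_all ya0 => z; exact: lt_le_trans.
rewrite ya0 /=; set i0 := c _.
rewrite (eq_bigr (fun i => if i0 == i then ([&& y < x, r < y,
    all (fun z => r < z) (drop a0 t) & has_counts (decr n i) (drop a0 t)] : nat) else 0%N)); last first.
  by move=> i _; rewrite /admissible ba0; case: eqP => _; rewrite ?andbF//= ?andbT -!andbA.
rewrite -big_mkcondr/=.
have [n0|n0] := boolP (0 < n i0)%N.
  by rewrite (big_pred1 i0) ?n0// => i; rewrite /= eq_sym; case: eqP => [->|]; rewrite ?n0 ?andbF.
by rewrite big_pred0 ?andbF// => i; case: eqP => [<-|]; rewrite ?(negPf n0) ?andbF.
Qed.

End block_recursion.

Section bool_ereal.
Context {R : realType}.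
Local Open Scope ereal_scope.

Definition b2e (b : bool) : \bar R := (b%:R)%:E.

Lemma b2e0 : b2e false = 0 :> \bar R. Proof. by []. Qed.

Lemma b2e1 : b2e true = 1 :> \bar R. Proof. by []. Qed.

Lemma b2e_ge0 b : 0 <= b2e b.
Proof. by rewrite lee_fin. Qed.

Lemma b2eM a b : b2e (a && b) = b2e a * b2e b.
Proof. by rewrite /b2e -EFinM -natrM mulnb. Qed.

Lemma measurable_b2e d (Y : measurableType d) (b : Y -> bool) :
  measurable [set y | b y] -> measurable_fun [set: Y] (fun y => b2e (b y)).
Proof.
move=> mb; rewrite (_ : (fun y => _) = fun y => (\1_[set y | b y] y)%:E).
  exact/measurable_EFinP/measurable_indic.
by apply/funext => y; rewrite indicE /b2e; congr ((nat_of_bool _)%:R)%:E; apply/idP/idP; rewrite inE.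
Qed.

End bool_ereal.

(** Unlike in [nneseriesZl], the factor may be infinite, as volumes a priori
    are. *)
Lemma nneseriesMl {R : realType} (k : \bar R) (f : nat -> \bar R) :
  (0 <= k -> (forall i, 0 <= f i) ->
  \sum_(i <oo) (k * f i) = k * \sum_(i <oo) f i)%E.
Proof.
move=> k0 f0; rewrite -!ge0_integral_count//; last by move=> i; rewrite mule_ge0.
by rewrite ge0_integralZl.
Qed.

Section block_series.
Context {R : realType} (C : finType) (c : finseq R -> C) (r : R).
Hypothesis mc : forall i, measurable [set s | c s = i].
Implicit Types (n : {ffun C -> nat}) (x y : R) (s : seq R).
Local Open Scope ereal_scope.

Lemma measurable_starts_below d (Y : measurableType d) (X : Y -> R) (S : Y -> finseq R) :
  measurable_fun [set: Y] X -> measurable_fun [set: Y] S ->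
  measurable [set y | starts_below (X y) (S y)].
Proof.
move=> mX mS; rewrite (_ : mkset _ =
    [set y | (size (S y) == 0%N) || (nth 0%R (S y) 0 < X y)%R]).
  apply: measurable_orb; first exact: (measurable_fun_preimage mS measurable_nil).
  apply: measurable_ltb => //; exact: (measurableT_comp (measurable_nth 0) mS).
by apply/seteqP; split => y /=; case: (S y).
Qed.

Lemma measurable_admissible n d (Y : measurableType d) (X : Y -> R) (S : Y -> finseq R) :
  measurable_fun [set: Y] X -> measurable_fun [set: Y] S ->
  measurable [set y | admissible c r n (X y) (S y)].
Proof.
move=> mX mS; apply: measurable_andb; first exact: measurable_starts_below.
apply: measurable_andb; first exact: (measurable_fun_preimage mS (measurable_all_gt r)).
exact: (measurable_fun_preimage mS (measurable_has_counts mc n)).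
Qed.

Lemma measurable_head_block x i : measurable [set s : finseq R | head_block c r x i s].
Proof.
rewrite (_ : mkset _ = [set s : finseq R | (~~ (size s == 0%N)) &&
    ((nth 0%R s 0 < x)%R && ((r < nth 0%R s 0)%R &&
    ((nth 0%R s 0 <= seq_min s)%R && (c s == i))))]).
  have mn0 := @measurable_nth R 0.
  apply: measurable_andb; first exact: measurable_nnil.
  apply: measurable_andb; first exact: measurable_ltb.
  apply: measurable_andb; first exact: measurable_ltb.
  apply: measurable_andb; first by apply: measurable_leb => //; exact: measurable_seq_min.
  rewrite (_ : mkset _ = [set s | c s = i])//.
  by apply/seteqP; split => s /= /eqP.
by apply/seteqP; split => -[|y t] //=; rewrite le_seq_min//= lexx.
Qed.

Definition admissible_ind n x s : \bar R := b2e (admissible c r n x s).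

(** The Lebesgue volume, over all lengths together, of the admissible
    continuations. It is the quantity computed by the recursion on the first
    block, as a function of [x]. *)
Definition volume n x : \bar R := \sum_(L <oo) int01n L (admissible_ind n x).

Lemma admissible_ind_ge0 n x s : 0 <= admissible_ind n x s. Proof. exact: b2e_ge0. Qed.
Hint Resolve admissible_ind_ge0 : core.

Lemma measurable_admissible_ind n x : measurable_fun [set: finseq R] (admissible_ind n x).
Proof.
by apply: measurable_b2e; apply: measurable_admissible => //; exact: measurable_cst.
Qed.

Lemma measurable_int01n_admissible L n :
  measurable_fun [set: R] (fun x => int01n L (admissible_ind n x)).
Proof.
apply: (@measurable_int01n_param _ L _ R (fun p => admissible_ind n p.1 p.2)) => //.
apply: measurable_b2e; apply: measurable_admissible; [exact: measurable_fst|exact: measurable_snd].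
Qed.

Lemma int01n_admissible_ge0 L n x : 0 <= int01n L (admissible_ind n x).
Proof. exact: int01n_ge0. Qed.
Hint Resolve int01n_admissible_ge0 : core.

Lemma volume_ge0 n x : 0 <= volume n x.
Proof. by apply: nneseries_ge0. Qed.

Lemma measurable_volume n : measurable_fun [set: R] (volume n).
Proof.
apply: (eq_measurable_fun (fun x => \sum_(L <oo | L \in predT) int01n L (admissible_ind n x))).
  by move=> x _; apply: eq_eseriesl.
by apply: ge0_emeasurable_sum => // k _; exact: measurable_int01n_admissible.
Qed.

Lemma measurable_head : measurable_fun [set: finseq R] (fun s : finseq R => head 0%R s).
Proof.
by rewrite (_ : (fun s => _) = fun s => nth 0%R s 0); [exact: measurable_nth|
  apply/funext; case].
Qed.

(** [admissible_rec] integrated: the terms of the first block and those of the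
    remainder are separate groups of coordinates, and the remainder sees of the
    first block only its first term. *)
Lemma int01n_admissible_rec n x L : int01n L.+1 (admissible_ind n x) =
  \sum_(a < L.+1) \sum_(i | (0 < n i)%N)
    int01n a.+1 (fun s => b2e (head_block c r x i s) * int01n (L - a) (admissible_ind (decr n i) (head 0%R s))).
Proof.
pose F (a : 'I_L.+1) i s := b2e (head_block c r x i (take a.+1 s)) *
  admissible_ind (decr n i) (head 0%R s) (drop a.+1 s).
have F0 a i s : 0 <= F a i s by rewrite mule_ge0 ?b2e_ge0.
have mF a i : measurable_fun [set: finseq R] (F a i).
  apply: emeasurable_funM.
    apply: measurable_b2e.
    exact: (measurable_fun_preimage (measurable_takef a.+1) (measurable_head_block x i)).
  by apply: measurable_b2e; apply: measurable_admissible;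
    [exact: measurable_head|exact: measurable_dropf].
transitivity (int01n L.+1 (fun s => \sum_(a < L.+1) \sum_(i | (0 < n i)%N) F a i s)).
  apply: eq_int01n => s sL _; rewrite /admissible_ind /b2e (admissible_rec c r n x sL).
  rewrite natr_sum -sumEFin; apply: eq_bigr => a _.
  rewrite natr_sum -sumEFin; apply: eq_bigr => i _.
  by rewrite /F /admissible_ind -b2eM.
rewrite (@int01n_sum_cond _ _ _ _ xpredT (fun a s => \sum_(i | (0 < n i)%N) F a i s)); last 2 first.
- by move=> a s; apply: sume_ge0.
- move=> a; apply: (eq_measurable_fun (fun s : finseq R =>
    \sum_(i <- [seq i <- index_enum C | (0 < n i)%N]) F a i s)).
    by move=> s _; rewrite big_filter.
  exact: emeasurable_sum.
apply: eq_bigr => a _; rewrite int01n_sum_cond//; apply: eq_bigr => i _.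
transitivity (int01n (a.+1 + (L - a)) (F a i)).
  by congr (int01n _ _); rewrite addSn subnKC// -ltnS.
rewrite int01n_cat; apply: eq_int01n => s sa _.
rewrite -int01nZl ?b2e_ge0//; last exact: measurable_admissible_ind.
apply: eq_int01n => t _ _; rewrite /F take_size_cat// drop_size_cat//.
by case: s sa.
Qed.

(** The volume, over all lengths, of the sequences that complete the head [y]
    to a block of colour [i]. *)
Definition ctail_vol i y : \bar R := \sum_(a <oo)
  int01n a (fun t => b2e (all (fun z => (y <= z)%R) t && (c (y :: t) == i))).

Let ctail_ind i (p : R * finseq R) : \bar R :=
  b2e (all (fun z => (p.1 <= z)%R) p.2 && (c (p.1 :: p.2) == i)).

Lemma measurable_ctail_ind i : measurable_fun [set: R * finseq R] (ctail_ind i).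
Proof.
have mS : measurable_fun [set: R * finseq R] (fun p => p.1 :: p.2 : finseq R).
  by apply: measurable_consf; [exact: measurable_fst|exact: measurable_snd].
apply: measurable_b2e; apply: measurable_andb.
  rewrite (_ : mkset _ = [set p : R * finseq R | (p.1 <= seq_min (p.1 :: p.2))%R]).
    apply: measurable_leb; first exact: measurable_fst.
    exact: (measurableT_comp measurable_seq_min mS).
  by apply/seteqP; split => p /=; rewrite le_seq_min//= lexx.
rewrite (_ : mkset _ = [set p : R * finseq R | c (p.1 :: p.2) = i]).
  exact: (measurable_fun_preimage mS (mc i)).
by apply/seteqP; split => p /= /eqP.
Qed.

Let ctail_ind_ge0 i p : 0 <= ctail_ind i p. Proof. exact: b2e_ge0. Qed.

Lemma ctail_vol_ge0 i y : 0 <= ctail_vol i y.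
Proof. by apply: nneseries_ge0 => a _ _; apply: int01n_ge0 => t; exact: b2e_ge0. Qed.

Lemma measurable_int01n_ctail a i : measurable_fun [set: R] (fun y =>
  int01n a (fun t => b2e (all (fun z => (y <= z)%R) t && (c (y :: t) == i)))).
Proof. exact: (@measurable_int01n_param _ a _ R (ctail_ind i) (ctail_ind_ge0 i) (measurable_ctail_ind i)). Qed.

Lemma measurable_ctail_vol i : measurable_fun [set: R] (ctail_vol i).
Proof.
apply: (eq_measurable_fun (fun y => \sum_(a <oo | a \in predT)
  int01n a (fun t => ctail_ind i (y, t)))); first by move=> x _; apply: eq_eseriesl.
apply: ge0_emeasurable_sum => [a y _ _|a _]; first exact: int01n_ge0.
exact: measurable_int01n_ctail.
Qed.

(** Splitting off the first block, with head [y] between [r] and [x]: the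
    completions of [y] to a block of colour [i] have volume [ctail_vol i y],
    and the remainder is an admissible continuation of a block with first term
    [y], with one block of colour [i] fewer. *)
Lemma volume_rec n x : volume n x = b2e [forall i, n i == 0%N] +
  \sum_(i | (0 < n i)%N)
    int01 (fun y => b2e ((y < x)%R && (r < y)%R) * (ctail_vol i y * volume (decr n i) y)).
Proof.
rewrite /volume nneseries_recl//.
congr (_ + _).
  rewrite /= /admissible_ind /admissible/= /has_counts/=; congr b2e.
  by apply: eq_forallb => i; rewrite eq_sym.
rewrite -nneseries_addn//.
pose A i a b := int01n a.+1 (fun s => b2e (head_block c r x i s) *
  int01n b (admissible_ind (decr n i) (head 0%R s))).
have mF i b : measurable_fun [set: finseq R]
    (fun s => b2e (head_block c r x i s) * int01n b (admissible_ind (decr n i) (head 0%R s))).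
  apply: emeasurable_funM; first by apply: measurable_b2e; exact: measurable_head_block.
  exact: (measurableT_comp (measurable_int01n_admissible b (decr n i)) measurable_head).
have F0 i b s : 0 <= b2e (head_block c r x i s) * int01n b (admissible_ind (decr n i) (head 0%R s)).
  by rewrite mule_ge0 ?b2e_ge0.
have A0 i a b : 0 <= A i a b by exact: int01n_ge0.
transitivity (\sum_(L <oo) \sum_(a < L.+1) \sum_(i | (0 < n i)%N) A i a (L - a)%N).
  by apply: eq_eseriesr => L _; rewrite addn1 int01n_admissible_rec.
rewrite (cauchy_nneseries (A := fun a b => \sum_(i | (0 < n i)%N) A i a b)); last first.
  by move=> a b; apply: sume_ge0.
transitivity (\sum_(i | (0 < n i)%N) \sum_(a <oo) \sum_(b <oo) A i a b).
  rewrite -nneseries_sum//; last by move=> i a _; apply: nneseries_ge0.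
  by apply: eq_eseriesr => a _; rewrite nneseries_sum.
apply: eq_bigr => i _.
transitivity (\sum_(a <oo) int01 (fun y =>
    b2e ((y < x)%R && (r < y)%R) * volume (decr n i) y *
    int01n a (fun t => ctail_ind i (y, t)))).
  apply: eq_eseriesr => a _; rewrite -int01n_series//=.
  apply: eq_int01 => y _.
  have k0 : 0 <= b2e ((y < x)%R && (r < y)%R) * volume (decr n i) y.
    by rewrite mule_ge0 ?b2e_ge0 ?volume_ge0.
  have mh : measurable_fun [set: finseq R] (fun t => ctail_ind i (y, t)).
    exact: (measurableT_comp (measurable_ctail_ind i) (pair1_measurable y)).
  rewrite -(int01nZl a k0 (fun t => ctail_ind_ge0 i (y, t)) mh).
  apply: eq_int01n => t _ _; rewrite /= nneseriesZl//.
  by rewrite -[X in X * _]/(b2e _) andbA b2eM muleAC.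
rewrite -int01_series; last 2 first.
- move=> a y; rewrite mule_ge0//; first by rewrite mule_ge0 ?b2e_ge0 ?volume_ge0.
  exact: int01n_ge0.
- move=> a; apply: emeasurable_funM; last exact: measurable_int01n_ctail.
  apply: emeasurable_funM; last exact: measurable_volume.
  apply: measurable_b2e; apply: measurable_andb; apply: measurable_ltb => //;
    exact: measurable_cst.
apply: eq_int01 => y _; rewrite nneseriesMl; last 2 first.
- by rewrite mule_ge0 ?b2e_ge0 ?volume_ge0.
- by move=> a; apply: int01n_ge0 => t; exact: ctail_ind_ge0.
by rewrite -muleA [volume _ _ * _]muleC.
Qed.

End block_series.

(** * Primitives above a level, and the solution of the recursion *)

(** An integral form of differential calculus above the level [r]. Here
    [primitive G g] says that [g] is the derivative of [G], in the sense of an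
    indefinite Lebesgue integral from [r]; no continuity of [g] is available,
    since colourings are only measurable. *)
Section primitives.
Context {R : realType} (r : R).
Local Open Scope ereal_scope.

Definition win (x y : R) : \bar R := b2e ((y < x)%R && (r < y)%R).

Lemma win_ge0 x y : 0 <= win x y. Proof. exact: b2e_ge0. Qed.

Lemma measurable_win d (Y : measurableType d) (f g : Y -> R) :
  measurable_fun [set: Y] f -> measurable_fun [set: Y] g ->
  measurable_fun [set: Y] (fun y => win (f y) (g y)).
Proof.
move=> mf mg; apply: measurable_b2e; apply: measurable_andb; apply: measurable_ltb => //.
Qed.

Definition win_int (g : R -> R) (x : R) := int01 (fun y => win x y * (g y)%:E).

Definition primitive (G g : R -> R) := [/\ (forall x, (0 <= G x)%R), (forall x, (0 <= g x)%R),
  measurable_fun [set: R] G, measurable_fun [set: R] g &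
  forall x, (G x)%:E = (G r)%:E + win_int g x].

Lemma measurable_win_fun x (g : R -> R) : measurable_fun [set: R] g ->
  measurable_fun [set: R] (fun y => win x y * (g y)%:E).
Proof.
move=> mg; apply: emeasurable_funM; last exact/measurable_EFinP.
by apply: measurable_win => //; exact: measurable_cst.
Qed.

Lemma win_fun_ge0 x (g : R -> R) : (forall y, (0 <= g y)%R) ->
  forall y, 0 <= win x y * (g y)%:E.
Proof. by move=> g0 y; rewrite mule_ge0 ?win_ge0// lee_fin. Qed.

Lemma win_int_ge0 (g : R -> R) x : (forall y, (0 <= g y)%R) -> 0 <= win_int g x.
Proof. by move=> g0; apply: int01_ge0; exact: win_fun_ge0. Qed.

Lemma measurable_win_int (g : R -> R) : (forall y, (0 <= g y)%R) -> measurable_fun [set: R] g ->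
  measurable_fun [set: R] (win_int g).
Proof.
move=> g0 mg; apply: (@measurable_int01 _ _ R (fun p => win p.1 p.2 * (g p.2)%:E)).
  by move=> p; exact: win_fun_ge0.
apply: emeasurable_funM; first exact: measurable_win.
by apply/measurable_EFinP; exact: (measurableT_comp mg).
Qed.

(** The square of side the window is cut along its diagonal, which is null;
    each of the two triangles gives one term, after exchanging the integrals in
    one of them. *)
Lemma win_int_mul (g h : R -> R) x :
  (forall y, (0 <= g y)%R) -> (forall y, (0 <= h y)%R) ->
  measurable_fun [set: R] g -> measurable_fun [set: R] h ->
  win_int g x * win_int h x =
  int01 (fun y => win x y * (g y)%:E * win_int h y) +
  int01 (fun y => win x y * (h y)%:E * win_int g y).
Proof.
move=> g0 h0 mg mh.
(* the part [y < z] of the square, as a function on the plane *)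
pose k y z := win x y * (g y)%:E * (b2e ((z < x)%R && (y < z)%R) * (h z)%:E).
have k0 y z : 0 <= k y z.
  by rewrite mule_ge0 ?win_fun_ge0// mule_ge0 ?b2e_ge0// lee_fin.
have mk : measurable_fun [set: R * R] (fun p => k p.1 p.2).
  apply: emeasurable_funM.
    exact: (measurableT_comp (measurable_win_fun x mg) measurable_fst).
  apply: emeasurable_funM.
    apply: measurable_b2e; apply: measurable_andb; apply: measurable_ltb => //;
      exact: measurable_cst.
  by apply/measurable_EFinP; exact: (measurableT_comp mh).
transitivity (int01 (fun y => win x y * (g y)%:E * win_int h y + int01 (k y))).
  rewrite muleC -int01Zl ?win_int_ge0//; last 2 first.
  - exact: win_fun_ge0.
  - exact: measurable_win_fun.
  apply: eq_int01 => y _; rewrite muleC.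
  have mk2 : measurable_fun [set: R] (fun z => b2e ((z < x)%R && (y < z)%R) * (h z)%:E).
    apply: emeasurable_funM; last exact/measurable_EFinP.
    apply: measurable_b2e; apply: measurable_andb; apply: measurable_ltb => //;
      exact: measurable_cst.
  have k20 z : 0 <= b2e ((z < x)%R && (y < z)%R) * (h z)%:E.
    by rewrite mule_ge0 ?b2e_ge0// lee_fin.
  rewrite int01Zl ?win_fun_ge0//.
  rewrite -ge0_muleDr ?win_int_ge0 ?int01_ge0//.
  have [/andP[yx ry]|xyr] := boolP ((y < x)%R && (r < y)%R); last first.
    by rewrite /win (negPf xyr) !mul0e.
  congr *%E; rewrite /win_int -int01D//; last 2 first.
  - exact: win_fun_ge0.
  - exact: measurable_win_fun.
  apply: (@eq_int01_but1 _ y); first exact: measurable_win_fun.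
    by apply: emeasurable_funD => //; exact: measurable_win_fun.
  move=> z zy; rewrite -ge0_muleDl ?win_ge0 ?b2e_ge0//; congr *%E.
  rewrite /win; have [zy'|yz] := ltP z y.
    by rewrite (lt_trans zy' yx) (lt_gtF zy') /b2e andbF mulr0n adde0.
  have yz' : (y < z)%R by rewrite lt_neqAle eq_sym zy.
  by rewrite yz' (lt_trans ry yz') !andbT /b2e add0e.
rewrite int01D//; last 4 first.
- by move=> y; rewrite mule_ge0 ?win_fun_ge0 ?win_int_ge0.
- by move=> y; exact: int01_ge0.
- by apply: emeasurable_funM; [exact: measurable_win_fun|exact: measurable_win_int].
- exact: (@measurable_int01 _ _ R (fun p => k p.1 p.2)).
congr (_ + _).
rewrite (@int01_swap _ (fun p => k p.1 p.2))//=.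
apply: eq_int01 => z _.
rewrite -int01Zl ?win_fun_ge0//; last 2 first.
- exact: win_fun_ge0.
- exact: measurable_win_fun.
apply: eq_int01 => y _; rewrite /k /win.
have [ry|_] := ltP r y; last by rewrite !andbF b2e0 !mul0e mule0.
have [yz|_] := ltP y z; last by rewrite !andbF b2e0 !mul0e !mule0.
have [zx|_] := ltP z x; last by rewrite b2e0 !mul0e mule0.
by rewrite (lt_trans yz zx) (lt_trans ry yz) b2e1 !mul1e muleC.
Qed.

Lemma primitive_cst (a : R) : (0 <= a)%R -> primitive (fun=> a) (fun=> 0%R).
Proof.
move=> a0; split => //; try exact: measurable_cst.
move=> x; rewrite /win_int (_ : (fun y => _) = fun=> 0 * 1).
  by rewrite int01Zl// ?mul0e ?adde0//; exact: measurable_cst.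
by apply/funext => y; rewrite mule0 mul0e.
Qed.

(** The Leibniz rule, or integration by parts: expand both factors as initial
    value plus integral and use [win_int_mul] for the product of the
    integrals. *)
Lemma primitive_mul (G g H h : R -> R) : primitive G g -> primitive H h ->
  primitive (fun x => G x * H x)%R (fun x => g x * H x + h x * G x)%R.
Proof.
move=> [G0 g0 mG mg EG] [H0 h0 mH mh EH].
have E x : (G x * H x)%:E = (G r * H r)%:E +
    win_int (fun x => g x * H x + h x * G x)%R x.
  have -> : win_int (fun x => g x * H x + h x * G x)%R x =
      (H r)%:E * win_int g x + int01 (fun y => win x y * (g y)%:E * win_int h y) +
      ((G r)%:E * win_int h x + int01 (fun y => win x y * (h y)%:E * win_int g y)).
    have aux (K k f : R -> R) : (forall x, (0 <= K x)%R) -> (forall x, (0 <= k x)%R) ->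
      (forall x, (0 <= f x)%R) ->
      measurable_fun [set: R] K -> measurable_fun [set: R] k -> measurable_fun [set: R] f ->
      (forall x, (K x)%:E = (K r)%:E + win_int k x) ->
      (K r)%:E * win_int f x + int01 (fun y => win x y * (f y)%:E * win_int k y) =
      int01 (fun y => win x y * (f y * K y)%:E).
      move=> K0 k0 f0 mK mk mf EK.
      rewrite -int01Zl ?lee_fin//; last 2 first.
      - exact: win_fun_ge0.
      - exact: measurable_win_fun.
      rewrite -int01D; last 4 first.
      - by move=> y; rewrite mule_ge0 ?win_fun_ge0// lee_fin.
      - by move=> y; rewrite mule_ge0 ?win_fun_ge0// win_int_ge0.
      - by apply: emeasurable_funM; [exact: measurable_cst|exact: measurable_win_fun].
      - by apply: emeasurable_funM; [exact: measurable_win_fun|exact: measurable_win_int].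
      apply: eq_int01 => y _; rewrite EFinM (EK y) [(K r)%:E * _]muleC -ge0_muleDr ?muleA//.
        by rewrite lee_fin.
      exact: win_int_ge0.
    rewrite (aux H h g)// (aux G g h)// -int01D; last 4 first.
    - by apply: win_fun_ge0 => y; rewrite mulr_ge0.
    - by apply: win_fun_ge0 => y; rewrite mulr_ge0.
    - by apply: measurable_win_fun; exact: measurable_funM.
    - by apply: measurable_win_fun; exact: measurable_funM.
    apply: eq_int01 => y _; rewrite EFinD ge0_muleDr// lee_fin mulr_ge0//.
  rewrite EFinM (EG x) (EH x).
  move: (win_int_mul x g0 h0 mg mh) (win_int_ge0 x g0) (win_int_ge0 x h0).
  move: (win_int g x) (win_int h x) (int01 _) (int01 _) => a b p q abpq a0 b0.
  have G0e : 0 <= (G r)%:E by rewrite lee_fin.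
  have H0e : 0 <= (H r)%:E by rewrite lee_fin.
  rewrite EFinM (ge0_muleDl _ G0e a0) (ge0_muleDr _ H0e b0) (ge0_muleDr _ H0e b0) abpq.
  by rewrite -!addeA [a * _]muleC; congr (_ + _); rewrite [LHS]addeCA; congr (_ + _); rewrite [LHS]addeCA.
split => //.
- by move=> x; rewrite mulr_ge0.
- by move=> x; rewrite addr_ge0// mulr_ge0.
- exact: measurable_funM.
- by apply: measurable_funD; exact: measurable_funM.
Qed.

End primitives.

Section stretch_heads.
Context {R : realType}.
Local Open Scope ereal_scope.

Lemma int01_tail (y : R) : (0 < y < 1)%R ->
  int01 (fun x => b2e (y <= x)%R) = (1 - y)%:E.
Proof.
move=> /andP[y0 y1]; rewrite /int01.
transitivity (\int[@lebesgue_measure R]_(x in `]0%R, 1%R[)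
    (\1_(`[y, +oo[%classic : set (measurableTypeR R)) x)%:E).
  apply: eq_integral => x _; rewrite indicE /b2e; congr ((nat_of_bool _)%:R)%:E.
  by apply/idP/idP; rewrite inE/= in_itv/= andbT.
rewrite integral_indic//= (_ : _ `&` _ = `[y, 1%R[%classic).
  by rewrite lebesgue_measure_itv/= lte_fin y1 EFinB.
apply/seteqP; split => x /=; rewrite !in_itv/= ?andbT.
  by move=> [-> /andP[_ ->]].
by move=> /andP[yx x1]; rewrite yx x1 (lt_le_trans y0 yx).
Qed.

Lemma int01n_all_ge (y : R) a : (0 < y < 1)%R ->
  int01n a (fun t => b2e (all (fun z => y <= z)%R t)) = ((1 - y) ^+ a)%:E.
Proof.
move=> y01; elim: a => [//|a IH] /=.
transitivity (int01 (fun x => ((1 - y) ^+ a)%:E * b2e (y <= x)%R)).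
  apply: eq_int01 => x _; rewrite -IH muleC -int01nZl ?b2e_ge0//.
  - by apply: eq_int01n => t _ _; rewrite b2eM.
  - by move=> s; exact: b2e_ge0.
  - by apply: measurable_b2e; exact: measurable_all_ge.
have [y0 y1] := andP y01.
rewrite int01Zl ?int01_tail//.
- by rewrite exprSr EFinM.
- by rewrite lee_fin exprn_ge0// subr_ge0 ltW.
- by move=> x; exact: b2e_ge0.
- by apply: measurable_b2e; apply: measurable_leb => //; exact: measurable_cst.
Qed.

Lemma nneseries_geometric (y : R) : (0 < y < 1)%R ->
  \sum_(a <oo) ((1 - y) ^+ a)%:E = (y^-1)%:E :> \bar R.
Proof.
move=> /andP[y0 y1]; apply/cvg_lim => //.
rewrite (_ : (fun n => _) = EFin \o series (geometric 1 (1 - y)%R)); last first.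
  apply/funext => n /=; rewrite /series/= -sumEFin.
  by apply: eq_bigr => i _; rewrite mul1r.
apply: cvg_EFin; first exact: nearW.
have := @cvg_geometric_series R 1 (1 - y)%R.
rewrite mul1r subKr; apply.
by rewrite ger0_norm ?subr_ge0 1?ltW// ltrBlDr ltrDl.
Qed.

Variables (C : finType) (c : finseq R -> C).
Hypothesis mc : forall i, measurable [set s | c s = i].

(** Without the colour constraint the completions of [y] are all sequences of
    terms at least [y], of volume [(1 - y) ^ a] in length [a], and the
    geometric series sums to [1 / y]. *)
Lemma sum_ctail_vol (y : R) : (0 < y < 1)%R -> \sum_i ctail_vol c i y = (y^-1)%:E.
Proof.
move=> y01; rewrite -nneseries_geometric// -nneseries_sum//; last first.
  by move=> i a _; apply: int01n_ge0 => s; exact: b2e_ge0.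
apply: eq_eseriesr => a _; rewrite -int01n_sum; last 2 first.
- by move=> i s; exact: b2e_ge0.
- move=> i; apply: measurable_b2e; apply: measurable_andb.
    exact: measurable_all_ge.
  rewrite (_ : mkset _ = [set s : finseq R | c (y :: s) = i]).
    exact: (measurable_fun_preimage (measurable_consr y) (mc i)).
  by apply/seteqP; split => s /= /eqP.
rewrite -int01n_all_ge//; apply: eq_int01n => t _ _.
under eq_bigr do rewrite b2eM.
rewrite -ge0_sume_distrr; last by move=> i _; exact: b2e_ge0.
rewrite (bigD1 (c (y :: t)))//= eqxx big1 ?adde0 ?mule1// => i ic.
by rewrite eq_sym (negPf ic).
Qed.

Variable r : R.
Hypothesis r0 : (0 < r)%R.

(** Finite above the level, being bounded by the inverse of the head; the
    truncation makes it bounded on the whole line. *)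
Definition ctail_volR i (y : R) : R := if (r < y < 1)%R then fine (ctail_vol c i y) else 0%R.

Lemma ctail_vol_le i (y : R) : (0 < y < 1)%R -> ctail_vol c i y <= (y^-1)%:E.
Proof.
move=> y01; rewrite -sum_ctail_vol// (bigD1 i)//= leeDl//.
by apply: sume_ge0 => j _; exact: ctail_vol_ge0.
Qed.

Lemma ctail_volRE i y : (r < y < 1)%R -> (ctail_volR i y)%:E = ctail_vol c i y.
Proof.
move=> ry; rewrite /ctail_volR ry fineK// ge0_fin_numE ?ctail_vol_ge0//.
apply: le_lt_trans (ctail_vol_le i _) _; rewrite ?ltry//.
by have [ry' ->] := andP ry; rewrite (lt_trans r0 ry').
Qed.

Lemma ctail_volR_ge0 i y : (0 <= ctail_volR i y)%R.
Proof. by rewrite /ctail_volR; case: ifP => // _; rewrite fine_ge0 ?ctail_vol_ge0. Qed.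

Lemma ctail_volR_le i y : (ctail_volR i y <= r^-1)%R.
Proof.
have [ry|ry] := boolP (r < y < 1)%R; last first.
  by rewrite /ctail_volR (negPf ry) invr_ge0 ltW.
have [ry' y1] := andP ry.
rewrite -lee_fin ctail_volRE//; apply: le_trans (ctail_vol_le i _) _.
  by rewrite y1 (lt_trans r0 ry').
by rewrite lee_fin lef_pV2 ?posrE ?(lt_trans r0 ry')// ltW.
Qed.

Lemma measurable_ctail_volR i : measurable_fun [set: R] (ctail_volR i).
Proof.
apply: measurable_fun_ifT; last exact: measurable_cst.
  apply: measurable_and; apply: measurable_fun_ltr => //; exact: measurable_cst.
by apply: measurableT_comp => //; exact: measurable_ctail_vol.
Qed.

(** The [mu]-mass of the stretches of colour [i] with head between [r] and [x];
    see [colour_mass1E]. *)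
Definition colour_mass i (x : R) : R := fine (win_int r (ctail_volR i) x).

Lemma colour_massE i x : (colour_mass i x)%:E = win_int r (ctail_volR i) x.
Proof.
rewrite /colour_mass fineK// ge0_fin_numE; last by apply: win_int_ge0; exact: ctail_volR_ge0.
apply: (@le_lt_trans _ _ (r^-1)%:E); last by rewrite ltry.
rewrite /win_int -[leRHS]mule1 -int01_cst1 -int01Zl//; last first.
  by rewrite lee_fin invr_ge0 ltW.
apply: ge0_le_integral => //.
- by move=> y _; rewrite mule_ge0 ?win_ge0// lee_fin ctail_volR_ge0.
- by apply: measurable_funTS; apply: measurable_win_fun; exact: measurable_ctail_volR.
- move=> y _; rewrite mule1 /win; case: (_ && _).
    by rewrite b2e1 mul1e lee_fin ctail_volR_le.
  by rewrite b2e0 mul0e lee_fin invr_ge0 ltW.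
Qed.

Lemma colour_mass_r i : colour_mass i r = 0%R.
Proof.
apply: EFin_inj; rewrite colour_massE /win_int.
rewrite (_ : (fun y => _) = fun=> 0 * 1).
  by rewrite int01Zl// ?mul0e//; exact: measurable_cst.
apply/funext => y; rewrite /win; have [yr|_] := ltP y r; last by rewrite b2e0 !mul0e.
by rewrite (lt_gtF yr) b2e0 !mul0e.
Qed.

Lemma primitive_colour_mass i : primitive r (colour_mass i) (ctail_volR i).
Proof.
split.
- by move=> x; rewrite -lee_fin colour_massE win_int_ge0//; exact: ctail_volR_ge0.
- exact: ctail_volR_ge0.
- apply: measurableT_comp => //; apply: measurable_win_int; first exact: ctail_volR_ge0.
  exact: measurable_ctail_volR.
- exact: measurable_ctail_volR.
- by move=> x; rewrite colour_mass_r add0e colour_massE.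
Qed.

End stretch_heads.

Section primitive_products.
Context {R : realType} (r : R).

Lemma primitive_scale (a : R) (G g : R -> R) : 0 <= a -> primitive r G g ->
  primitive r (fun x => a * G x) (fun x => a * g x).
Proof.
move=> a0 Gg; have := primitive_mul (primitive_cst r a0) Gg.
by under [X in primitive _ _ X -> _]funext do rewrite mul0r add0r mulrC.
Qed.

(** Divided powers, so that differentiation lowers the exponent without a
    factor; the exponent 0 has derivative 0. *)
Lemma primitive_pow (m h : R -> R) k : primitive r m h ->
  primitive r (fun x => m x ^+ k / k`!%:R)
    (fun x => if k is k'.+1 then h x * (m x ^+ k' / k'`!%:R) else 0).
Proof.
move=> mh; elim: k => [|k IH].
  under [X in primitive _ X _]funext do rewrite expr0 fact0 divr1.
  exact: primitive_cst.
have k0 : 0 <= k.+1%:R^-1 :> R by rewrite invr_ge0.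
have := primitive_scale k0 (primitive_mul IH mh).
set G := (X in primitive _ X _); set g := (X in primitive _ _ X).
suff [-> ->] : G = (fun x => m x ^+ k.+1 / k.+1`!%:R) /\
    g = (fun x => h x * (m x ^+ k / k`!%:R)) by [].
split; apply/funext => x.
  by rewrite /G factS natrM invfM exprSr; ring.
rewrite /g; case: k {IH k0 G g} => [|k]; first by rewrite mul0r add0r invr1 mul1r.
have kf : k`!%:R != 0 :> R by rewrite pnatr_eq0 -lt0n fact_gt0.
have k1 : k%:R + 1 != 0 :> R by rewrite natr1 pnatr_eq0.
have k2 : k%:R + 2 != 0 :> R by rewrite -natrD pnatr_eq0 addn2.
rewrite exprSr factS natrM -[k.+2]addn2 -[k.+1]addn1 !natrD; field.
by rewrite kf k1 k2.
Qed.

Lemma primitive_prod (I : eqType) (s : seq I) (G g : I -> R -> R) : uniq s ->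
  (forall i, primitive r (G i) (g i)) ->
  primitive r (fun x => \prod_(i <- s) G i x)
         (fun x => \sum_(i <- s) g i x * \prod_(j <- rem i s) G j x).
Proof.
move=> us Gg; elim: s us => [_|a s IH /= /andP[as_ us]].
  under [X in primitive _ X _]funext do rewrite big_nil.
  under [X in primitive _ _ X]funext do rewrite big_nil.
  exact: primitive_cst.
have := primitive_mul (Gg a) (IH us).
set G' := (X in primitive _ X _ -> _); set g' := (X in primitive _ _ X -> _).
set G'' := (X in _ -> primitive _ X _); set g'' := (X in _ -> primitive _ _ X).
suff [-> ->] : G' = G'' /\ g' = g'' by [].
split; apply/funext => x; first by rewrite /G'' big_cons.
rewrite /g'' big_cons eqxx; congr (_ + _).
rewrite mulr_suml; apply: eq_big_seq => i si.
have ia : a != i by apply: contraNneq as_ => ->.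
by rewrite (negPf ia) big_cons mulrA mulrAC.
Qed.

End primitive_products.

Section solution.
Context {R : realType} (C : finType) (c : finseq R -> C) (r : R).
Hypothesis mc : forall i, measurable [set s | c s = i].
Hypothesis r0 : 0 < r.
Implicit Types n : {ffun C -> nat}.

(** Up to exponential factors, the probability that independent Poisson
    variables with means [colour_mass i x] take the values [n i]. *)
Definition mass_product n (x : R) : R := \prod_i (colour_mass c r i x ^+ n i / (n i)`!%:R).

Lemma primitive_mass_product n : primitive r (mass_product n)
  (fun x => \sum_(i | (0 < n i)%N) ctail_volR c r i x * mass_product (decr n i) x).
Proof.
have := @primitive_prod R r C (index_enum C) _ _ (index_enum_uniq C)
  (fun i => primitive_pow (n i) (primitive_colour_mass mc r0 i)).
set g' := (X in primitive _ _ X -> _); set g'' := (X in _ -> primitive _ _ X).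
suff -> : g' = g'' by [].
apply/funext => x; rewrite /g' /g'' [RHS]big_mkcond; apply: eq_bigr => i _.
rewrite /mass_product [in RHS](bigD1 i)//= ffunE eqxx.
case: (n i) => [|k]; first by rewrite mul0r.
rewrite subSS subn0 -!mulrA; congr *%R; rewrite !mulrA; congr *%R.
rewrite rem_filter ?index_enum_uniq// big_filter; apply: eq_bigr => j ji.
by rewrite ffunE (negPf ji) subn0.
Qed.

Lemma mass_product_r n : mass_product n r = [forall i, n i == 0%N]%:R.
Proof.
rewrite /mass_product; case: (boolP [forall i, n i == 0%N]) => [/forallP H|].
  by rewrite big1// => i _; rewrite (eqP (H i)) expr0 fact0 divr1.
rewrite negb_forall => /existsP[i ni].
by rewrite (bigD1 i)//= (colour_mass_r mc r0) expr0n (negPf ni) !mul0r.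
Qed.

(** Both sides solve the recursion of [volume_rec], by induction on the total
    number of blocks: differentiating the product of divided powers removes one
    block of one colour, with factor the derivative of its mass. *)
Lemma volumeE n x : volume c r n x = (mass_product n x)%:E.
Proof.
have [N] := ubnP (\sum_i n i)%N; elim: N n x => // N IH n x nN.
have [P0 h0 mP mh ->] := primitive_mass_product n.
rewrite volume_rec// mass_product_r; congr (_ + _)%E.
rewrite /win_int; transitivity (int01 (fun y => \sum_(i | (0 < n i)%N)
    win r x y * (ctail_volR c r i y * mass_product (decr n i) y)%:E))%E; last first.
  apply: eq_int01 => y _; rewrite -sumEFin ge0_sume_distrr// => i _.
  by rewrite lee_fin mulr_ge0 ?ctail_volR_ge0//; have [] := primitive_mass_product (decr n i).
rewrite -big_filter.
under [in RHS]eq_fun do rewrite -big_filter.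
rewrite int01_sum; last 2 first.
- move=> i y.
  apply: (@win_fun_ge0 _ r x (fun y => ctail_volR c r i y * mass_product (decr n i) y)) => {}y.
  by rewrite mulr_ge0 ?ctail_volR_ge0//; have [] := primitive_mass_product (decr n i).
- move=> i.
  apply: (@measurable_win_fun _ r x (fun y => ctail_volR c r i y * mass_product (decr n i) y)).
  apply: measurable_funM.
    exact: measurable_ctail_volR.
  by have [] := primitive_mass_product (decr n i).
rewrite !big_filter; apply: eq_bigr => i ni; apply: eq_int01 => y y01.
rewrite -/(win r x y); have [/andP[yx ry]|] := boolP ((y < x) && (r < y)); last first.
  by rewrite /win => /negPf ->; rewrite b2e0 !mul0e.
rewrite EFinM ctail_volRE//; last by rewrite ry; have [_ ->] := andP y01.
rewrite IH//.
rewrite -ltnS; apply: leq_trans nN; rewrite ltnS.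
rewrite (bigD1 i)//= [in ltnRHS](bigD1 i)//= ffunE eqxx.
rewrite (eq_bigr n); last by move=> j ji; rewrite ffunE (negPf ji) subn0.
by rewrite -addSn leq_add2r; case: (n i) ni => // k _; rewrite subn1.
Qed.

End solution.

(** * The mean measure as an integral over the head of a stretch *)

Section calculus.
Context {R : realType}.
Local Open Scope ereal_scope.

(** Regularity is asked only on positive numbers, because the functions of
    interest, inverse and real powers, are singular at 0. *)
Lemma int01_FTC (f F : R -> R) (r : R) : (0 < r < 1)%R ->
  (forall x : R, (0 < x)%R -> is_derive x 1%R F (f x)) ->
  (forall x : R, (0 < x)%R -> {for x, continuous f}) ->
  int01 (fun y => b2e (r < y)%R * (f y)%:E) = (F 1%R - F r)%:E.
Proof.
move=> /andP[r0 r1] dF cf.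
have cfr : {within `[r, 1%R], continuous f}.
  apply: continuous_in_subspaceT => x; rewrite inE/= in_itv/= => /andP[rx _].
  by apply: cf; exact: lt_le_trans rx.
have cF (x : R) : (0 < x)%R -> {for x, continuous F}.
  move=> x0; apply: differentiable_continuous; apply/derivable1_diffP.
  by have [] := dF x x0.
rewrite EFinB -(@continuous_FTC2 _ f F r 1%R)//; last 2 first.
- split.
  + move=> x; rewrite in_itv/= => /andP[rx _].
    by have [] := dF x (lt_trans r0 rx).
  + by apply: cvg_at_right_filter; exact: cF.
  + by apply: cvg_at_left_filter; exact: cF.
- move=> x; rewrite in_itv/= => /andP[rx _].
  by rewrite derive1E; have [_ ->] := dF x (lt_trans r0 rx).
rewrite integral_itv_bndoo//; last first.
  apply/measurable_EFinP; apply: (measurable_funS (measurable_itv `[r, 1%R])).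
    exact: subset_itv_oo_cc.
  exact: subspace_continuous_measurable_fun.
rewrite /int01 integral_mkcond [RHS]integral_mkcond; apply: eq_integral => x _.
rewrite !patchE; case: ifPn; case: ifPn; rewrite ?inE ?notin_setE/= !in_itv/=.
- by move=> /andP[-> _] _; rewrite /b2e mul1e.
- move=> H /andP[_ x1]; have [rx|] := ltP r x; last by rewrite /b2e mul0e.
  by exfalso; apply: H; rewrite rx.
- by move=> /andP[rx x1] H; exfalso; apply: H; rewrite x1 (lt_trans r0 rx).
- by [].
Qed.

Lemma int01_inv (r : R) : (0 < r < 1)%R ->
  int01 (fun y => b2e (r < y)%R * (y^-1)%:E) = (- ln r)%:E.
Proof.
move=> r01; rewrite (@int01_FTC (fun y => y^-1)%R (@ln R))//.
- by rewrite ln1 sub0r.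
- by move=> x x0; apply: inv_continuous; rewrite gt_eqF.
Qed.

Lemma int01_powR_tail (theta r : R) : (0 < r < 1)%R ->
  int01 (fun y => b2e (r < y)%R * (theta * y `^ (theta - 1))%:E) =
  (1 - r `^ theta)%:E.
Proof.
move=> r01; rewrite (@int01_FTC (fun y => theta * y `^ (theta - 1))%R (fun y => y `^ theta)%R)//.
- by rewrite powR1.
- move=> x x0.
  have c : {for x, continuous (fun y : R => y `^ (theta - 1))%R}.
    apply: differentiable_continuous; apply/derivable1_diffP.
    by have [] := is_derive1_powR (theta - 1) x0.
  by apply: cvgM; [exact: cvg_cst|exact: c].
Qed.

Lemma int01_onemXn n : int01 (fun y : R => ((1 - y) ^+ n)%:E) = (n.+1%:R^-1)%:E.
Proof.
rewrite -(@beta_fun1Sn R n) EFin_beta_fun/= /int01.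
rewrite -(@integral_itv_bndoo R 0%R 1%R _ true false); last first.
  apply/measurable_EFinP; apply: measurable_funTS.
  by apply: measurable_funX; exact: measurable_funB.
rewrite [LHS]integral_mkcond; apply: eq_integral => x _.
by rewrite !patchE; case: ifP => // _; rewrite XMonemX0n.
Qed.

End calculus.

Section stretch_mean_integral.
Context {R : realType}.
Local Open Scope ereal_scope.

(** The volume of the completions of [y] to a block in [B]: the density at [y]
    of the head of a stretch in [B] under [mu]. *)
Definition tail_vol (B : set (finseq R)) (y : R) : \bar R :=
  \sum_(a <oo) int01n a (fun t => b2e (all (fun z => y <= z)%R t && ((y :: t : finseq R) \in B))).

Lemma measurable_int01n_tail (B : set (finseq R)) a : measurable B ->
  measurable_fun [set: R] (fun y => int01n a (fun t =>
    b2e (all (fun z => y <= z)%R t && ((y :: t : finseq R) \in B)))).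
Proof.
move=> mB; apply: (eq_measurable_fun (fun y : R => int01n a (fun t =>
    b2e (all (fun z => y <= z)%R t && (((y :: t : finseq R) \in B) == true))))).
  by move=> y _; apply: eq_int01n => t _ _; rewrite eqb_id.
apply: (@measurable_int01n_ctail R bool (fun s => s \in B)) => -[].
  rewrite (_ : mkset _ = B)//; apply/seteqP.
  by split => s; [exact: set_mem|exact: mem_set].
rewrite (_ : mkset _ = ~` B); first exact: measurableC.
apply/seteqP; split => s /=; first by move=> /negbT; rewrite notin_setE.
by move=> sB; apply/negbTE; rewrite notin_setE.
Qed.

Lemma measurable_tail_vol (B : set (finseq R)) : measurable B -> measurable_fun [set: R] (tail_vol B).
Proof.
move=> mB; apply: (eq_measurable_fun (fun y : R => \sum_(a <oo | a \in predT)
  int01n a (fun t => b2e (all (fun z => y <= z)%R t && ((y :: t : finseq R) \in B))))).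
  by move=> x _; apply: eq_eseriesl.
apply: ge0_emeasurable_sum => [a y _ _|a _].
  by apply: int01n_ge0 => s; exact: b2e_ge0.
exact: measurable_int01n_tail.
Qed.

Lemma tail_vol_ge0 (B : set (finseq R)) y : 0 <= tail_vol B y.
Proof. by apply: nneseries_ge0 => a _ _; apply: int01n_ge0 => s; exact: b2e_ge0. Qed.

(** Ties with [y] are null. The strict inequality is that of the conditioning
    event in [P_l], the large one is that of non-records. *)
Lemma int01n_all_gt (y : R) a (f : finseq R -> \bar R) :
  (forall s, 0 <= f s) -> measurable_fun [set: finseq R] f ->
  int01n a (fun t => b2e (all (fun z => y <= z)%R t) * f t) =
  int01n a (fun t => b2e (all (fun z => y < z)%R t) * f t).
Proof.
elim: a f => [//|a IH] f f0 mf /=.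
have mle : measurable_fun [set: finseq R] (fun t => b2e (all (fun z => y <= z)%R t) * f t).
  by apply: emeasurable_funM => //; apply: measurable_b2e; exact: measurable_all_ge.
have mlt : measurable_fun [set: finseq R] (fun t => b2e (all (fun z => y < z)%R t) * f t).
  by apply: emeasurable_funM => //; apply: measurable_b2e; exact: measurable_all_gt.
apply: (@eq_int01_but1 _ y).
- by apply: (measurable_int01n_cons _ _ mle) => s; rewrite mule_ge0 ?b2e_ge0.
- by apply: (measurable_int01n_cons _ _ mlt) => s; rewrite mule_ge0 ?b2e_ge0.
move=> z zy.
pose g s := b2e (y <= z)%R * f (z :: s).
have := IH g; rewrite /g => IHg.
transitivity (int01n a (fun t => b2e (all (fun z => y <= z)%R t) * g t)).
  by apply: eq_int01n => t _ _; rewrite /g b2eM muleA [X in X * _]muleC -muleA.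
rewrite IHg; last 2 first.
- by move=> s; rewrite mule_ge0 ?b2e_ge0.
- apply: emeasurable_funM; first exact: measurable_cst.
  exact: (measurableT_comp mf (measurable_consr z)).
apply: eq_int01n => t _ _.
by rewrite [(y < z)%R]lt_neqAle [y == z]eq_sym zy/= b2eM muleCA muleA.
Qed.

Lemma measurable_inB (B : set (finseq R)) (y : R) : measurable B ->
  measurable [set t : finseq R | (y :: t : finseq R) \in B].
Proof.
move=> mB; rewrite (_ : mkset _ = [set t : finseq R | B (y :: t)]).
  exact: (measurable_fun_preimage (measurable_consr y) mB).
by apply/seteqP; split => t /=; rewrite inE.
Qed.

Lemma mem_lowest_first l (w : l.+1.-tuple R) :
  (w \in @lowest_first R l.+1) = all (fun z => head 0 (tval w) < z)%R (behead (tval w)).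
Proof.
case/tupleP: w => y t; apply/idP/(all_nthP 0%R) => /=.
  rewrite inE => H i; rewrite size_tuple => il.
  by have := H i.+1; rewrite /= ltnS il; apply.
move=> H; rewrite inE => -[//|i] /=; rewrite ltnS => il.
by apply: H; rewrite size_tuple.
Qed.

Lemma int01n_lowest_first (B : set (finseq R)) a : measurable B ->
  iid_uniform a.+1 ([set w : a.+1.-tuple R | B (tval w)] `&` @lowest_first R a.+1) =
  int01n a.+1 (fun s => b2e (all (fun z => head 0 s <= z)%R (behead s) && ((s : finseq R) \in B))).
Proof.
move=> mB.
(* the event [lowest_first] for sequences of any length *)
pose LF := [set s : finseq R | (0 < size s)%N && all (fun z => head 0 s < z)%R (behead s)].
have mLF : measurable LF.
  rewrite (_ : LF = [set s : finseq R | (~~ (size s == 0%N)) &&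
     ((size (drop 1 s) == 0%N) || (nth 0 s 0 < seq_min (drop 1 s))%R)]).
    apply: measurable_andb; first exact: measurable_nnil.
    apply: measurable_orb.
      exact: (measurable_fun_preimage (measurable_dropf 1) measurable_nil).
    apply: measurable_ltb; first exact: measurable_nth.
    exact: (measurableT_comp measurable_seq_min (measurable_dropf 1)).
  by apply/seteqP; split => -[|y [|z t]] //=; rewrite ?drop0 lt_seq_min.
transitivity (iid_uniform a.+1 [set w : a.+1.-tuple R | (B `&` LF) (tval w)]).
  congr (iid_uniform a.+1 _); apply/seteqP; split => w /= [Bw].
    rewrite /LF/= size_tuple/= => lw; split => //.
    by rewrite -mem_lowest_first inE.
  rewrite /LF/= size_tuple/= => lw; split => //.
  by move: lw; rewrite -mem_lowest_first inE.
rewrite iid_uniformE; last exact: measurableI.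
rewrite /=; apply: eq_int01 => y _.
transitivity (int01n a (fun t => b2e (all (fun z => y < z)%R t) * b2e ((y :: t : finseq R) \in B))).
  apply: eq_int01n => t _ _; rewrite -b2eM indicE /b2e; congr ((nat_of_bool _)%:R)%:E.
  by apply/idP/andP; rewrite !inE /LF/= => -[].
rewrite -int01n_all_gt; last 2 first.
- by move=> s; exact: b2e_ge0.
- by apply: measurable_b2e; exact: measurable_inB.
by apply: eq_int01n => t _ _; rewrite b2eM.
Qed.

Lemma measurable_lowest_first a : measurable (@lowest_first R a.+1).
Proof.
rewrite (_ : @lowest_first R a.+1 = [set w : a.+1.-tuple R |
    ((size (drop 1 (tval w)) == 0%N) || (nth 0 (tval w) 0 < seq_min (drop 1 (tval w)))%R)]).
  have mT := @measurable_tval R a.+1.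
  have mdT : measurable_fun [set: a.+1.-tuple R] (fun w => drop 1 (tval w) : finseq R).
    exact: (measurableT_comp (measurable_dropf 1) mT).
  apply: measurable_orb; first exact: (measurable_fun_preimage mdT measurable_nil).
  apply: measurable_ltb; first exact: (measurableT_comp (measurable_nth 0) mT).
  exact: (measurableT_comp measurable_seq_min mdT).
have E (w : a.+1.-tuple R) : (w \in @lowest_first R a.+1) =
    ((size (drop 1 (tval w)) == 0%N) || (nth 0 (tval w) 0 < seq_min (drop 1 (tval w)))%R).
  rewrite mem_lowest_first; case: (tval w) => [|y [|z t]]//=.
  by rewrite lt_seq_min.
by apply/seteqP; split => w; rewrite /mkset -E inE.
Qed.

(** Each of the [a.+1] variables is equally likely to be the smallest; computed
    here as the integral of [(1 - y) ^ a]. *)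
Lemma iid_lowest_first a : iid_uniform a.+1 (@lowest_first R a.+1) = (a.+1%:R^-1)%:E.
Proof.
have := @int01n_lowest_first setT a measurableT.
rewrite (_ : [set w : _.-tuple R | _] = setT) ?setTI// => ->.
rewrite -int01_onemXn /=; apply: eq_int01 => y y01.
rewrite -int01n_all_ge//; apply: eq_int01n => t _ _.
by rewrite in_setT andbT.
Qed.

(** The weight [1 / l] in [mu] is exactly the probability of the event by which
    [P_l] is conditioned, so that the two cancel and leave plain Lebesgue
    measure on that event. *)
Lemma stretch_law_div (B : set (finseq R)) a : measurable B ->
  stretch_law [set w : a.+1.-tuple R | B (tval w)] * (a.+1%:R^-1)%:E =
  int01n a.+1 (fun s => b2e (all (fun z => head 0 s <= z)%R (behead s) && ((s : finseq R) \in B))).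
Proof.
move=> mB; rewrite /stretch_law /conditional_probability iid_lowest_first/=.
rewrite -EFinM divfK ?invr_eq0 ?pnatr_eq0//.
rewrite int01n_lowest_first// fineK// ge0_fin_numE; last first.
  by apply: int01n_ge0 => s; exact: b2e_ge0.
apply: (@le_lt_trans _ _ (iid_uniform a.+1 (@lowest_first R a.+1))); last first.
  by rewrite iid_lowest_first ltry.
rewrite -int01n_lowest_first//; apply: le_measure; rewrite ?inE.
- by apply: measurableI; [exact: mB|exact: measurable_lowest_first].
- exact: measurable_lowest_first.
- exact: subIsetr.
Qed.

Lemma stretch_meanE (B : set (finseq R)) : measurable B ->
  stretch_mean B = int01 (tail_vol B).
Proof.
move=> mB; rewrite /stretch_mean.
rewrite -(@nneseries_addn R (fun l => stretch_law [set w : l.-tuple R | B (tval w)] * (l%:R^-1)%:E)); last first.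
  move=> [|l].
    by rewrite mule_ge0// lee_fin// mulr_ge0// ?invr_ge0 fine_ge0.
  by rewrite stretch_law_div//; apply: int01n_ge0 => s; exact: b2e_ge0.
rewrite /tail_vol int01_series; last 2 first.
- by move=> a y; apply: int01n_ge0 => s; exact: b2e_ge0.
- by move=> a; exact: measurable_int01n_tail.
by apply: eq_eseriesr => a _; rewrite addn1 stretch_law_div.
Qed.

End stretch_mean_integral.

(** * Stretches above a level *)

Section high_stretches.
Context {R : realType} (r : R).
Local Open Scope ereal_scope.

(** The stretches that begin above the level [r]; the empty sequence is the
    junk value of missing stretches and is left out. *)
Definition high : set (finseq R) := [set s | ~~ (size s == 0%N) && (r < nth 0 s 0)%R].

Lemma measurable_high : measurable high.
Proof.
apply: measurable_andb; first exact: measurable_nnil.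
by apply: measurable_ltb; [exact: measurable_cst|exact: measurable_nth].
Qed.

Lemma tail_vol_high (B : set (finseq R)) y : measurable B ->
  tail_vol (B `&` high) y = b2e (r < y)%R * tail_vol B y.
Proof.
move=> mB; rewrite /tail_vol -nneseriesMl ?b2e_ge0//; last first.
  by move=> a; apply: int01n_ge0 => s; exact: b2e_ge0.
apply: eq_eseriesr => a _; rewrite -int01nZl ?b2e_ge0//; last 2 first.
- by move=> s; exact: b2e_ge0.
- apply: measurable_b2e; apply: measurable_andb; first exact: measurable_all_ge.
  exact: measurable_inB.
apply: eq_int01n => t _ _; rewrite -b2eM in_setI.
rewrite (_ : (_ \in high) = (r < y)%R).
  by congr b2e; rewrite andbA andbC.
by apply/idP/idP; rewrite inE.
Qed.

End high_stretches.

Section level.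
Context {R : realType} (theta : R).
Hypothesis theta_gt0 : (0 < theta)%R.
Variable P : probability (seqspace R) R.
Hypothesis HP : is_Ptheta theta P.
Variable r : R.
Hypothesis r01 : (0 < r < 1)%R.
Variables (C : finType) (c : finseq R -> C).
Hypothesis mc : forall i, measurable [set s | c s = i].
Local Open Scope ereal_scope.
Implicit Types n : {ffun C -> nat}.

Let r0 : (0 < r)%R. Proof. by case/andP: r01. Qed.

Lemma ctail_volE i y : ctail_vol c i y = tail_vol [set s | c s = i] y.
Proof.
apply: eq_eseriesr => a _; apply: eq_int01n => t _ _; congr (b2e (_ && _)).
by apply/eqP/idP; rewrite inE.
Qed.

(** Integrating the completion volume over heads between [r] and 1 gives the
    [mu]-mass of the stretches above the level. *)
Lemma colour_mass1E i : (colour_mass c r i 1)%:E = stretch_mean ([set s | c s = i] `&` high r).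
Proof.
rewrite (colour_massE mc r0) stretch_meanE; last by apply: measurableI => //; exact: measurable_high.
apply: eq_int01 => y /andP[y0 y1]; rewrite tail_vol_high// -ctail_volE /win y1/=.
have [ry|_] := ltP r y; last by rewrite b2e0 !mul0e.
by rewrite (ctail_volRE mc r0)// ry.
Qed.

(** The integral of [1 / y] from [r] to 1: the total mass of the stretches
    above the level, finite because of the level. *)
Lemma sum_colour_mass1 : (\sum_i colour_mass c r i 1 = - ln r)%R.
Proof.
apply: EFin_inj; rewrite -sumEFin -int01_inv//.
under eq_bigr do rewrite (colour_massE mc r0).
rewrite -int01_sum; last 2 first.
- by move=> i y; apply: win_fun_ge0; exact: ctail_volR_ge0.
- by move=> i; apply: measurable_win_fun; exact: measurable_ctail_volR.
apply: eq_int01 => y /andP[y0 y1]; rewrite /win y1/=.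
have [ry|_] := ltP r y; last first.
  by rewrite b2e0 mul0e big1// => i _; rewrite mul0e.
under eq_bigr do rewrite b2e1 mul1e (ctail_volRE mc r0) ?ry//.
by rewrite b2e1 mul1e (sum_ctail_vol mc)// y0.
Qed.

(** The Beta density of the first term has total mass 1 because it is the
    density of a probability law; this spares an improper integral at 0. *)
Lemma int01_powR : int01 (fun y => (theta * y `^ (theta - 1))%:E) = 1.
Proof.
have [mb Hb] := Ptheta_init HP.
transitivity (pushforward P (fun u : seqspace R => u 0%N) setT); last first.
  by rewrite /pushforward preimage_setT probability_setT.
rewrite Hb// /int01 integral_mkcond [RHS]integral_mkcond.
apply: eq_integral => y _; rewrite !patchE in_setT /beta1_density.
case: ifPn; rewrite ?inE ?notin_setE/= in_itv/=; first by move=> ->.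
by move=> /negP/negbTE ->.
Qed.

Let pow_ge0 (y : R) : 0 <= (theta * y `^ (theta - 1))%:E.
Proof. by rewrite lee_fin mulr_ge0 ?powR_ge0// ltW. Qed.

Let measurable_pow : measurable_fun [set: R] (fun y : R => (theta * y `^ (theta - 1))%:E).
Proof.
apply/measurable_EFinP; apply: measurable_funM; first exact: measurable_cst.
exact: measurable_powR.
Qed.

Lemma int01_powR_head :
  int01 (fun y => b2e (y <= r)%R * (theta * y `^ (theta - 1))%:E) = (r `^ theta)%:E.
Proof.
have := int01_powR.
rewrite (_ : (fun y => (theta * y `^ (theta - 1))%:E) =
  fun y => b2e (y <= r)%R * (theta * y `^ (theta - 1))%:E +
           b2e (r < y)%R * (theta * y `^ (theta - 1))%:E); last first.
  apply/funext => y; case: leP => _; rewrite b2e0 b2e1 mul1e mul0e ?adde0 ?add0e//.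
have mle : measurable_fun [set: R] (fun y : R => b2e (y <= r)%R : \bar R).
  by apply: measurable_b2e; apply: measurable_leb => //; exact: measurable_cst.
have mlt : measurable_fun [set: R] (fun y : R => b2e (r < y)%R : \bar R).
  by apply: measurable_b2e; apply: measurable_ltb => //; exact: measurable_cst.
rewrite int01D; last 4 first.
- by move=> y; rewrite mule_ge0 ?b2e_ge0.
- by move=> y; rewrite mule_ge0 ?b2e_ge0.
- exact: emeasurable_funM.
- exact: emeasurable_funM.
rewrite int01_powR_tail//; case: (int01 _) => [x||]//.
by rewrite -EFinD => -[x1]; congr EFin; lra.
Qed.

(** The first passage at or below [r] is at time [L], and the blocks before it
    have colour counts [n]. Only the first [L.+1] terms matter. *)
Definition level_event n L : set (finseq R) := [set s : finseq R |
  [&& all (fun y => r < y)%R (take L s), has_counts c n (take L s) & (nth 0 s L <= r)%R]].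

Lemma measurable_level_event n L : measurable (level_event n L).
Proof.
apply: measurable_andb.
  exact: (measurable_fun_preimage (measurable_takef L) (measurable_all_gt r)).
apply: measurable_andb.
  exact: (measurable_fun_preimage (measurable_takef L) (measurable_has_counts mc n)).
by apply: measurable_leb; [exact: measurable_nth|exact: measurable_cst].
Qed.

Lemma has_counts_nb_recs n s : has_counts c n s -> nb_recs s = (\sum_i n i)%N.
Proof.
move=> /forallP H; rewrite -size_blocks.
under eq_bigr do rewrite -(eqP (H _)).
elim: (blocks s) => [|b bs IH] /=; first by rewrite big1.
rewrite big_split/= -IH (bigD1 (c b))//= eqxx big1 ?addn0// => i ic.
by rewrite eq_sym (negPf ic).
Qed.

(** All terms before [L] exceed [r] and the next one, [y], does not, so that it
    is a record and the minimum: the density is [theta ^ (k + 1) * y ^ (theta -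
    1)] with [k] the number of blocks, and depends on the first [L] terms
    through [k] alone. Integrating [y] up to [r] gives [r ^ theta]. *)
Lemma level_event_prob n L : P [set u | level_event n L (mkseq u L.+1)] =
  (theta ^+ (\sum_i n i)%N * r `^ theta)%:E * int01n L (admissible_ind c r n 1).
Proof.
rewrite (prefix_prob theta_gt0 HP)//; last exact: measurable_level_event.
rewrite int01n_rcons -int01nZl; last 3 first.
- by rewrite lee_fin mulr_ge0 ?powR_ge0// exprn_ge0// ltW.
- by move=> s; exact: b2e_ge0.
- exact: measurable_admissible_ind.
apply: eq_int01n => s sL s01.
(* the bound 1 on the first term is vacuous in the open cube *)
have s1 : starts_below 1 s.
  by case: s s01 {sL} => // y s /(_ y); rewrite mem_head => /(_ isT) /andP[].
have [/andP[rs gs]|ngs] := boolP (all (fun y => r < y)%R s && has_counts c n s); last first.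
  rewrite /admissible_ind /admissible s1/= (negPf ngs) b2e0 mule0.
  rewrite (_ : (fun x => _) = fun=> 0 * 1).
    by rewrite int01Zl ?mul0e//; exact: measurable_cst.
  apply/funext => y; rewrite mul0e indicE memNset ?mul0e// /level_event /=.
  by rewrite -cats1 take_size_cat// => /and3P[rs gs _]; rewrite rs gs in ngs.
rewrite /admissible_ind /admissible s1 rs gs b2e1 mule1.
rewrite EFinM -int01_powR_head -int01Zl; last 3 first.
- by rewrite lee_fin exprn_ge0// ltW.
- by move=> y; rewrite mule_ge0 ?b2e_ge0.
- apply: emeasurable_funM => //; apply: measurable_b2e.
  by apply: measurable_leb => //; exact: measurable_cst.
apply: eq_int01 => y /andP[y0 y1].
have -> : (\1_(level_event n L) (rcons s y))%:E = b2e (y <= r)%R :> \bar R.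
  rewrite indicE /b2e; congr ((nat_of_bool _)%:R)%:E; apply/idP/idP.
    by rewrite inE /level_event /= nth_rcons sL ltnn eqxx => /and3P[].
  move=> yr; rewrite inE /level_event /= nth_rcons sL ltnn eqxx yr.
  by rewrite -cats1 take_size_cat// rs gs.
have [yr|] := leP y r; last by rewrite b2e0 !mul0e mule0.
rewrite b2e1 !mul1e -EFinM -(has_counts_nb_recs gs); congr EFin.
rewrite /dens; have [->|snil] := eqVneq s [::].
  by rewrite nb_recs1 seq_min1 expr1 /nb_recs /= nb_records0 expr0 mul1r.
have ym : (y < seq_min s)%R.
  rewrite lt_seq_min//; apply: sub_all rs => z; exact: le_lt_trans.
by rewrite nb_recs_rcons// seq_min_rcons// ym addn1 min_r ?ltW// exprSr mulrA.
Qed.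

Definition level_set n : set (seqspace R) :=
  \bigcup_L [set u | level_event n L (mkseq u L.+1)].

Lemma measurable_level_set n : measurable (level_set n).
Proof.
apply: bigcupT_measurable => L.
exact: (measurable_fun_preimage (@measurable_mkseq R L.+1) (measurable_level_event n L)).
Qed.

Lemma level_eventP n L (u : nat -> R) : level_event n L (mkseq u L.+1) <->
  [/\ forall i, (i < L)%N -> (r < u i)%R, has_counts c n (mkseq u L) & (u L <= r)%R].
Proof.
have tE : take L (mkseq u L.+1) = mkseq u L.
  by rewrite mkseqS -cats1 take_size_cat// size_mkseq.
rewrite /level_event /= tE nth_mkseq//; split.
  move=> /and3P[/allP H -> ->]; split => // i iL; apply: H.
  by apply/mapP; exists i => //; rewrite mem_iota.
move=> [H -> ->]; rewrite !andbT; apply/allP => x /mapP[i].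
by rewrite mem_iota/= add0n => iL ->; exact: H.
Qed.

Lemma first_passage_uniq (u : nat -> R) L L' :
  (forall i, (i < L)%N -> (r < u i)%R) -> (u L <= r)%R ->
  (forall i, (i < L')%N -> (r < u i)%R) -> (u L' <= r)%R -> L = L'.
Proof.
move=> H uL H' uL'; case: (ltngtP L L') => //.
  by move=> /H'; rewrite ltNge uL.
by move=> /H; rewrite ltNge uL'.
Qed.

(** Summing [level_event_prob] over [L] brings in the volume with bound 1 on
    the first term, no constraint at all, hence the product of divided powers
    by [volumeE]. The factor [r ^ theta] is the product of the missing
    exponentials, because the masses of all colours add up to [- ln r]. *)
Lemma level_set_prob n :
  P (level_set n) = (\prod_i poisson_mass (theta * colour_mass c r i 1) (n i))%:E.
Proof.
rewrite /level_set measure_bigcup//; last 2 first.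
- move=> L _.
  exact: (measurable_fun_preimage (@measurable_mkseq R L.+1) (measurable_level_event n L)).
- apply/trivIsetP => L L' _ _ LL'; apply/seteqP; split => // u [].
  move=> /level_eventP[H _ uL] /level_eventP[H' _ uL'].
  by move/eqP: LL'; apply; exact: (@first_passage_uniq u).
transitivity (\sum_(L <oo) P [set u | level_event n L (mkseq u L.+1)]).
  by apply: eq_eseriesl => L; rewrite in_setT.
rewrite (eq_eseriesr (fun L _ => level_event_prob n L)).
rewrite nneseriesZl; last by move=> L _; apply: int01n_ge0 => s; exact: b2e_ge0.
rewrite -/(volume c r n 1) (volumeE mc r0) -EFinM; congr EFin.
have -> : (r `^ theta = \prod_i expR (- (theta * colour_mass c r i 1)))%R.
  rewrite -expR_sum sumrN -mulr_sumr sum_colour_mass1 mulrN opprK /powR.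
  by rewrite gt_eqF.
rewrite expr_sum -!big_split; apply: eq_bigr => i _ /=.
rewrite /poisson_mass exprMn; ring.
Qed.

End level.

Lemma poisson_mass_ge0 {R : realType} (l : R) k : 0 <= l -> 0 <= poisson_mass l k.
Proof. by move=> l0; rewrite /poisson_mass !mulr_ge0 ?expR_ge0 ?exprn_ge0 ?invr_ge0. Qed.

Lemma poisson_mass_sum {R : realType} (l : R) : 0 <= l ->
  (\sum_(k <oo) (poisson_mass l k)%:E = 1)%E.
Proof.
move=> l0; rewrite (eq_eseriesr (g := fun k => ((expR (- l))%:E * (l ^+ k / k`!%:R)%:E)%E)); last first.
  by move=> k _; rewrite -EFinM /poisson_mass mulrA.
rewrite nneseriesZl; last by move=> k _; rewrite lee_fin divr_ge0// exprn_ge0.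
rewrite (_ : (\sum_(k <oo) _)%E = (expR l)%:E); last first.
  rewrite expRE -EFin_lim; last first.
    rewrite /pseries/=; under eq_fun do rewrite mulrC.
    exact: is_cvg_series_exp_coeff.
  apply/congr_lim/funext => n/=; rewrite /pseries/= /series/= -sumEFin.
  by apply: eq_bigr => k _; rewrite mulrC.
by rewrite -EFinM expRN mulVf// gt_eqF// expR_gt0.
Qed.

Lemma big_option (I : finType) (T : Type) (idx : T) (op : Monoid.com_law idx)
    (F : option I -> T) :
  \big[op/idx]_i F i = op (F None) (\big[op/idx]_i F (Some i)).
Proof.
rewrite (bigD1 None)//=; congr (op _ _).
rewrite (reindex_omap Some id); last by case.
by apply: eq_bigl => i; rewrite eqxx.
Qed.

Section colouring.
Context {R : realType} (m : nat) (B : 'I_m -> set (finseq R)).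
Hypotheses (mB : forall i, measurable (B i)) (tB : trivIset setT B).

(** A family of disjoint sets as a colouring, with [None] for the sequences in
    none of them, so that every stretch has a colour. *)
Definition colour (s : finseq R) : option 'I_m := [pick i | s \in B i].

Lemma colour_Some s i : (colour s == Some i) = (s \in B i).
Proof.
rewrite /colour; case: pickP => [j sj|H]; last by rewrite H.
apply/eqP/idP => [[<-]//|si]; congr Some.
apply: contrapT => ji; move/trivIsetP : tB => /(_ j i I I).
move/eqP in ji => /(_ ji); rewrite -subset0 => /(_ s); apply.
by split; exact: set_mem.
Qed.

Lemma colour_None s : (colour s == None) = ~~ (s \in \bigcup_i B i).
Proof.
rewrite /colour; case: pickP => [j sj|H] /=.
  apply/esym/negbTE; rewrite negbK inE; exists j => //; exact: set_mem.
apply/esym; apply/negP; rewrite inE => -[i _ /mem_set]; by rewrite H.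
Qed.

Lemma measurable_colour o : measurable [set s | colour s = o].
Proof.
case: o => [i|].
  rewrite (_ : mkset _ = B i)//; apply/seteqP; split => s /=.
    by move=> /eqP; rewrite colour_Some => /set_mem.
  by move=> /mem_set; rewrite -colour_Some => /eqP.
rewrite (_ : mkset _ = ~` \bigcup_i B i).
  by apply: measurableC; apply: fin_bigcup_measurable => //; exact: finite_finset.
apply/seteqP; split => s /=.
  by move=> /eqP; rewrite colour_None => /negP H sB; apply: H; rewrite inE.
by move=> H; apply/eqP; rewrite colour_None; apply/negP; rewrite inE.
Qed.

End colouring.

Section point_counts.
Context {R : realType}.
Implicit Types u : nat -> R.
Local Open Scope ereal_scope.

Definition stretches (k : nat) (u : seqspace R) : finseq R := stretch u k.

Lemma record_first_passage (r : R) u L :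
  (forall i, (i < L)%N -> (r < u i)%R) -> (u L <= r)%R -> lower_record u L.
Proof.
by move=> H uL; apply/lower_recordP => j jL; apply: le_lt_trans uL _; exact: H.
Qed.

Lemma stretch_exists u k i j : lower_record u i -> nb_records u i = k ->
  lower_record u j -> nb_records u j = k.+1 ->
  (0 < size (stretch u k))%N /\ nth 0%R (stretch u k) 0 = u i.
Proof.
move=> ui ik uj jk.
have ij : (i < j)%N.
  rewrite ltnNge; apply/negP => /(nb_records_homo u); rewrite ik jk ltnn//.
rewrite nth_stretch size_map size_iota (record_indexP ui ik) (record_indexP uj jk).
by rewrite subn_gt0 ij addn0.
Qed.

(** Up to the first passage [L] at or below [r] the stretches are the blocks
    and begin above [r]; the later ones begin at or below [r], and missing ones
    are empty. *)
Lemma point_count_level (r : R) u L (A : set (finseq R)) :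
  (forall i, (i < L)%N -> (r < u i)%R) -> (u L <= r)%R ->
  point_count R stretches (A `&` high r) u =
  (count (fun b : finseq R => b \in A) (blocks (mkseq u L)))%:R%:E.
Proof.
move=> H uL; have recL := record_first_passage H uL.
rewrite /point_count /stretches (nneseries_split 0 (nb_records u L))//.
rewrite [X in _ + X]eseries0 ?adde0; last first.
  move=> k; rewrite add0n => Lk _; rewrite diracE memNset// => -[_].
  rewrite /high /= => /andP[s0 /lt_geF/negP]; apply.
  have [[i ui ik]|ne] := pselect (exists2 i, lower_record u i & nb_records u i = k).
    have Li : (L <= i)%N.
      by rewrite leqNgt; apply/negP => /(nb_records_lt ui); rewrite ik ltnNge Lk.
    rewrite nth_stretch (record_indexP ui ik) addn0; case: ifP => [_|Hs].
      move: Li; rewrite leq_eqVlt => /predU1P[<-//|Li].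
      by apply: le_trans uL; apply: ltW; exact: (lower_recordP _ _ ui).
    by move: s0; rewrite size_map size_iota (record_indexP ui ik) -leqn0 leqNgt Hs.
  exfalso; move: s0; rewrite size_map size_iota.
  rewrite (@record_index_default _ _ k.+1) ?sub0n ?eqxx// => i ui ik.
  have [j [_ uj jk]] : exists j, [/\ (j < i)%N, lower_record u j & nb_records u j = k].
    by apply: record_exists; rewrite ik.
  by apply: ne; exists j.
rewrite blocks_mkseq// add0n big_mkord.
have -> : count (fun b : finseq R => b \in A)
    [seq stretch u k | k <- iota 0 (nb_records u L)] =
    (\sum_(k < nb_records u L) ((stretch u k : finseq R) \in A))%N.
  rewrite -sum1_count big_map big_mkcond -[X in iota _ X]subn0.
  by rewrite -/(index_iota 0 _) big_mkord; apply: eq_bigr => k _; case: ifP.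
rewrite natr_sum -sumEFin; apply: eq_bigr => k _; rewrite diracE in_setI.
have [i [iL ui ik]] := record_exists (ltn_ord k).
have [j uj jk] : exists2 j, lower_record u j & nb_records u j = k.+1.
  have [kL|kL] := ltnP k.+1 (nb_records u L).
    by have [j [_ ? ?]] := record_exists kL; exists j.
  by exists L => //; apply/eqP; rewrite eqn_leq kL ltn_ord.
have [s0 sE] := stretch_exists ui ik uj jk.
rewrite (_ : (_ \in high r) = true) ?andbT; last first.
  by apply: mem_set; rewrite /high /= -lt0n s0 sE H.
by [].
Qed.

End point_counts.

Section level_counts.
Context {R : realType} (theta : R).
Hypothesis theta_gt0 : (0 < theta)%R.
Variable P : probability (seqspace R) R.
Hypothesis HP : is_Ptheta theta P.
Local Open Scope ereal_scope.

Lemma first_passage (r : R) (u : nat -> R) : (exists L, u L <= r)%R ->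
  exists L, (forall i, (i < L)%N -> (r < u i)%R) /\ (u L <= r)%R.
Proof.
move=> H; have [L uL Lmin] := ex_minnP H.
exists L; split => // i iL; rewrite ltNge; apply/negP => /Lmin.
by rewrite leqNgt iL.
Qed.

Section family.
Variables (m : nat) (B : 'I_m -> set (finseq R)).
Hypotheses (mB : forall i, measurable (B i)) (tB : trivIset setT B).
Implicit Types n : 'I_m -> nat.

Definition ext_count n k : {ffun option 'I_m -> nat} :=
  [ffun o => if o is Some i then n i else k].

Definition level_counts r n : set (seqspace R) :=
  [set u | (exists L, u L <= r)%R /\
    forall i, point_count R stretches (B i `&` high r) u = (n i)%:R%:E].

Lemma level_countsE r n : level_counts r n =
  \bigcup_k level_set r (colour B) (ext_count n k).
Proof.
have cE i L (u : nat -> R) : count (fun b : finseq R => b \in B i) (blocks (mkseq u L)) =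
    count (fun b => colour B b == Some i) (blocks (mkseq u L)).
  by apply: eq_count => b /=; rewrite (colour_Some tB).
apply/seteqP; split => u.
  move=> [/first_passage[L [H uL]] Hn].
  exists (count (fun b => colour B b == None) (blocks (mkseq u L))) => //.
  exists L => //; apply/level_eventP; split => //; apply/forallP => -[i|]; rewrite ffunE//.
  have := Hn i; rewrite (point_count_level _ H uL) => -[/eqP]; rewrite eqr_nat.
  by rewrite cE.
move=> [k _ [L _ /level_eventP[H gu uL]]]; split; first by exists L.
move=> i; rewrite (point_count_level _ H uL) cE.
by have /forallP/(_ (Some i))/eqP -> := gu; rewrite ffunE.
Qed.

Lemma measurable_level_counts r n : measurable (level_counts r n).
Proof.
rewrite level_countsE; apply: bigcupT_measurable => k; apply: measurable_level_set.
exact: measurable_colour.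
Qed.

(** The uncoloured stretches above the level are counted too in [level_set];
    summing over their number [k] makes the corresponding Poisson factor
    disappear. *)
Lemma level_counts_prob r n : (0 < r < 1)%R ->
  P (level_counts r n) =
  (\prod_i poisson_mass (fine (theta%:E * stretch_mean (B i `&` high r))) (n i))%:E.
Proof.
move=> r01; have r0 : (0 < r)%R by case/andP: r01.
have mc := measurable_colour mB tB.
rewrite level_countsE measure_bigcup//; last 2 first.
- by move=> k _; apply: measurable_level_set.
- apply/trivIsetP => k k' _ _ kk'; apply/seteqP; split => // u [].
  move=> [L _ /level_eventP[H gu uL]] [L' _ /level_eventP[H' gu' uL']].
  have LL' := first_passage_uniq H uL H' uL'; rewrite {}LL' in gu *.
  move/eqP: kk'; apply.
  move/forallP/(_ None): gu => /eqP; move/forallP/(_ None): gu' => /eqP.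
  by rewrite !ffunE => -> ->.
transitivity (\sum_(k <oo) P (level_set r (colour B) (ext_count n k))).
  by apply: eq_eseriesl => k; rewrite in_setT.
set Q := (\prod_i _)%R.
rewrite (eq_eseriesr (g := fun k => Q%:E *
    (poisson_mass (theta * colour_mass (colour B) r None 1) k)%:E)); last first.
  move=> k _; rewrite (level_set_prob theta_gt0 HP r01 mc) big_option ffunE.
  rewrite /= -EFinM [in RHS](mulrC Q); congr ((_ * _)%R)%:E; apply: eq_bigr => i _; rewrite ffunE.
  congr poisson_mass.
  have -> : B i = [set s | colour B s = Some i].
    apply/seteqP; split => s /=.
      by move=> /mem_set; rewrite -(colour_Some tB) => /eqP.
    by move=> /eqP; rewrite (colour_Some tB) => /set_mem.
  by rewrite -(colour_mass1E r01 mc) -EFinM.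
have m0 i : (0 <= theta * colour_mass (colour B) r i 1)%R.
  by apply: mulr_ge0; [exact: ltW|have [H _ _ _ _] := primitive_colour_mass mc r0 i; exact: H].
rewrite nneseriesZl; last by move=> k _; rewrite lee_fin poisson_mass_ge0.
by rewrite poisson_mass_sum// mule1.
Qed.

End family.

(** The case of an empty family in [level_counts_prob]: an empty product equals
    1. *)
Lemma hit_prob (r : R) : (0 < r < 1)%R -> P [set u | exists L, u L <= r]%R = 1.
Proof.
move=> r01.
pose B (i : 'I_0) : set (finseq R) := set0.
have mB i : measurable (B i) by case: i.
have tB : trivIset setT B by case.
have := @level_counts_prob 0 B mB tB r (fun=> 0%N) r01.
rewrite big_ord0 => <-; congr (P _); apply/seteqP; split => u; last by case.
by move=> H; split => // -[].
Qed.

Lemma coord_gt0_prob i : P [set u | 0 < u i]%R = 1.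
Proof.
have mS : measurable [set s : finseq R | (0 < nth 0 s i)%R].
  by apply: measurable_ltb; [exact: measurable_cst|exact: measurable_nth].
transitivity (P [set u | [set s : finseq R | (0 < nth 0 s i)%R] (mkseq u i.+1)]).
  by congr (P _); apply/seteqP; split => u /=; rewrite nth_mkseq.
rewrite (prefix_prob theta_gt0 HP)//.
transitivity (P [set u | setT (mkseq u i.+1 : finseq R)]); last exact: probability_setT.
rewrite (prefix_prob theta_gt0 HP)//.
apply: eq_int01n => s si s01; rewrite !indicE in_setT mem_set//=.
by have := s01 (nth 0%R s i); rewrite mem_nth ?si// => /(_ isT) /andP[].
Qed.

Definition level (j : nat) : R := j.+2%:R^-1.

Lemma level01 j : (0 < level j < 1)%R.
Proof. by rewrite /level invr_gt0 ltr0n/= invf_lt1 ?ltr0n// ltr1n. Qed.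

(** The almost sure event on which the sequence goes to the bottom without
    reaching it: there are then infinitely many records, and every stretch is
    eventually above the level. *)
Definition descending : set (seqspace R) :=
  [set u | (forall j, exists L, u L <= level j)%R /\ forall i, (0 < u i)%R].

Lemma measurable_hit r : measurable [set u : seqspace R | exists L, u L <= r]%R.
Proof.
rewrite (_ : mkset _ = \bigcup_L [set u : seqspace R | u L <= r]%R).
  apply: bigcupT_measurable => L; apply: measurable_leb; last exact: measurable_cst.
  exact: measurable_coord.
by apply/seteqP; split => [u [L uL]|u [L _ uL]]; exists L.
Qed.

Lemma descendingE : descending =
  (\bigcap_j [set u : seqspace R | exists L, u L <= level j]%R) `&`
  (\bigcap_i [set u : seqspace R | 0 < u i]%R).
Proof.
apply/seteqP; split => [u [H1 H2]|u [H1 H2]].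
  by split => [j _|i _]; [exact: H1|exact: H2].
by split => [j|i]; [exact: H1|exact: H2].
Qed.

Lemma measurable_descending : measurable descending.
Proof.
rewrite descendingE; apply: measurableI; apply: bigcapT_measurable => j.
  exact: measurable_hit.
by apply: measurable_ltb; [exact: measurable_cst|exact: measurable_coord].
Qed.

Lemma prob_bigcap1 d (T : measurableType d) (Q : probability T R) (F : nat -> set T) :
  (forall j, measurable (F j)) -> (forall j, Q (F j) = 1) -> Q (\bigcap_j F j) = 1.
Proof.
move=> mF QF.
have mc : measurable (\bigcap_j F j) by exact: bigcapT_measurable.
have : Q (~` \bigcap_j F j) = 0.
  rewrite setC_bigcap; apply/eqP; rewrite -measure_le0.
  apply: (@le_trans _ _ (\sum_(j <oo) Q (~` F j))).
    apply: measure_sigma_subadditive => //.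
    + by move=> j; exact: measurableC.
    + by apply: bigcupT_measurable => j; exact: measurableC.
  by rewrite eseries0// => j _ _; rewrite probability_setC// QF subee.
rewrite probability_setC//; have := fin_num_measure Q _ mc.
case: (Q _) => [x _||//]; last by [].
by rewrite -EFinB => -[x0]; congr EFin; lra.
Qed.

Lemma probI1 d (T : measurableType d) (Q : probability T R) (A B : set T) :
  measurable A -> measurable B -> Q A = 1 -> Q B = 1 -> Q (A `&` B) = 1.
Proof.
move=> mA mB QA QB.
pose F (j : nat) := if j is 0%N then A else B.
rewrite (_ : A `&` B = \bigcap_j F j).
  by apply: prob_bigcap1 => -[].
apply/seteqP; split => [t [At Bt] [|j] _//|t H]; split; first exact: (H 0%N I).
exact: (H 1%N I).
Qed.

Lemma descending_prob : P descending = 1.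
Proof.
rewrite descendingE; apply: probI1.
- by apply: bigcapT_measurable => j; exact: measurable_hit.
- apply: bigcapT_measurable => i.
  by apply: measurable_ltb; [exact: measurable_cst|exact: measurable_coord].
- by apply: prob_bigcap1 => j; [exact: measurable_hit|apply: hit_prob; exact: level01].
- apply: prob_bigcap1 => i; last exact: coord_gt0_prob.
  by apply: measurable_ltb; [exact: measurable_cst|exact: measurable_coord].
Qed.

End level_counts.

(** * Letting the level vanish *)

Section vanishing_level.
Context {R : realType}.
Implicit Types u : nat -> R.

Lemma level_small (x : R) : 0 < x -> exists j0, forall j, (j0 <= j)%N -> (level j : R) < x.
Proof.
move=> x0; have [k] := @ltr_add_invr R 0 x x0; rewrite add0r => kx.
exists k => j kj; apply: le_lt_trans kx; rewrite /level lef_pV2 ?posrE ?ltr0n//.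
by rewrite ler_nat ltnS; exact: leqW.
Qed.

Lemma levels_below u L : (forall i, 0 < u i) ->
  exists j0, forall j i, (j0 <= j)%N -> (i < L)%N -> (level j : R) < u i.
Proof.
move=> u0; elim: L => [|L [j1 H1]]; first by exists 0%N.
have [j2 H2] := level_small (u0 L); exists (maxn j1 j2) => j i.
rewrite geq_max => /andP[j1j j2j]; rewrite ltnS leq_eqVlt => /predU1P[->|iL]; first exact: H2.
exact: H1.
Qed.

Lemma nb_records_unbounded u k : descending u -> exists L, (k < nb_records u L)%N.
Proof.
move=> [hit u0]; elim: k => [|k [L kL]].
  by exists 1%N; rewrite nb_recordsS nb_records0 lower_record0.
have [j0 H] := levels_below L u0.
have [L' [H' uL']] := first_passage (hit j0).
have LL' : (L <= L')%N.
  by rewrite leqNgt; apply/negP => L'L; have := H j0 L' (leqnn _) L'L; rewrite ltNge uL'.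
exists L'.+1; rewrite nb_recordsS (record_first_passage H' uL') addn1 ltnS.
exact: leq_trans kL (nb_records_homo _ LL').
Qed.

Lemma stretch_high u k : descending u ->
  exists j0, forall j, (j0 <= j)%N -> (stretch u k : finseq R) \in high (level j : R).
Proof.
move=> du; have [L kL] := nb_records_unbounded k.+1 du.
have [i [_ ui ik]] := record_exists (ltnW kL).
have [i' [_ ui' ik']] := record_exists kL.
have [s0 sE] := stretch_exists ui ik ui' ik'.
have [_ u0] := du.
have [j0 H] := level_small (u0 i); exists j0 => j /H ji.
by rewrite inE /high /= -lt0n s0 sE.
Qed.

End vanishing_level.

Section bool_series.
Context {R : realType}.
Local Open Scope ereal_scope.

Lemma nneseries_le (f : nat -> \bar R) (x : \bar R) : (forall k, 0 <= f k) ->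
  (forall K, \sum_(k < K) f k <= x) -> \sum_(k <oo) f k <= x.
Proof.
move=> f0 H; apply: lime_le; first by apply: is_cvg_nneseries.
by apply: nearW => K; rewrite big_mkord.
Qed.

Lemma nneseries_ge (f : nat -> \bar R) K : (forall k, 0 <= f k) ->
  \sum_(k < K) f k <= \sum_(k <oo) f k.
Proof. by move=> f0; rewrite -(big_mkord xpredT); apply: nneseries_lim_ge. Qed.

Lemma sum_bool (a : nat -> bool) K :
  \sum_(k < K) (a k)%:R%:E = ((\sum_(k < K) a k)%N)%:R%:E :> \bar R.
Proof. by rewrite sumEFin natr_sum. Qed.

(** Applied to the event that the stretch [k] lies in a set and to the event [h
    j k] that it is above the level [j]. If the count is [n], or exceeds [n],
    finitely many points show it and they are above all small levels; if it is
    less than [n], no level count reaches [n]. *)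
Lemma bool_series_eventually (a : nat -> bool) (h : nat -> nat -> bool) n :
  (forall k, exists j0, forall j, (j0 <= j)%N -> h j k) ->
  exists j0, forall j, (j0 <= j)%N ->
    (\sum_(k <oo) (a k && h j k)%:R%:E = n%:R%:E :> \bar R) <->
    (\sum_(k <oo) (a k)%:R%:E = n%:R%:E :> \bar R).
Proof.
move=> hP.
have b0 (b : bool) : 0 <= b%:R%:E :> \bar R by rewrite lee_fin.
have hK K : exists j0, forall j k, (j0 <= j)%N -> (k < K)%N -> h j k.
  elim: K => [|K [j1 H1]]; first by exists 0%N.
  have [j2 H2] := hP K; exists (maxn j1 j2) => j k.
  rewrite geq_max => /andP[j1j j2j]; rewrite ltnS leq_eqVlt => /predU1P[->|kK]; first exact: H2.
  exact: H1.
pose S K := (\sum_(k < K) a k)%N.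
have partial K j0 : (forall j k, (j0 <= j)%N -> (k < K)%N -> h j k) ->
    forall j, (j0 <= j)%N -> (S K)%:R%:E <= \sum_(k <oo) (a k && h j k)%:R%:E :> \bar R.
  move=> H j j0j; apply: le_trans (nneseries_ge K _); last by move=> k.
  rewrite -sum_bool; apply: lee_sum => k _; rewrite H//= andbT//.
have le_all j : \sum_(k <oo) (a k && h j k)%:R%:E <= \sum_(k <oo) (a k)%:R%:E :> \bar R.
  by apply: lee_nneseries => k *//; rewrite lee_fin ler_nat; case: (a k) (h j k) => -[].
have SE K : (S K)%:R%:E <= \sum_(k <oo) (a k)%:R%:E :> \bar R.
  by rewrite -sum_bool; exact: nneseries_ge.
have [[K nK]|small] := pselect (exists K, (n < S K)%N).
  have [j0 H] := hK K; exists j0 => j j0j; split => E; exfalso.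
    have := partial K j0 H j j0j; rewrite E lee_fin ler_nat leqNgt nK//.
  by have := SE K; rewrite E lee_fin ler_nat leqNgt nK.
have Sn K : (S K <= n)%N.
  by rewrite leqNgt; apply/negP => nK; apply: small; exists K.
have sum_le (p : nat) : (forall K, (S K <= p)%N) -> \sum_(k <oo) (a k)%:R%:E <= p%:R%:E :> \bar R.
  by move=> H; apply: nneseries_le => // K; rewrite sum_bool lee_fin ler_nat; exact: H.
have [[K Kn]|ne] := pselect (exists K, S K = n).
  have [j0 H] := hK K; exists j0 => j j0j.
  have E : \sum_(k <oo) (a k)%:R%:E = n%:R%:E :> \bar R.
    by apply/eqP; rewrite eq_le sum_le//= -Kn SE.
  split => // _; apply/eqP; rewrite eq_le -{1}E le_all/= -Kn; exact: partial j0j.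
exists 0%N => j _.
have n0 : (0 < n)%N by rewrite lt0n; apply/eqP => n0; apply: ne; exists 0%N; rewrite /S big_ord0.
have lt : \sum_(k <oo) (a k)%:R%:E < n%:R%:E :> \bar R.
  apply: (@le_lt_trans _ _ (n.-1%:R%:E)); last by rewrite lte_fin ltr_nat prednK.
  apply: sum_le => K; rewrite -ltnS prednK// ltn_neqAle Sn andbT.
  by apply/eqP => SKn; apply: ne; exists K.
split => E; exfalso; last by rewrite E ltxx in lt.
by have := le_lt_trans (le_all j) lt; rewrite E ltxx.
Qed.

End bool_series.

Section limits.
Context {R : realType}.
Local Open Scope ereal_scope.

Lemma cvg_eventually (u : nat -> \bar R) l :
  (exists j0, forall j, (j0 <= j)%N -> u j = l) -> u @ \oo --> l.
Proof.
move=> [j0 H]; apply: cvg_near_cst; exists j0 => // j /= j0j; exact: H.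
Qed.

Lemma prob_cvg_eventually d (T : measurableType d) (Q : probability T R)
    (F : nat -> set T) (G N : set T) :
  (forall j, measurable (F j)) -> measurable G -> measurable N -> Q N = 1 ->
  (forall t, N t -> exists j0, forall j, (j0 <= j)%N -> F j t <-> G t) ->
  (fun j => Q (F j)) @ \oo --> Q G.
Proof.
move=> mF mG mN QN H.
have [] := @dominated_convergence _ _ _ Q setT measurableT
  (fun j t => (\1_(F j) t)%:E) (fun t => (\1_G t)%:E) (cst 1).
- by move=> j; exact/measurable_EFinP/measurable_indic.
- exact/measurable_EFinP/measurable_indic.
- exists (~` N); split; first exact: measurableC.
    by rewrite [LHS]probability_setC// QN subee.
  move=> t /= nH; apply: contra_not nH => Nt _; apply: cvg_eventually.
  have [j0 Hj] := H t Nt; exists j0 => j /Hj FG; rewrite !indicE.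
  by congr ((nat_of_bool _)%:R)%:E; apply/idP/idP; rewrite !inE => /FG.
- exact: finite_measure_integrable_cst.
- apply: aeW => t j _; rewrite /= lee_fin indicE.
  by case: (_ \in _); rewrite ?normr1 ?normr0.
move=> _ _; rewrite /= integral_indic// setIT.
by under eq_fun do rewrite integral_indic// setIT.
Qed.

Lemma stretch_mean_high_cvg (B : set (finseq R)) : measurable B ->
  (fun j => stretch_mean (B `&` high (level j))) @ \oo --> stretch_mean B.
Proof.
move=> mB.
have mhigh j : measurable (B `&` high (level j : R)).
  by apply: measurableI => //; exact: measurable_high.
under eq_fun do rewrite stretch_meanE//.
rewrite stretch_meanE//.
have -> : int01 (tail_vol B) = int01 (fun y => limn (fun j => tail_vol (B `&` high (level j)) y)).
  apply: eq_int01 => y /andP[y0 y1]; apply/esym/cvg_lim => //; apply: cvg_eventually.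
  have [j0 H] := level_small y0; exists j0 => j /H jy.
  by rewrite tail_vol_high// jy b2e1 mul1e.
apply: cvg_monotone_convergence => //.
- by move=> j; apply: measurable_funTS; exact: measurable_tail_vol.
- by move=> j y _; exact: tail_vol_ge0.
- move=> y _ j j' jj'; rewrite !tail_vol_high//; apply: lee_wpmul2r; first exact: tail_vol_ge0.
  rewrite lee_fin ler_nat; have [jy|//] := ltP (level j) y.
  rewrite (le_lt_trans _ jy)// /level lef_pV2 ?posrE ?ltr0n// ler_nat.
  by rewrite !ltnS.
Qed.

(** The Poisson law with a possibly infinite mean, which charges no finite
    count. *)
Definition count_mass (l : \bar R) (n : nat) : R :=
  if l == +oo then 0%R else poisson_mass (fine l) n.

Lemma poisson_mass_cvgy (l : nat -> R) n : (forall j, 0 <= l j)%R ->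
  l @ \oo --> +oo%R -> (fun j => poisson_mass (l j) n) @ \oo --> (0 : R)%R.
Proof.
move=> l0 ly.
have bound (x : R) : (0 < x)%R -> (poisson_mass x n <= n.+1%:R / x)%R.
  move=> x0; rewrite /poisson_mass expRN.
  have e0 := expR_gt0 x.
  (* one more power of [x] than in the numerator of the Poisson mass, so that
     the quotient is of order [1 / x] *)
  have : (x ^+ n.+1 / n.+1`!%:R <= expR x)%R.
    by apply: le_trans (expR_ge1Dxn n (ltW x0)); rewrite lerDr.
  rewrite factS natrM exprS => H.
  have fn : (0 < n`!%:R :> R)%R by rewrite ltr0n fact_gt0.
  have n1 : (0 < n.+1%:R :> R)%R by rewrite ltr0n.
  have {}H : (x * (x ^+ n / n`!%:R) <= n.+1%:R * expR x)%R.
    rewrite -ler_pdivrMl//; apply: le_trans H.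
    by rewrite invfM le_eqVlt; apply/orP; left; apply/eqP; ring.
  rewrite ler_pdivlMr// (_ : (_ * x = x * (x ^+ n / n`!%:R) / expR x)%R); last by ring.
  by rewrite ler_pdivrMr.
apply/cvgrPdist_lt => e e0; near=> j.
have lj : (n.+1%:R / e < l j)%R by near: j; move/cvgryPgt : ly; apply.
have lj0 : (0 < l j)%R by apply: le_lt_trans lj; rewrite divr_ge0// ltW.
rewrite sub0r normrN ger0_norm ?poisson_mass_ge0//.
apply: le_lt_trans (bound _ lj0) _.
by rewrite ltr_pdivrMr// mulrC -ltr_pdivrMr.
Unshelve. all: by end_near. Qed.

Lemma count_mass_cvg (l : nat -> \bar R) (L : \bar R) n :
  (forall j, 0 <= l j) -> (forall j, l j < +oo) -> l @ \oo --> L ->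
  (fun j => poisson_mass (fine (l j)) n) @ \oo --> count_mass L n.
Proof.
move=> l0 ly lL.
have lf j : l j \is a fin_num by rewrite ge0_fin_numE.
rewrite /count_mass; case: eqVneq => [Ly|Ly].
  apply: poisson_mass_cvgy; first by move=> j; exact: fine_ge0.
  apply/cvgeryP; rewrite -Ly.
  by under eq_fun do rewrite fineK//.
have Lf : L \is a fin_num.
  rewrite ge0_fin_numE ?lt_neqAle ?Ly ?leey//.
  have <- := cvg_lim _ lL; last exact: ereal_hausdorff.
  by apply: lime_ge; [apply/cvg_ex; exists L|exact: nearW].
have fl : (fun j => fine (l j)) @ \oo --> fine L by apply: fine_cvg; rewrite fineK.
rewrite /poisson_mass; apply: cvgM; last exact: cvg_cst.
apply: cvgM; last exact: (cvg_comp (fun j => fine (l j)) _ fl (@exprn_continuous R n _)).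
exact: (cvg_comp (fun j => - fine (l j))%R _ (cvgN fl) (@continuous_expR R _)).
Qed.

End limits.

Section counts.
Context {R : realType} (theta : R).
Hypothesis theta_gt0 : (0 < theta)%R.
Variable P : probability (seqspace R) R.
Hypothesis HP : is_Ptheta theta P.
Local Open Scope ereal_scope.

(** A count is a natural number or infinite; a bounded count equals one of its
    partial sums. *)
Lemma bool_series_value (a : nat -> bool) :
  \sum_(k <oo) (a k)%:R%:E = +oo :> \bar R \/
  exists n : nat, \sum_(k <oo) (a k)%:R%:E = n%:R%:E :> \bar R.
Proof.
have b0 k : 0 <= (a k)%:R%:E :> \bar R by rewrite lee_fin.
pose S K := (\sum_(k < K) a k)%N.
have SE K : (S K)%:R%:E <= \sum_(k <oo) (a k)%:R%:E :> \bar R.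
  by rewrite -sum_bool; exact: nneseries_ge.
have sum_le (p : nat) : (forall K, (S K <= p)%N) -> \sum_(k <oo) (a k)%:R%:E <= p%:R%:E :> \bar R.
  by move=> H; apply: nneseries_le => // K; rewrite sum_bool lee_fin ler_nat; exact: H.
have [bd|unb] := pselect (exists p, forall K, (S K <= p)%N); [right|left].
  have exb : exists p, `[< forall K, (S K <= p)%N >] by have [p Hp] := bd; exists p; apply/asboolP.
  have [p /asboolP Hp pmin] := ex_minnP exb; exists p.
  apply/eqP; rewrite eq_le sum_le//=.
  have [K SK] : exists K, S K = p.
    apply: contrapT => ne; have [p0|p0] := posnP p.
      by apply: ne; exists 0%N; rewrite /S big_ord0 p0.
    have : `[< forall K, (S K <= p.-1)%N >].
      apply/asboolP => K; rewrite -ltnS prednK// ltn_neqAle Hp andbT.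
      by apply/eqP => SK; apply: ne; exists K.
    by move=> /pmin; rewrite leqNgt prednK ?leqnn.
  by rewrite -SK.
apply/eqyP => A A0.
have [K HK] : exists K, (Num.bound A < S K)%N.
  apply: contrapT => H; apply: unb; exists (Num.bound A) => K.
  by rewrite leqNgt; apply/negP => HK; apply: H; exists K.
apply: le_trans (SE K); rewrite lee_fin.
apply: le_trans (_ : (Num.bound A)%:R <= _)%R; last by rewrite ler_nat ltnW.
by apply: ltW; apply: archi_boundP; exact: ltW.
Qed.

Lemma measurable_stretches k : measurable_fun [set: seqspace R] (stretches k : seqspace R -> finseq R).
Proof. by apply: measurable_stretch => i; exact: measurable_coord. Qed.

Lemma measurable_point_count (A : set (finseq R)) : measurable A ->
  measurable_fun [set: seqspace R] (point_count R stretches A).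
Proof.
move=> mA; apply: (eq_measurable_fun (fun u : seqspace R => \sum_(k <oo | k \in predT)
   (\1_A (stretches k u))%:E)).
  by move=> u _; apply: eq_eseriesl.
apply: ge0_emeasurable_sum => [k u _ _|k _]; first by rewrite lee_fin.
apply/measurable_EFinP.
exact: (measurableT_comp (measurable_indic mA) (measurable_stretches k)).
Qed.

Lemma point_countE (A : set (finseq R)) u : point_count R stretches A u =
  \sum_(k <oo) ((stretches k u \in A)%:R)%:E.
Proof. by apply: eq_eseriesr => k _; rewrite diracE. Qed.

Lemma measurable_count_eq (A : set (finseq R)) (x : \bar R) : measurable A ->
  measurable [set u | point_count R stretches A u = x].
Proof.
move=> mA; apply: (measurable_fun_preimage (B := [set x]) (measurable_point_count mA)).
exact: emeasurable_set1.
Qed.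

Section family.
Variables (m : nat) (B : 'I_m -> set (finseq R)).
Hypotheses (mB : forall i, measurable (B i)) (tB : trivIset setT B).

(** The level probabilities converge in two ways: to the probability of the
    event without level, because every finite count is eventually the count
    above the level; and to the product of Poisson masses, because the mean
    measures increase to their value without level. *)
Lemma counts_prob (n : 'I_m -> nat) :
  P [set u | forall i, point_count R stretches (B i) u = (n i)%:R%:E] =
  (\prod_i count_mass (theta%:E * stretch_mean (B i)) (n i))%:E.
Proof.
set F := [set u | _].
have mF : measurable F.
  rewrite (_ : F = \bigcap_(i in [set: 'I_m])
      [set u | point_count R stretches (B i) u = (n i)%:R%:E]).
    apply: fin_bigcap_measurable; first exact: finite_finset.
    by move=> i _; exact: measurable_count_eq.
  by apply/seteqP; split => [u H i _|u H i]; [exact: H|exact: (H i I)].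
have mc := measurable_colour mB tB.
have lim1 : (fun j => P (level_counts B (level j) n)) @ \oo --> P F.
  apply: (@prob_cvg_eventually R _ _ P _ F descending) => //.
  - by move=> j; exact: measurable_level_counts.
  - exact: measurable_descending.
  - exact: (descending_prob theta_gt0 HP).
  move=> u du.
  have H (i : 'I_m) : exists j0, forall j, (j0 <= j)%N ->
      (point_count R stretches (B i `&` high (level j)) u = (n i)%:R%:E) <->
      (point_count R stretches (B i) u = (n i)%:R%:E).
    have [j0 H] := @bool_series_eventually R (fun k => stretches k u \in B i)
      (fun j k => stretches k u \in high (level j)) (n i) (fun k => stretch_high k du).
    exists j0 => j /H; rewrite !point_countE => {}H.
    have -> : \sum_(k <oo) ((stretches k u \in B i `&` high (level j))%:R)%:E =
        \sum_(k <oo) ((stretches k u \in B i) &&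
          (stretches k u \in high (level j)))%:R%:E :> \bar R.
      by apply: eq_eseriesr => k _; rewrite in_setI.
    exact: H.
  have /choice[j0 Hj0] := H.
  exists (\max_i j0 i)%N => j j0j; split.
    by move=> [_ Hl] i; apply/(Hj0 i); [exact: leq_trans (leq_bigmax i) j0j|exact: Hl].
  move=> HF; split; first by have [hit _] := du; exact: hit.
  by move=> i; apply/(Hj0 i); [exact: leq_trans (leq_bigmax i) j0j|exact: HF].
have lim2 : (fun j => P (level_counts B (level j) n)) @ \oo -->
    (\prod_i count_mass (theta%:E * stretch_mean (B i)) (n i))%:E.
  under eq_fun do rewrite (level_counts_prob theta_gt0 HP mB tB _ (level01 _)).
  apply: cvg_EFin; first exact: nearW.
  apply: (cvg_big (@mul_continuous R)) => i _.
  have mhigh j : measurable (B i `&` high (level j : R)).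
    by apply: measurableI => //; exact: measurable_high.
  apply: count_mass_cvg.
  - move=> j; apply: mule_ge0; first by rewrite lee_fin ltW.
    by rewrite stretch_meanE//; apply: int01_ge0 => y; exact: tail_vol_ge0.
  - move=> j; rewrite (_ : B i = [set s | colour B s = Some i]).
      by rewrite -(colour_mass1E (level01 j) mc) -EFinM ltry.
    apply/seteqP; split => s /=.
      by move=> /mem_set; rewrite -(colour_Some tB) => /eqP.
    by move=> /eqP; rewrite (colour_Some tB) => /set_mem.
  - by apply: cvgeZl => //; exact: stretch_mean_high_cvg.
exact: (cvg_unique _ lim1 lim2).
Qed.

End family.

End counts.

(** * Poisson process of the stretches *)

Section independence.
Context {R : realType} (theta : R).
Hypothesis theta_gt0 : (0 < theta)%R.
Variable P : probability (seqspace R) R.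
Hypothesis HP : is_Ptheta theta P.
Local Open Scope ereal_scope.

Definition mean (A : set (finseq R)) : \bar R := theta%:E * stretch_mean A.

Local Notation N := (point_count R stretches).

Lemma mean_ge0 A : measurable A -> 0 <= mean A.
Proof.
move=> mA; apply: mule_ge0; first by rewrite lee_fin ltW.
by rewrite stretch_meanE//; apply: int01_ge0 => y; exact: tail_vol_ge0.
Qed.

Lemma stretch_mean0 : stretch_mean (set0 : set (finseq R)) = 0.
Proof.
rewrite stretch_meanE// -[RHS](mul0e (int01 (fun=> 1))) -int01Zl//.
apply: eq_int01 => y _; rewrite mul0e; apply: eseries0 => a _ _.
rewrite -[RHS](mul0e (int01n a (fun=> 1))) -int01nZl//.
by apply: eq_int01n => s _ _; rewrite mul0e in_set0 andbF.
Qed.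

Lemma point_count0 (u : seqspace R) : N set0 u = 0.
Proof. by rewrite point_countE; apply: eseries0 => k _ _; rewrite in_set0. Qed.

Lemma count_mass0 : count_mass (0 : \bar R) 0 = 1%R.
Proof.
rewrite /count_mass; case: eqP => // _.
by rewrite /poisson_mass /= oppr0 expR0 expr0 fact0 divr1 mul1r.
Qed.

Lemma probI_as d (T : measurableType d) (Q : probability T R) (F G : set T) :
  measurable F -> measurable G -> Q G = 1 -> Q (F `&` G) = Q F.
Proof.
move=> mF mG QG; rewrite -[in RHS](setIT F) -(setUv G) setIUr measureU//; last 3 first.
- exact: measurableI.
- by apply: measurableI => //; exact: measurableC.
- by rewrite setIACA setICr setI0.
rewrite [X in _ + X](_ : _ = 0) ?adde0//.
apply/eqP; rewrite -measure_le0.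
apply: (@le_trans _ _ (Q (~` G))).
  apply: le_measure; last exact: subIsetr.
    by rewrite inE; apply: measurableI => //; exact: measurableC.
  by rewrite inE; exact: measurableC.
by rewrite probability_setC// QG subee.
Qed.

Section family.
Variables (m : nat) (B : 'I_m -> set (finseq R)).
Hypotheses (mB : forall i, measurable (B i)) (tB : trivIset setT B).

Let cm i (k : nat) : R := count_mass (mean (B i)) k.

(** The sets outside [K] are replaced by the empty set, whose count and mean
    are 0. *)
Lemma counts_prob_seq (K : seq 'I_m) (k : 'I_m -> nat) : uniq K ->
  P [set u | forall i, i \in K -> N (B i) u = (k i)%:R%:E] =
  (\prod_(i <- K) cm i (k i))%:E.
Proof.
move=> uK.
pose B' i := if i \in K then B i else set0.
pose k' i := if i \in K then k i else 0%N.
have mB' i : measurable (B' i) by rewrite /B'; case: ifP.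
have tB' : trivIset setT B'.
  apply/trivIsetP => i j _ _ ij; rewrite /B'.
  case: ifP => _; last by rewrite set0I.
  case: ifP => _; last by rewrite setI0.
  by move/trivIsetP : tB; apply.
have := counts_prob theta_gt0 HP mB' tB' k'.
rewrite (_ : [set u | forall i, N (B' i) u = (k' i)%:R%:E] =
    [set u | forall i, i \in K -> N (B i) u = (k i)%:R%:E]); last first.
  apply/seteqP; split => u /= H i.
    by move=> iK; have := H i; rewrite /B' /k' iK.
  rewrite /B' /k'; case: ifP => [|_]; first exact: H.
  exact: point_count0.
move=> ->; congr EFin; rewrite [RHS]big_uniq//= [RHS]big_mkcond/=.
apply: eq_bigr => i _; rewrite /B' /k'; case: ifP => // _.
by rewrite stretch_mean0 mule0 count_mass0.
Qed.

Lemma count_prob i n : P [set u | N (B i) u = n%:R%:E] = (cm i n)%:E.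
Proof.
have := @counts_prob_seq [:: i] (fun=> n) isT; rewrite big_seq1 => <-.
congr (P _); apply/seteqP; split => u /= H; last by apply: H; rewrite inE.
by move=> j; rewrite inE => /eqP ->.
Qed.

Lemma cm_ge0 i n : (0 <= cm i n)%R.
Proof. by rewrite -lee_fin -count_prob. Qed.

Let finite_count i : set (seqspace R) := \bigcup_n [set u | N (B i) u = n%:R%:E].

Let m_eq i n : measurable [set u | N (B i) u = n%:R%:E].
Proof. exact: measurable_count_eq. Qed.

Let mfin i : measurable (finite_count i).
Proof. exact: bigcupT_measurable. Qed.

Let prob_finite_series i : P (finite_count i) = \sum_(n <oo) (cm i n)%:E.
Proof.
rewrite /finite_count measure_bigcup//.
  transitivity (\sum_(n <oo) P [set u | N (B i) u = n%:R%:E]).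
    by apply: eq_eseriesl => n; rewrite in_setT.
  by apply: eq_eseriesr => n _; exact: count_prob.
apply/trivIsetP => n n' _ _ /eqP nn'; apply/seteqP; split => // u /= [-> [/eqP]].
by rewrite eqr_nat => /eqP.
Qed.

Lemma count_infinite_prob i : mean (B i) = +oo -> P [set u | N (B i) u = +oo] = 1.
Proof.
move=> moo.
have f0 : P (finite_count i) = 0.
  rewrite prob_finite_series eseries0// => n _ _.
  by rewrite /cm /count_mass moo eqxx.
rewrite (_ : [set u | _] = ~` finite_count i).
  by rewrite probability_setC// f0 sube0.
apply/seteqP; split => u /=; first by move=> Nu [n _]; rewrite /= Nu.
move=> H; have := @bool_series_value R (fun k => stretches k u \in B i).
rewrite -(point_countE (B i) u) => -[//|[n Hn]].
by exfalso; apply: H; exists n.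
Qed.

Lemma count_finite_prob i : mean (B i) != +oo -> P (finite_count i) = 1.
Proof.
move=> moo; rewrite prob_finite_series -(@poisson_mass_sum R (fine (mean (B i)))).
  by apply: eq_eseriesr => n _; rewrite /cm /count_mass (negPf moo).
by rewrite fine_ge0// mean_ge0.
Qed.

(** When the mean is finite the count is almost surely a natural number, and an
    event about it is a countable union over its values. *)
Lemma prob_count_decomp (E : set (seqspace R)) (A : set (\bar R)) i :
  measurable E -> measurable A -> mean (B i) != +oo ->
  P (E `&` [set u | A (N (B i) u)]) =
  \sum_(n <oo) (if n%:R%:E \in A then P (E `&` [set u | N (B i) u = n%:R%:E]) else 0).
Proof.
move=> mE mA moo.
have mNA : measurable [set u | A (N (B i) u)].
  exact: (measurable_fun_preimage (measurable_point_count (mB i)) mA).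
rewrite -(probI_as _ (mfin i) (count_finite_prob moo)); last exact: measurableI.
pose F n := if n%:R%:E \in A then E `&` [set u | N (B i) u = n%:R%:E] else set0.
rewrite (_ : _ `&` finite_count i = \bigcup_n F n).
  rewrite measure_bigcup//.
  - transitivity (\sum_(n <oo) P (F n)).
      by apply: eq_eseriesl => n; rewrite in_setT.
    by apply: eq_eseriesr => n _; rewrite /F; case: ifP => // _; rewrite measure0.
  - by move=> n _; rewrite /F; case: ifP => // _; exact: measurableI.
  - apply/trivIsetP => n n' _ _ /eqP nn'; apply/seteqP; split => // u.
    rewrite /F; case: ifP => _ []; last by [].
    move=> [_ /= Nn]; case: ifP => // _ [_ /=]; rewrite Nn => -[/eqP].
    by rewrite eqr_nat => /eqP.
apply/seteqP; split => u.
  move=> [[Eu /= Au] [n _ /= Nn]]; exists n => //; rewrite /F ifT//.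
  by rewrite inE -Nn.
move=> [n _]; rewrite /F; case: ifP => // nA [Eu /= Nn]; split; last by exists n.
by split => //=; rewrite Nn; exact: set_mem.
Qed.

(** The sets in [K] have counts fixed at natural numbers and those in [J] are
    subject to arbitrary events. Moving one index from [J] to [K] costs a sum
    over its possible values; for a set of infinite mean the count is almost
    surely infinite and its event is trivial. The case where [K] is empty is
    the independence of the counts. *)
Lemma counts_independence (J K : seq 'I_m) (A : 'I_m -> set (\bar R)) (k : 'I_m -> nat) :
  uniq (J ++ K) -> (forall i, measurable (A i)) ->
  P ([set u | forall i, i \in J -> A i (N (B i) u)] `&`
     [set u | forall i, i \in K -> N (B i) u = (k i)%:R%:E]) =
  \prod_(i <- J) P [set u | A i (N (B i) u)] * (\prod_(i <- K) cm i (k i))%:E.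
Proof.
move=> + mA; elim: J K k => [|i J IH] K k.
  rewrite big_nil mul1e /= => uK; rewrite -counts_prob_seq//.
  by congr (P _); apply/seteqP; split => u /=; [case|].
rewrite [uniq _]/= => /andP[iJK uJK].
have mNA j : measurable [set u | A j (N (B j) u)].
  exact: (measurable_fun_preimage (measurable_point_count (mB j)) (mA j)).
pose EJ := [set u : seqspace R | forall i, i \in J -> A i (N (B i) u)].
pose EK := [set u : seqspace R | forall i, i \in K -> N (B i) u = (k i)%:R%:E].
have mE (L : seq 'I_m) (Q : 'I_m -> set (seqspace R)) : (forall j, measurable (Q j)) ->
    measurable [set u | forall j, j \in L -> Q j u].
  move=> mQ; rewrite (_ : mkset _ = \bigcap_(j in [set` L]) Q j); last first.
    by apply/seteqP; split => u /= H j; [move=> /H|exact: H].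
  apply: fin_bigcap_measurable => // ; exact: finite_seq.
have mEJ : measurable EJ by apply: (mE J (fun j => [set u | A j (N (B j) u)])).
have mEK : measurable EK by apply: (mE K (fun j => [set u | N (B j) u = (k j)%:R%:E])).
have splitE : [set u | forall j, j \in i :: J -> A j (N (B j) u)] `&` EK =
    (EJ `&` EK) `&` [set u | A i (N (B i) u)].
  apply/seteqP; split => u.
    move=> [H HK]; split; last by apply: H; rewrite mem_head.
    by split => // j jJ; apply: H; rewrite inE jJ orbT.
  move=> [[HJ HK] Hi]; split => // j; rewrite inE => /predU1P[->//|]; exact: HJ.
rewrite -/EK splitE big_cons.
have [moo|moo] := eqVneq (mean (B i)) +oo.
  have moo1 := count_infinite_prob moo.
  have mi : measurable [set u | N (B i) u = +oo] by exact: measurable_count_eq.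
  rewrite -(probI_as _ mi moo1); last by apply: measurableI => //; exact: measurableI.
  rewrite -(probI_as (mNA i) mi moo1).
  have [Ai|Ai] := pselect (A i +oo).
    have -> : [set u | A i (N (B i) u)] `&` [set u | N (B i) u = +oo] =
        [set u | N (B i) u = +oo].
      by apply/seteqP; split => u /=; [case|move=> Nu; rewrite Nu].
    rewrite moo1 mul1e -IH// -[RHS](probI_as _ mi moo1); last exact: measurableI.
    congr (P _); apply/seteqP; split => u /=; first by move=> [[H _] Nu].
    by move=> [H Nu]; rewrite Nu.
  have -> : [set u | A i (N (B i) u)] `&` [set u | N (B i) u = +oo] = set0.
    by apply/seteqP; split => u //= -[+ Nu]; rewrite Nu.
  have -> : EJ `&` EK `&` [set u | A i (N (B i) u)] `&` [set u | N (B i) u = +oo] = set0.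
    by apply/seteqP; split => u //= -[[_ +] Nu]; rewrite Nu.
  by rewrite measure0 !mul0e.
rewrite prob_count_decomp//; last exact: measurableI.
have -> : P [set u | A i (N (B i) u)] =
    \sum_(n <oo) (if n%:R%:E \in A i then (cm i n)%:E else 0).
  rewrite -[X in P X]setTI prob_count_decomp//.
  by apply: eq_eseriesr => n _; rewrite setTI count_prob.
rewrite -muleA muleC -nneseriesMl; last 2 first.
- rewrite mule_ge0//; first by apply: prode_ge0 => j _.
  by rewrite lee_fin prodr_ge0// => j _; exact: cm_ge0.
- by move=> n; case: ifP => // _; rewrite lee_fin cm_ge0.
apply: eq_eseriesr => n _; case: ifP => _; last by rewrite mule0.
(* the index [i] moves to [K] with prescribed count [n] *)
pose k' j := if j == i then n else k j.
have eK j : j \in K -> k' j = k j.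
  move=> jK; rewrite /k'; case: eqP => // ji.
  by move: iJK; rewrite mem_cat -ji jK orbT.
have uJiK : uniq (J ++ i :: K).
  by rewrite uniq_catC /= mem_cat orbC -mem_cat iJK uniq_catC.
have := IH (i :: K) k' uJiK.
rewrite big_cons [k' i]/k' eqxx (eq_big_seq (fun j => cm j (k j))); last first.
  by move=> j /eK ->.
rewrite EFinM [(cm i n)%:E * _]muleC muleA => <-.
congr (P _); apply/seteqP; split => u.
  move=> [[HJ HK] Hi]; split => // j; rewrite inE => /predU1P[->|jK].
    by rewrite /k' eqxx.
  by rewrite eK//; exact: HK.
move=> [HJ HK]; split; last by have := HK i; rewrite mem_head /k' eqxx; apply.
by split => // j jK; rewrite HK ?inE ?jK ?orbT// eK.
Qed.

End family.
End independence.

Section poisson.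
Context {R : realType} (theta : R).
Hypothesis theta_gt0 : (0 < theta)%R.
Variable P : probability (seqspace R) R.
Hypothesis HP : is_Ptheta theta P.
Local Open Scope ereal_scope.

Lemma stretches_poisson : is_poisson_process P stretches (mean theta).
Proof.
have tI1 (B : set (finseq R)) : trivIset setT (fun _ : 'I_1 => B).
  by apply/trivIsetP => i j _ _ /eqP; rewrite !ord1.
split.
- by move=> B; exact: measurable_point_count.
- move=> B mB moo n; rewrite (count_prob theta_gt0 HP (fun=> mB) (tI1 B) ord0).
  by rewrite /count_mass ifF//; apply/negbTE; rewrite lt_eqF.
- move=> B mB moo.
  exact: (count_infinite_prob theta_gt0 HP (fun=> mB) (tI1 B) (i := ord0) moo).
move=> m B mB tB J A uJ mA.
have := counts_independence theta_gt0 HP mB tB (K := [::]) (fun=> 0%N) _ mA.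
move=> /(_ J); rewrite cats0 big_nil mule1 => /(_ uJ) <-.
by congr (P _); apply/seteqP; split => u //= -[].
Qed.

End poisson.

Section image.
Context d (T : measurableType d) d' (T' : measurableType d') d'' (E : measurableType d'').
Context (R : realType) (Q : probability T R) (P : probability T' R).
Variable U : {mfun T >-> T'}.
Hypothesis QP : forall A, measurable A -> distribution Q U A = P A.
Local Open Scope ereal_scope.

(** Being a Poisson process is a property of the joint law of the counts, hence
    only of the law of the sequence from which the points are built. *)
Lemma poisson_process_comp (V : nat -> T' -> E) (nu : set E -> \bar R) :
  is_poisson_process P V nu -> is_poisson_process Q (fun k w => V k (U w)) nu.
Proof.
move=> [mN fN oN iN].
have QU (A : set T') : measurable A -> Q (U @^-1` A) = P A by exact: QP.
have mNA B (A : set (\bar R)) : measurable B -> measurable A ->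
    measurable [set u | A (point_count R V B u)].
  by move=> mB mA; exact: (measurable_fun_preimage (mN B mB) mA).
split.
- by move=> B /mN mNB; exact: (measurableT_comp mNB (@measurable_funPT _ _ _ _ U)).
- move=> B mB moo n; rewrite -fN// -QU//.
  exact: (mNA B [set n%:R%:E] mB (emeasurable_set1 _)).
- move=> B mB moo; rewrite -(oN _ mB moo) -QU//.
  exact: (mNA B [set +oo] mB (emeasurable_set1 _)).
move=> m B mB tB J A uJ mA.
have -> : \prod_(i <- J) Q [set w | A i (point_count R (fun k w => V k (U w)) (B i) w)] =
    \prod_(i <- J) P [set u | A i (point_count R V (B i) u)].
  by apply: eq_bigr => i _; rewrite -QU//; exact: mNA.
rewrite -(iN m B mB tB J A uJ mA) -QU//.
rewrite (_ : mkset _ = \bigcap_(i in [set` J]) [set u | A i (point_count R V (B i) u)]).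
  by apply: fin_bigcap_measurable => [|i _]; [exact: finite_seq|exact: mNA].
by apply/seteqP; split => u /= H i; [move=> /H|exact: H].
Qed.

End image.

Section almost_sure.
Context {R : realType} (theta : R).
Hypothesis theta_gt0 : (0 < theta)%R.
Variable P : probability (seqspace R) R.
Hypothesis HP : is_Ptheta theta P.
Local Open Scope ereal_scope.

Lemma descending_no_min (u : seqspace R) : descending u -> ~ exists i, forall j, (u i <= u j)%R.
Proof.
move=> [hit u0] [i Hi]; have [j0 H] := level_small (u0 i).
have [L uL] := hit j0; have := le_lt_trans uL (H j0 (leqnn _)).
by rewrite ltNge Hi.
Qed.

Definition tie i j : set (seqspace R) := [set u | u i = u j].

Lemma measurable_eqr d (Y : measurableType d) (f g : Y -> R) :
  measurable_fun [set: Y] f -> measurable_fun [set: Y] g ->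
  measurable [set y | f y = g y].
Proof.
move=> mf mg; rewrite (_ : mkset _ = [set y | (f y <= g y)%R] `&` [set y | (g y <= f y)%R]).
  by apply: measurableI; exact: measurable_leb.
apply/seteqP; split => y /=; first by move=> ->.
by move=> [fg gf]; apply/eqP; rewrite eq_le fg.
Qed.

Lemma measurable_tie i j : measurable (tie i j).
Proof. by apply: measurable_eqr; exact: measurable_coord. Qed.

(** The density of the prefix of length [j.+1], integrated first over its last
    term, gives no mass to the single value [u i]. *)
Lemma tie_prob i j : (i < j)%N -> P (tie i j) = 0.
Proof.
move=> ij.
pose A : set (finseq R) := [set s | nth 0%R s i = nth 0%R s j].
have mA : measurable A by apply: measurable_eqr; exact: measurable_nth.
transitivity (P [set u | A (mkseq u j.+1)]).
  congr (P _); apply/seteqP; split => u; rewrite /tie /A /= !nth_mkseq//; exact: ltnW.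
rewrite (prefix_prob theta_gt0 HP)// int01n_rcons -[RHS](mul0e (int01n j (fun=> 1))) -int01nZl//.
apply: eq_int01n => s sj _; rewrite mul0e.
rewrite (@eq_int01_but1 _ (nth 0%R s i) _ (fun=> 0)); last 3 first.
- have mr : measurable_fun [set: R] (fun y : R => rcons s y : finseq R).
    by apply: (measurable_rconsf (f := id) (F := fun=> s : finseq R)) => //; exact: measurable_cst.
  apply: emeasurable_funM; apply/measurable_EFinP.
    exact: (measurableT_comp (measurable_indic mA) mr).
  exact: (measurableT_comp (measurable_dens theta) mr).
- exact: measurable_cst.
- move=> z zs; rewrite indicE memNset ?mul0e// /A /= !nth_rcons sj ij ltnn eqxx.
  by move=> zE; rewrite zE eqxx in zs.
by rewrite /int01 integral0.
Qed.

Lemma distinct_prob : P (\bigcap_i \bigcap_j (if (i < j)%N then ~` tie i j else setT)) = 1.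
Proof.
have mF i j : measurable (if (i < j)%N then ~` tie i j else setT).
  by case: ifP => // _; apply: measurableC; exact: measurable_tie.
apply: prob_bigcap1 => i; first exact: bigcapT_measurable.
apply: prob_bigcap1 => // j; case: ifP => [ij|_]; last exact: probability_setT.
by rewrite probability_setC ?tie_prob ?sube0//; exact: measurable_tie.
Qed.

Lemma distinctE : \bigcap_i \bigcap_j (if (i < j)%N then ~` tie i j else setT) =
  [set u : seqspace R | injective (u : nat -> R)].
Proof.
apply/seteqP; split => [u H i j uij|u inju i _ j _].
  by have [ij|ji|//] := ltngtP i j; [have := H i I j I; rewrite ij|
    have := H j I i I; rewrite ji] => /(_ _) []; rewrite /tie /= uij.
by case: ifP => // ij /inju ijE; rewrite ijE ltnn in ij.
Qed.

Lemma measurable_injective : measurable [set u : seqspace R | injective (u : nat -> R)].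
Proof.
rewrite -distinctE; apply: bigcapT_measurable => i; apply: bigcapT_measurable => j.
by case: ifP => // _; apply: measurableC; exact: measurable_tie.
Qed.

Lemma descending_injective_prob : P (descending `&` [set u : seqspace R | injective (u : nat -> R)]) = 1.
Proof.
apply: probI1; [exact: measurable_descending|exact: measurable_injective| |].
  exact: (descending_prob theta_gt0 HP).
by rewrite -distinctE; exact: distinct_prob.
Qed.

End almost_sure.

(** * Densities of prefixes *)

Section prefix_events.
Context {R : realType} (theta : R).
Hypothesis theta_gt0 : (0 < theta)%R.
Variable P : probability (seqspace R) R.
Hypothesis HP : is_Ptheta theta P.
Local Open Scope ereal_scope.

Lemma seq_tuple_mkseq n m (u : seqspace R) : (n <= m)%N ->
  seq_tuple n (mkseq u m) = prefix_tuple n u.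
Proof.
move=> nm; apply: eq_from_tnth => i; rewrite !tnth_mktuple nth_mkseq//.
exact: leq_trans (ltn_ord i) nm.
Qed.

Lemma prefix_preimage n (A : set (n.-tuple R)) :
  prefix_tuple n @^-1` A =
  [set u : seqspace R | (@seq_tuple R n @^-1` A) (mkseq u n)].
Proof. by apply/seteqP; split => u /=; rewrite /preimage /= seq_tuple_mkseq. Qed.

Lemma prefix_integral n (A : set (n.-tuple R)) (f : finseq R -> \bar R) : (0 < n)%N ->
  measurable A -> (forall s, 0 <= f s) -> measurable_fun [set: finseq R] f ->
  \int[P]_(u in prefix_tuple n @^-1` A) f (mkseq u n) =
  int01n n (fun s => (\1_(@seq_tuple R n @^-1` A) s)%:E * f s * (dens theta s)%:E).
Proof.
move=> n0 mA f0 mf.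
rewrite -(@prefix_law _ _ theta_gt0 P HP _
  (fun s => (\1_(@seq_tuple R n @^-1` A) s)%:E * f s)) => [|//|s|]; last 2 first.
- by rewrite mule_ge0// lee_fin.
- apply: emeasurable_funM => //; apply/measurable_EFinP/measurable_indic.
  exact: measurable_seq_tuple_preimage.
rewrite integral_mkcond; apply: eq_integral => u _; rewrite patchE indicE.
rewrite prefix_preimage (_ : (u \in _) = ((mkseq u n : finseq R) \in @seq_tuple R n @^-1` A)).
  by case: (_ \in _); rewrite ?mul1e ?mul0e.
by apply/idP/idP; rewrite !inE.
Qed.

(** The mass below [m] of the conditional density given the minimum [m] is [m]
    times the total mass of a Beta density: the probability of a new record. *)
Lemma int01_step_head (m : R) : (0 < m < 1)%R ->
  int01 (fun y => b2e (y < m)%R * (step_density theta m y)%:E) = m%:E.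
Proof.
move=> m01; have [m0 _] := andP m01.
transitivity (int01 (fun y => (m `^ (1 - theta))%:E *
    (b2e (y <= m)%R * (theta * y `^ (theta - 1))%:E))).
  have mpow : measurable_fun [set: R] (fun y : R => (theta * y `^ (theta - 1))%:E).
    apply/measurable_EFinP; apply: measurable_funM; first exact: measurable_cst.
    exact: measurable_powR.
  transitivity (int01 (fun y => b2e (y < m)%R * (m `^ (1 - theta) * (theta * y `^ (theta - 1)))%:E)).
    apply: eq_int01 => y y01; rewrite /step_density y01; have [y0 _] := andP y01.
    have [ym|_] := ltP y m; last by rewrite b2e0 !mul0e.
    congr (_ * _%:E); rewrite mulrCA; congr (_ * _)%R.
    have -> : (1 - theta = - (theta - 1))%R by ring.
    by rewrite powRM ?invr_ge0 ?ltW// mulrC -powR_inv1 ?ltW// -powRrM mulN1r.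
  apply: (@eq_int01_but1 _ m).
  - apply: emeasurable_funM.
      by apply: measurable_b2e; apply: measurable_ltb => //; exact: measurable_cst.
    apply/measurable_EFinP; apply: measurable_funM; first exact: measurable_cst.
    exact/measurable_EFinP.
  - apply: emeasurable_funM; first exact: measurable_cst.
    apply: emeasurable_funM => //.
    by apply: measurable_b2e; apply: measurable_leb => //; exact: measurable_cst.
  - by move=> z zm; rewrite le_eqVlt (negPf zm) EFinM muleCA.
rewrite int01Zl; last 3 first.
- by rewrite lee_fin powR_ge0.
- by move=> y; rewrite mule_ge0 ?b2e_ge0// lee_fin mulr_ge0 ?powR_ge0// ltW.
- apply: emeasurable_funM.
    by apply: measurable_b2e; apply: measurable_leb => //; exact: measurable_cst.
  apply/measurable_EFinP; apply: measurable_funM; first exact: measurable_cst.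
  exact: measurable_powR.
rewrite (int01_powR_head theta_gt0 HP m01) -EFinM -powRD ?subrK ?powRr1 ?ltW//.
by apply/implyP => _; rewrite gt_eqF.
Qed.

Lemma seq_min01 n (s : seq R) : size s = n.+1 -> (forall x, x \in s -> (0 < x < 1)%R) ->
  (0 < seq_min s < 1)%R.
Proof.
move=> sn s01; have s0 : s != [::] by rewrite -size_eq0 sn.
rewrite lt_seq_min//; apply/andP; split; first by apply/allP => x /s01 /andP[].
rewrite ltNge le_seq_min//; apply/negP => /allP.
case: s s0 s01 {sn} => // x s _ s01 /(_ x); rewrite mem_head => /(_ isT).
by have /andP[_ x1] := s01 x (mem_head _ _); rewrite leNgt x1.
Qed.

(** The last term of the prefix of length [n.+1] is integrated over the values
    below the minimum of the others, which by [int01_step_head] replaces the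
    indicator of a record by that minimum. *)
Lemma next_record_prob n (A : set (n.-tuple R)) : (0 < n)%N -> measurable A ->
  P (prefix_tuple n @^-1` A `&` [set u : seqspace R | lower_record u n]) =
  \int[P]_(u in prefix_tuple n @^-1` A) (tuple_min (prefix_tuple n u))%:E.
Proof.
case: n A => // n A _ mA.
set A' := @seq_tuple R n.+1 @^-1` A.
have mA' : measurable A' by exact: measurable_seq_tuple_preimage.
pose C : set (finseq R) := A' `&` [set s | (nth 0 s n.+1 < seq_min (take n.+1 s))%R].
have mC : measurable C.
  apply: measurableI => //; apply: measurable_ltb; first exact: measurable_nth.
  exact: (measurableT_comp measurable_seq_min (measurable_takef _)).
transitivity (P [set u | C (mkseq u n.+2)]).
  congr (P _); rewrite prefix_preimage -/A'.
  have tE (u : seqspace R) : take n.+1 (mkseq u n.+2) = mkseq u n.+1.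
    by rewrite mkseqS -cats1 take_size_cat// size_mkseq.
  have nE (u : seqspace R) : nth 0%R (mkseq u n.+2) n.+1 = u n.+1 by rewrite nth_mkseq.
  apply/seteqP; split => u [Au un]; split.
  - by move: Au; rewrite /A' /preimage /= !seq_tuple_mkseq.
  - have : lower_record u n.+1 by [].
    by rewrite lower_record_mkseq// -{1}(nE u) -(tE u).
  - by move: Au; rewrite /A' /preimage /= !seq_tuple_mkseq.
  - have : (nth 0%R (mkseq u n.+2) n.+1 < seq_min (take n.+1 (mkseq u n.+2)))%R by [].
    by rewrite nE tE -lower_record_mkseq.
rewrite (prefix_prob theta_gt0 HP)// int01n_rcons.
(* absolute values make the integrand nonnegative on every sequence; almost
   surely they change nothing *)
transitivity (\int[P]_(u in prefix_tuple n.+1 @^-1` A) (`|seq_min (mkseq u n.+1)|)%:E).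
  rewrite (@prefix_integral n.+1 A (fun s => `|seq_min s|%:E))//; last first.
    by apply/measurable_EFinP; apply: measurableT_comp => //; exact: measurable_seq_min.
  apply: eq_int01n => s sn s01; have m01 := seq_min01 sn s01; have [m0 _] := andP m01.
  rewrite gtr0_norm// -(int01_step_head m01) -/A'.
  have mb : measurable_fun [set: R] (fun y : R => b2e (y < seq_min s)%R : \bar R).
    by apply: measurable_b2e; apply: measurable_ltb => //; exact: measurable_cst.
  have ms : measurable_fun [set: R] (fun y : R => (step_density theta (seq_min s) y)%:E).
    apply/measurable_EFinP.
    exact: (measurableT_comp (measurable_step_density theta) (pair1_measurable (seq_min s))).
  rewrite muleAC -int01Zl; last 3 first.
  - by rewrite mule_ge0// lee_fin ?dens_ge0.
  - by move=> y; rewrite mule_ge0 ?b2e_ge0// lee_fin step_density_ge0.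
  - exact: emeasurable_funM.
  apply: eq_int01 => y y01; rewrite dens_rcons//; last by rewrite -size_eq0 sn.
  have -> : (\1_C (rcons s y))%:E = (\1_A' s)%:E * b2e (y < seq_min s)%R :> \bar R.
    rewrite !indicE /b2e -EFinM -natrM mulnb; congr ((nat_of_bool _)%:R)%:E.
    have tE : seq_tuple n.+1 (rcons s y : finseq R) = seq_tuple n.+1 (s : finseq R).
      apply: eq_from_tnth => i; rewrite !tnth_mktuple nth_rcons sn.
      by rewrite (ltn_ord i).
    have cE : take n.+1 (rcons s y) = s by rewrite -cats1 take_size_cat.
    have nE : nth 0%R (rcons s y) n.+1 = y by rewrite nth_rcons sn ltnn eqxx.
    rewrite in_setI; congr andb; apply/idP/idP; rewrite !inE /A' /preimage /= ?tE//.
      by rewrite cE nE.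
    by rewrite cE nE.
  by rewrite -!muleA; congr *%E; rewrite EFinM muleCA.
rewrite -/A'.
have mfA : measurable (prefix_tuple n.+1 @^-1` A : set (seqspace R)).
  by rewrite -[X in measurable X]setTI; exact: measurable_prefix_tuple.
have mmin : measurable_fun [set: seqspace R] (fun u => seq_min (mkseq u n.+1)).
  exact: (measurableT_comp measurable_seq_min (@measurable_mkseq R n.+1)).
apply: ae_eq_integral => //.
- apply: measurable_funTS; apply/measurable_EFinP; exact: measurableT_comp.
- apply: measurable_funTS; apply/measurable_EFinP.
  by apply: (eq_measurable_fun _ _ mmin) => u _; rewrite -prefix_tupleE.
exists (~` descending); split.
- apply: measurableC; exact: measurable_descending.
- by rewrite [LHS]probability_setC ?(descending_prob theta_gt0 HP) ?subee//; exact: measurable_descending.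
move=> u /= nu [_ u0]; apply: nu => _; rewrite gtr0_norm -?prefix_tupleE//.
rewrite prefix_tupleE lt_seq_min -?size_eq0 ?size_mkseq//.
by apply/allP => x /mapP[i _ ->].
Qed.

Lemma prefix_density n (A : set (n.-tuple R)) : (0 < n)%N -> measurable A ->
  pushforward P (prefix_tuple n) A =
  int01n n (fun s => (\1_(@seq_tuple R n @^-1` A) s)%:E * (dens theta s)%:E).
Proof.
move=> n0 mA; rewrite /pushforward prefix_preimage (prefix_prob theta_gt0 HP)//.
exact: measurable_seq_tuple_preimage.
Qed.

Lemma dens_tuple n (t : n.-tuple R) :
  (theta ^+ nb_records (nth 0 t) n * tuple_min t `^ (theta - 1))%R = dens theta (tval t).
Proof. by rewrite /dens /nb_recs size_tuple. Qed.

Lemma measurable_dens_tuple n :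
  measurable_fun [set: n.-tuple R] (fun t : n.-tuple R =>
    (theta ^+ nb_records (nth 0 t) n * tuple_min t `^ (theta - 1))%R).
Proof.
under eq_fun do rewrite dens_tuple.
exact: (measurableT_comp (measurable_dens theta) (@measurable_tval R n)).
Qed.

Lemma density_dominates d (T : measurableType d) (mu : {measure set T -> \bar R})
    (f : T -> R) (nu : set T -> \bar R) : has_density mu f nu -> nu `<< mu.
Proof.
move=> [mf H]; apply/null_content_dominatesP => A mA A0.
by rewrite H// null_set_integral//; apply: measurable_funTS; exact/measurable_EFinP.
Qed.

Lemma prefix_has_density n : (0 < n)%N ->
  has_density (lebesgue_cube n)
    (fun t => theta ^+ nb_records (nth 0 t) n * tuple_min t `^ (theta - 1))%R
    (pushforward P (prefix_tuple n)).
Proof.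
move=> n0; split; first exact: measurable_dens_tuple.
move=> A mA; rewrite (prefix_density n0 mA).
under eq_integral do rewrite dens_tuple.
rewrite (@integral_lebesgue_cube R n A (fun s => (dens theta s)%:E))//; last 2 first.
- by move=> s; rewrite lee_fin dens_ge0.
- by apply/measurable_EFinP; exact: measurable_dens.
rewrite -integral_iid_uniform; last 2 first.
- by move=> s; rewrite mule_ge0// lee_fin dens_ge0.
- apply: emeasurable_funM; apply/measurable_EFinP; last exact: measurable_dens.
  by apply: measurable_indic; exact: measurable_seq_tuple_preimage.
rewrite [RHS]integral_mkcond; apply: eq_integral => t _; rewrite patchE indicE.
have -> : ((tval t : finseq R) \in @seq_tuple R n @^-1` A) = (t \in A).
  by apply/idP/idP; rewrite !inE /preimage /= seq_tupleK.
by case: (t \in A); rewrite ?mul1e ?mul0e.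
Qed.

End prefix_events.

Section iid.
Context {R : realType}.
Variable P1 : probability (seqspace R) R.
Hypothesis HP1 : is_Ptheta 1 P1.
Local Open Scope ereal_scope.

Lemma dens1 (s : seq R) : dens 1 s = 1%R.
Proof. by rewrite /dens expr1n subrr powRr0 mulr1. Qed.

Lemma uniform_prob_int01 (B : set R) : measurable B ->
  uniform_prob (@ltr01 R) B = int01 (fun x => (\1_B x)%:E).
Proof.
move=> mB; rewrite -int01_uniform; last 2 first.
- by move=> x; rewrite lee_fin.
- exact/measurable_EFinP/measurable_indic.
by rewrite integral_indic// setIT.
Qed.

(** For [theta = 1] the density is identically 1 by [dens1], and the volume of
    a box is the product of the lengths of its sides. *)
Lemma iid_prefix_prob n (B : nat -> set R) : (forall i, measurable (B i)) ->
  P1 [set u : seqspace R | forall i, (i < n)%N -> B i (u i)] =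
  \prod_(i < n) uniform_prob (@ltr01 R) (B i).
Proof.
move=> mB; have [->|n0] := posnP n.
  rewrite big_ord0 -(probability_setT P1); congr (P1 _).
  by apply/seteqP; split.
pose A k : set (finseq R) := [set s | forall i, (i < k)%N -> B i (nth 0%R s i)].
have mA k : measurable (A k).
  rewrite (_ : A k = \bigcap_(i in `I_k) [set s | B i (nth 0%R s i)]).
    apply: fin_bigcap_measurable => [|i _]; first exact: finite_II.
    exact: (measurable_fun_preimage (measurable_nth i) (mB i)).
  by apply/seteqP; split.
transitivity (P1 [set u | A n (mkseq u n)]).
  by congr (P1 _); apply/seteqP; split => u /= H i ni; have := H i ni; rewrite nth_mkseq.
rewrite (prefix_prob ltr01 HP1)//.
under [LHS]eq_int01n do rewrite dens1 mule1.
elim: n {n0} => [|n IH]; first by rewrite big_ord0 /= indicE mem_set.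
rewrite int01n_rcons big_ord_recr/= -IH.
rewrite uniform_prob_int01// muleC -int01nZl; last 3 first.
- by apply: int01_ge0 => x; rewrite lee_fin.
- by move=> s; rewrite lee_fin.
- exact/measurable_EFinP/measurable_indic.
apply: eq_int01n => s sn _; rewrite muleC -int01Zl; last 3 first.
- by rewrite lee_fin.
- by move=> x; rewrite lee_fin.
- exact/measurable_EFinP/measurable_indic.
apply: eq_int01 => x _; rewrite !indicE -EFinM -natrM mulnb; congr ((nat_of_bool _)%:R)%:E.
apply/idP/andP; rewrite !inE.
  move=> H; split; last by have := H n (ltnSn n); rewrite /= nth_rcons sn ltnn eqxx.
  by move=> i ni; have := H i (ltnW ni); rewrite nth_rcons sn ni.
move=> [H Bx] i; rewrite ltnS leq_eqVlt nth_rcons sn => /predU1P[->|ni].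
  by rewrite ltnn eqxx.
by rewrite ni; exact: H.
Qed.

Lemma iid_marginal i (B : set R) : measurable B ->
  P1 [set u : seqspace R | B (u i)] = uniform_prob (@ltr01 R) B.
Proof.
move=> mB; pose B' j := if j == i then B else setT.
have mB' j : measurable (B' j) by rewrite /B'; case: ifP.
transitivity (P1 [set u : seqspace R | forall j, (j < i.+1)%N -> B' j (u j)]).
  congr (P1 _); apply/seteqP; split => u /= H; last by have := H i (ltnSn i); rewrite /B' eqxx.
  by move=> j _; rewrite /B'; case: eqP => // ->.
rewrite iid_prefix_prob// big_ord_recr/= /B' eqxx big1 ?mul1e// => j _.
by rewrite ifF ?probability_setT// ltn_eqF.
Qed.

(** A finite family of coordinates is completed to a whole prefix by trivial
    events. *)
Lemma iid_independent : mutually_independent P1 (fun i (u : seqspace R) => u i).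
Proof.
move=> J A uJ mA; pose n := (\max_(i <- J) i).+1.
have Jn i : i \in J -> (i < n)%N by move=> iJ; rewrite ltnS; exact: leq_bigmax_seq.
pose A' i := if i \in J then A i else setT.
have mA' i : measurable (A' i) by rewrite /A'; case: ifP.
transitivity (P1 [set u : seqspace R | forall i, (i < n)%N -> A' i (u i)]).
  congr (P1 _); apply/seteqP; split => u /= H i.
    by move=> _; rewrite /A'; case: ifP => //; exact: H.
  by move=> iJ; have := H i (Jn i iJ); rewrite /A' iJ.
rewrite iid_prefix_prob//.
transitivity (\prod_(i <- J) uniform_prob (@ltr01 R) (A i)); last first.
  by apply: eq_bigr => i _; rewrite -(iid_marginal i).
rewrite -(big_mkord xpredT (fun i => uniform_prob (@ltr01 R) (A' i))).
rewrite (bigID (mem J))/= [X in _ * X]big1 ?mule1; last first.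
  by move=> i /negPf iJ; rewrite /A' iJ probability_setT.
rewrite -big_filter (perm_big J).
  by apply: eq_big_seq => i iJ; rewrite /A' iJ.
apply: uniq_perm => //; first by rewrite filter_uniq// iota_uniq.
move=> i; rewrite mem_filter mem_index_iota /=; case iJ : (i \in J) => //=.
by rewrite (Jn _ iJ).
Qed.

Variable theta : R.
Hypothesis theta_gt0 : (0 < theta)%R.
Variable P : probability (seqspace R) R.
Hypothesis HP : is_Ptheta theta P.

(** Integrating [dens theta] against the law for [theta = 1] is integrating it
    over the cube. *)
Lemma prefix_relative_density n : (0 < n)%N ->
  has_density (pushforward P1 (prefix_tuple n))
    (fun t => theta ^+ nb_records (nth 0 t) n * tuple_min t `^ (theta - 1))%R
    (pushforward P (prefix_tuple n)).
Proof.
move=> n0; split; first exact: measurable_dens_tuple.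
move=> A mA; rewrite (prefix_density theta_gt0 HP n0 mA).
rewrite (@ge0_integral_pushforward _ _ _ _ _ _ (@measurable_prefix_tuple R n))//; last 2 first.
- apply: measurable_funTS; apply/measurable_EFinP; exact: measurable_dens_tuple.
- by move=> t _; rewrite lee_fin dens_tuple dens_ge0.
transitivity (\int[P1]_(u in prefix_tuple n @^-1` A) (dens theta (mkseq u n))%:E).
  rewrite (prefix_integral ltr01 HP1 (f := fun s => (dens theta s)%:E))//.
  - by apply: eq_int01n => s _ _; rewrite dens1 mule1.
  - by move=> s; rewrite lee_fin dens_ge0.
  - by apply/measurable_EFinP; exact: measurable_dens.
by apply: eq_integral => u _; rewrite -prefix_tupleE -dens_tuple.
Qed.

Lemma prefix_relative_dominates n : (0 < n)%N ->
  pushforward P (prefix_tuple n) `<< pushforward P1 (prefix_tuple n).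
Proof.
move=> n0; have H := prefix_relative_density n0.
by apply: (density_dominates H); exact: measurable_prefix_tuple.
Qed.

End iid.

Theorem theorem1p3 (R : realType) (theta : R) (theta_gt0 : 0 < theta)
    (Ptheta : probability (seqspace R) R) (HPtheta : is_Ptheta theta Ptheta) :
  [/\ forall (n : nat) (A : set (n.-tuple R)), (0 < n)%N -> measurable A ->
        (Ptheta (prefix_tuple n @^-1` A `&`
                 [set u : seqspace R | lower_record u n])
         = \int[Ptheta]_(u in prefix_tuple n @^-1` A)
             (tuple_min (prefix_tuple n u))%:E)%E,
      forall n : nat, (0 < n)%N ->
        pushforward Ptheta (prefix_tuple n) `<< lebesgue_cube n /\
        has_density (lebesgue_cube n)
          (fun t => theta ^+ nb_records (nth 0 t) n *
                    tuple_min t `^ (theta - 1))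
          (pushforward Ptheta (prefix_tuple n)),
      forall P1 : probability (seqspace R) R, is_Ptheta 1 P1 ->
        [/\ forall n : nat, (0 < n)%N ->
              pushforward Ptheta (prefix_tuple n)
                `<< pushforward P1 (prefix_tuple n) /\
              has_density (pushforward P1 (prefix_tuple n))
                (fun t => theta ^+ nb_records (nth 0 t) n *
                          tuple_min t `^ (theta - 1))
                (pushforward Ptheta (prefix_tuple n)),
            forall (i : nat) (B : set R), measurable B ->
              P1 [set u : seqspace R | B (u i)] = uniform_prob (@ltr01 R) B
          & mutually_independent P1 (fun i (u : seqspace R) => u i)]
    & forall (d : measure_display) (T : measurableType d) (P : probability T R)
          (U : {mfun T >-> seqspace R}),
        (forall A, measurable A -> distribution P U A = Ptheta A) ->
        {ae P, forall w, ~ (exists i, forall j, U w i <= U w j) /\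
                         injective (U w)} /\
        is_poisson_process P (fun k w => stretch (U w) k : finseq R)
          (fun B => theta%:E * stretch_mean B)%E].
Proof.
split.
- by move=> n A n0 mA; exact: (next_record_prob theta_gt0 HPtheta).
- move=> n n0; have H := prefix_has_density theta_gt0 HPtheta n0.
  by split; [exact: density_dominates H|exact: H].
- move=> P1 HP1; split; last exact: iid_independent.
    move=> n n0; split; first exact: (prefix_relative_dominates HP1 theta_gt0 HPtheta).
    exact: (prefix_relative_density HP1 theta_gt0 HPtheta).
  by move=> i B mB; exact: iid_marginal.
move=> d T P U PU; split; last exact: (poisson_process_comp PU (stretches_poisson theta_gt0 HPtheta)).
pose G := descending `&` [set u : seqspace R | injective (u : nat -> R)].
have mG : measurable G.
  by apply: measurableI; [exact: measurable_descending|exact: measurable_injective].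
exists (U @^-1` ~` G); split.
- by rewrite -[X in measurable X]setTI; apply: measurable_funPT => //; exact: measurableC.
- rewrite [LHS](PU (~` G)); last exact: measurableC.
  rewrite [LHS]probability_setC// (descending_injective_prob theta_gt0 HPtheta).
  by rewrite subee.
move=> w /= nw [dw iw]; apply: nw; split => //; exact: descending_no_min dw.
Qed.
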